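(* Let $P=(p_1,\ldots,p_m)$ and $Q=(q_1,\ldots,q_n)$ be two sequences of points in $\mathbb{R}^2$ with $m\le n$, and let $\delta>0$. Then one can determine whether there exists a translation $t\in\mathbb{R}^2$ such that $\delta^*(P,Q+t)\le\delta$ in $O(m^3n^2(1+\log(n/m)))$ time.
   Context: For $\delta>0$, let $M_\delta(P,Q)$ be the $m\times n$ $0/1$-matrix whose $(i,j)$ entry is $1$ iff $\|p_i-q_j\|\le\delta$. A path in this matrix from entry $(k,l)$ to entry $(i,j)$ is a sequence of $1$-entries starting at $(k,l)$ and ending at $(i,j)$ in which each consecutive step goes from $(r,s)$ to $(r+1,s)$, $(r,s+1)$ or $(r+1,s+1)$. The discrete Fréchet distance $\delta^*(P,Q)$ is the smallest $\delta>0$ such that $M_\delta(P,Q)$ contains a path from $(1,1)$ to $(m,n)$. For $t\in\mathbb{R}^2$, $Q+t=(q_1+t,\ldots,q_n+t)$. Running times are in the real RAM model. *)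

(* Defs.v *)
From HB Require Import structures.
From mathcomp Require Import all_boot all_order all_algebra.
From mathcomp Require Import all_classical all_reals all_analysis.
Set Implicit Arguments. Unset Strict Implicit. Unset Printing Implicit Defensive.
Import Order.TTheory GRing.Theory Num.Theory.
Local Open Scope ring_scope.

Section Frechet.
Variable R : realType.

Definition pt := (R * R)%type.
Definition edist (p q : pt) : R :=
  Num.sqrt ((p.1 - q.1) ^+ 2 + (p.2 - q.2) ^+ 2).

Definition pt0 : pt := (0, 0).

Definition entry1 (d : R) (P Q : seq pt) (ij : nat * nat) : bool :=
  [&& (ij.1 < size P)%N, (ij.2 < size Q)%N &
      edist (nth pt0 P ij.1) (nth pt0 Q ij.2) <= d].

Definition mstep (a b : nat * nat) : bool :=
  [|| b == (a.1.+1, a.2), b == (a.1, a.2.+1) | b == (a.1.+1, a.2.+1)].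

Definition has_mpath (d : R) (P Q : seq pt) : Prop :=
  exists s : seq (nat * nat),
    [&& path mstep (0%N, 0%N) s, all (entry1 d P Q) ((0%N, 0%N) :: s) &
        last (0%N, 0%N) s == ((size P).-1, (size Q).-1)].

Definition dfrechet (P Q : seq pt) : R :=
  inf [set d : R | 0 < d /\ has_mpath d P Q].

Definition translate (Q : seq pt) (t : pt) : seq pt :=
  map (fun q => (q.1 + t.1, q.2 + t.2)) Q.

(* ---------- A real RAM (deep embedding, unit cost) ---------- *)
Inductive instr :=
| ICst  of nat & int          (* R[r] := c                          *)
| IAdd  of nat & nat & nat    (* R[r] := R[a] + R[b]                *)
| ISub  of nat & nat & nat    (* R[r] := R[a] - R[b]                *)
| IMul  of nat & nat & nat    (* R[r] := R[a] * R[b]                *)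
| IDiv  of nat & nat & nat    (* R[r] := R[a] / R[b]   (R[b] <> 0)  *)
| ISqrt of nat & nat          (* R[r] := sqrt R[a]     (R[a] >= 0)  *)
| ILoad of nat & nat          (* R[r] := R[R[a]]   (R[a] in N)      *)
| IStore of nat & nat         (* R[R[a]] := R[b]   (R[a] in N)      *)
| IJlt  of nat & nat & nat    (* if R[a] < R[b] goto l              *)
| IJmp  of nat                (* goto l                             *)
| IHalt.

Definition rmem := nat -> R.
Definition upd (m : rmem) (r : nat) (v : R) : rmem :=
  fun i => if i == r then v else m i.

Inductive rstep (prog : seq instr) : nat * rmem -> nat * rmem -> Prop :=
| S_cst pc m r c : nth IHalt prog pc = ICst r c ->
    rstep prog (pc, m) (pc.+1, upd m r c%:~R)
| S_add pc m r a b : nth IHalt prog pc = IAdd r a b ->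
    rstep prog (pc, m) (pc.+1, upd m r (m a + m b))
| S_sub pc m r a b : nth IHalt prog pc = ISub r a b ->
    rstep prog (pc, m) (pc.+1, upd m r (m a - m b))
| S_mul pc m r a b : nth IHalt prog pc = IMul r a b ->
    rstep prog (pc, m) (pc.+1, upd m r (m a * m b))
| S_div pc m r a b : nth IHalt prog pc = IDiv r a b -> m b != 0 ->
    rstep prog (pc, m) (pc.+1, upd m r (m a / m b))
| S_sqrt pc m r a : nth IHalt prog pc = ISqrt r a -> 0 <= m a ->
    rstep prog (pc, m) (pc.+1, upd m r (Num.sqrt (m a)))
| S_load pc m r a k : nth IHalt prog pc = ILoad r a -> m a = k%:R ->
    rstep prog (pc, m) (pc.+1, upd m r (m k))
| S_store pc m a b k : nth IHalt prog pc = IStore a b -> m a = k%:R ->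
    rstep prog (pc, m) (pc.+1, upd m k (m b))
| S_jlt_t pc m a b l : nth IHalt prog pc = IJlt a b l -> m a < m b ->
    rstep prog (pc, m) (l, m)
| S_jlt_f pc m a b l : nth IHalt prog pc = IJlt a b l -> ~~ (m a < m b) ->
    rstep prog (pc, m) (pc.+1, m)
| S_jmp pc m l : nth IHalt prog pc = IJmp l ->
    rstep prog (pc, m) (l, m).

(* [exec prog c k m']: starting from configuration c the program halts
   (reaches IHalt, or runs off the end) after exactly k steps with final
   memory m'. *)
Inductive exec (prog : seq instr) : nat * rmem -> nat -> rmem -> Prop :=
| E_halt pc m : nth IHalt prog pc = IHalt -> exec prog (pc, m) 0 m
| E_step c c' k m' : rstep prog c c' -> exec prog c' k m' ->
    exec prog c k.+1 m'.

(* Input encoding: R[0] = m, R[1] = n, R[2] = delta, then the coordinates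
   x(p_1), y(p_1), ..., x(p_m), y(p_m), x(q_1), y(q_1), ..., x(q_n), y(q_n);
   all other cells are 0. *)
Definition coord (s : seq pt) (j : nat) : R :=
  if odd j then (nth pt0 s j./2).2 else (nth pt0 s j./2).1.

Definition input_mem (P Q : seq pt) (delta : R) : rmem :=
  fun i =>
    if i == 0%N then (size P)%:R
    else if i == 1%N then (size Q)%:R
    else if i == 2%N then delta
    else if (i - 3 < 2 * size P)%N then coord P (i - 3)
    else if (i - 3 - 2 * size P < 2 * size Q)%N then coord Q (i - 3 - 2 * size P)
    else 0.

End Frechet.

(* Main.v *)
Require Import Defs.
From HB Require Import structures.
From mathcomp Require Import all_boot all_order all_algebra.
From mathcomp Require Import all_classical all_reals all_analysis.
From mathcomp Require Import zify ring lra.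
Set Implicit Arguments. Unset Strict Implicit. Unset Printing Implicit Defensive.
Import Order.TTheory GRing.Theory Num.Theory.
Local Open Scope ring_scope.

(* A translation t makes the entry (i, j) a 1-entry iff it lies in the disk of
   radius delta around p_i - q_j.  A feasible t can be moved to the right until
   it leaves one of the disks of its path, so it suffices to search the right
   halves of the m n bounding circles.  Along such a half circle each disk cuts
   out one arc, so the matrix changes at O(m n) events, and after each event one
   asks whether the corners are connected.  After padding the sequences to powers
   of two M <= N by repeating their last points, the matrix is the root of a
   binary tree of blocks: cells are merged into squares up to size M x M, which
   are then juxtaposed.  Each block stores which of its entries reach which of
   its exits; by planarity this relation is determined by the hulls of its rows
   and columns, and the relation of a block is composed from those of its two
   halves in time linear in the boundary.  An event updates one leaf-to-root
   path, in time O(M + M log(N/M)), and the next event is found by a tournament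
   in the same tree.  The total is O(m n) circles times O(m n) events times
   O(m (1 + log(n/m))). *)

(** * A structured language over a real RAM *)

(** The machine has real cells only: counters, addresses and coordinates share one type. Programs
    are therefore written in a small language with separate naturals, reals and arrays and with
    bounded loops; a single compiler proof transfers both correctness and cost.

    On a half circle the stereographic parameter stays in [[-1, 1]], away from its point at
    infinity, and membership in a disk becomes a quadratic inequality in it. Events thus need only
    field operations and one square root, and they are compared as reals.

    A diagonal step may lead to a block that touches the current one in a corner only, where the two
    share no port. Sending it through a neighbouring cell gives it ports, at the price that a
    blocked cell is not empty: it still lets its upper entry out to the right.

    Sorting the events would cost a factor log(mn). The tournament has the shape of the tree and is
    repaired by the same climb; with M = 2^a and N = 2^(a+k), its height 2a+k is dominated by the
    O(M(1+k)) ports met on the way. This sum is geometric up to the M x M square, and each of the k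
    wide levels adds M, which is where the logarithm of n/m comes from. *)

Inductive nexp :=
| NV of nat | NC of nat
| NAdd of nexp & nexp | NSub of nexp & nexp | NMul of nexp & nexp
| NA of nat & nexp.

Inductive rexp :=
| RV of nat | RC of int
| RAdd of rexp & rexp | RSub of rexp & rexp | RMul of rexp & rexp
| RDiv of rexp & rexp | RSqrt of rexp
| RA of nat & nexp | RRaw of nexp.

Inductive bexp := BN of nexp & nexp | BR of rexp & rexp.

Inductive com :=
| Skip
| SetN of nat & nexp | SetR of nat & rexp
| StoN of nat & nexp & nexp | StoR of nat & nexp & rexp
| Seq of com & com
| If of bexp & com & com
| For of nat & nexp & com.

Definition fupd {T : Type} (f : nat -> T) (x : nat) (v : T) : nat -> T :=
  fun y => if Nat.eqb y x then v else f y.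

Arguments fupd : simpl never.

Lemma fupd_eq T (f : nat -> T) x v : fupd f x v x = v.
Proof. by rewrite /fupd PeanoNat.Nat.eqb_refl. Qed.

Lemma fupdE T (f : nat -> T) x v y :
  fupd f x v y = if y == x then v else f y.
Proof.
rewrite /fupd; case: eqP => [->|ne]; first by rewrite PeanoNat.Nat.eqb_refl.
by rewrite (introF (PeanoNat.Nat.eqb_spec y x) ne).
Qed.

Lemma fupd_neq T (f : nat -> T) x v y : y != x -> fupd f x v y = f y.
Proof. by rewrite fupdE => /negbTE ->. Qed.

Fixpoint wn (c : com) : seq nat :=
  match c with
  | SetN x _ => [:: x]
  | Seq c1 c2 => wn c1 ++ wn c2
  | If _ c1 c2 => wn c1 ++ wn c2
  | For x _ c => x :: wn c
  | _ => [::]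
  end.

Fixpoint wr (c : com) : seq nat :=
  match c with
  | SetR x _ => [:: x]
  | Seq c1 c2 => wr c1 ++ wr c2
  | If _ c1 c2 => wr c1 ++ wr c2
  | For x _ c => wr c
  | _ => [::]
  end.

Fixpoint wna (c : com) : seq nat :=
  match c with
  | StoN A _ _ => [:: A]
  | Seq c1 c2 => wna c1 ++ wna c2
  | If _ c1 c2 => wna c1 ++ wna c2
  | For x _ c => wna c
  | _ => [::]
  end.

Fixpoint wra (c : com) : seq nat :=
  match c with
  | StoR A _ _ => [:: A]
  | Seq c1 c2 => wra c1 ++ wra c2
  | If _ c1 c2 => wra c1 ++ wra c2
  | For x _ c => wra c
  | _ => [::]
  end.

(** * Semantics, cost and total correctness of the structured language *)

Section Semantics.
Variable R : realType.

Record st := St {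
  nv : nat -> nat; rv : nat -> R;
  na : nat -> nat -> nat; ra : nat -> nat -> R;
  raw : nat -> R; bs : nat }.

Definition setn s x v :=
  St (fupd (nv s) x v) (rv s) (na s) (ra s) (raw s) (bs s).
Definition setr s x v :=
  St (nv s) (fupd (rv s) x v) (na s) (ra s) (raw s) (bs s).
Definition setna s A k v :=
  St (nv s) (rv s) (fupd (na s) A (fupd (na s A) k v)) (ra s) (raw s) (bs s).
Definition setra s A k v :=
  St (nv s) (rv s) (na s) (fupd (ra s) A (fupd (ra s A) k v)) (raw s) (bs s).

Fixpoint evn (e : nexp) (s : st) : nat :=
  match e with
  | NV x => nv s x
  | NC k => k
  | NAdd a b => evn a s + evn b s
  | NSub a b => evn a s - evn b s
  | NMul a b => evn a s * evn b s
  | NA A a => na s A (evn a s)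
  end%N.

(** The machine subtracts reals, whereas [evn] truncates at zero. The two agree exactly when no
    subtraction truncates, which is what the side condition of [NSub] secures. *)
Fixpoint okn (e : nexp) (s : st) : Prop :=
  match e with
  | NV _ | NC _ => True
  | NAdd a b | NMul a b => okn a s /\ okn b s
  | NSub a b => [/\ okn a s, okn b s & (evn b s <= evn a s)%N]
  | NA _ a => okn a s
  end.

Fixpoint evr (e : rexp) (s : st) : R :=
  match e with
  | RV x => rv s x
  | RC z => z%:~R
  | RAdd a b => evr a s + evr b s
  | RSub a b => evr a s - evr b s
  | RMul a b => evr a s * evr b s
  | RDiv a b => evr a s / evr b s
  | RSqrt a => Num.sqrt (evr a s)
  | RA A a => ra s A (evn a s)
  | RRaw a => raw s (evn a s)
  end.

(* Number of the first cell not used by scalar variables and temporaries. *)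
Definition cells := 200%N.

Fixpoint okr (e : rexp) (s : st) : Prop :=
  match e with
  | RV _ | RC _ => True
  | RAdd a b | RSub a b | RMul a b => okr a s /\ okr b s
  | RDiv a b => [/\ okr a s, okr b s & evr b s != 0]
  | RSqrt a => okr a s /\ 0 <= evr a s
  | RA _ a => okn a s
  | RRaw a => okn a s /\ (cells <= evn a s < bs s)%N
  end.

Definition evb (b : bexp) (s : st) : bool :=
  match b with
  | BN a b => (evn a s < evn b s)%N
  | BR a b => evr a s < evr b s
  end.

Definition okb (b : bexp) (s : st) : Prop :=
  match b with
  | BN a b => okn a s /\ okn b s
  | BR a b => okr a s /\ okr b s
  end.

(** The bound of a loop is evaluated once, before the first iteration. The final assignment mirrors
    the compiled loop, whose counter equals the bound on exit. *)
Fixpoint run (c : com) (s : st) : st :=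
  match c with
  | Skip => s
  | SetN x e => setn s x (evn e s)
  | SetR x e => setr s x (evr e s)
  | StoN A e v => setna s A (evn e s) (evn v s)
  | StoR A e v => setra s A (evn e s) (evr v s)
  | Seq c1 c2 => run c2 (run c1 s)
  | If b c1 c2 => if evb b s then run c1 s else run c2 s
  | For x e c =>
      setn (iteri (evn e s) (fun i s' => run c (setn s' x i)) s) x (evn e s)
  end.

Definition iter_for c x i s := iteri i (fun i s' => run c (setn s' x i)) s.

(** Each assignment, test and loop iteration counts for one, whatever the size of its expressions;
    the number of machine steps behind one unit depends on the program text alone and is accounted
    for by [weight]. *)
Fixpoint cost (c : com) (s : st) : nat :=
  match c with
  | Skip => 0
  | Seq c1 c2 => cost c1 s + cost c2 (run c1 s)
  | If b c1 c2 => (if evb b s then cost c1 s else cost c2 s).+1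
  | For x e c =>
     (\sum_(i < evn e s) (cost c (setn (iter_for c x i s) x i)).+1).+1
  | _ => 1
  end%N.

Fixpoint safe (c : com) (s : st) : Prop :=
  match c with
  | Skip => True
  | SetN x e => okn e s
  | SetR x e => okr e s
  | StoN A e v => okn e s /\ okn v s
  | StoR A e v => okn e s /\ okr v s
  | Seq c1 c2 => safe c1 s /\ safe c2 (run c1 s)
  | If b c1 c2 => okb b s /\ (if evb b s then safe c1 s else safe c2 s)
  | For x e c => okn e s /\
     forall i, (i < evn e s)%N -> safe c (setn (iter_for c x i s) x i)
  end.

Definition frame (c : com) (s s' : st) : Prop :=
  [/\ forall x, x \notin wn c -> nv s' x = nv s x,
      forall x, x \notin wr c -> rv s' x = rv s x,
      forall A, A \notin wna c -> na s' A = na s A,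
      forall A, A \notin wra c -> ra s' A = ra s A &
      raw s' = raw s /\ bs s' = bs s].

Lemma frame_refl c s : frame c s s.
Proof. by split. Qed.

Lemma run_frame c s : frame c s (run c s).
Proof.
elim: c s => [|x e|x e|A e v|A e v|c1 IH1 c2 IH2|b c1 IH1 c2 IH2|x e c IH] s /=.
- exact: frame_refl.
- by split=> //= y; rewrite inE => h; rewrite fupd_neq.
- by split=> //= y; rewrite inE => h; rewrite fupd_neq.
- by split=> //= B; rewrite inE => h; rewrite fupd_neq.
- by split=> //= B; rewrite inE => h; rewrite fupd_neq.
- case: (IH1 s) (IH2 (run c1 s)) => [a1 a2 a3 a4 [a5 a6]] [b1 b2 b3 b4 [b5 b6]].
  split=> [y|y|y|y|]; rewrite ?mem_cat ?negb_or => /=.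
  + by case/andP=> h1 h2; rewrite b1 // a1.
  + by case/andP=> h1 h2; rewrite b2 // a2.
  + by case/andP=> h1 h2; rewrite b3 // a3.
  + by case/andP=> h1 h2; rewrite b4 // a4.
  + by rewrite b5 b6.
- case: ifP => _.
  + case: (IH1 s) => [a1 a2 a3 a4 a5].
    by split=> // y; rewrite mem_cat negb_or => /andP[h1 h2]; auto.
  + case: (IH2 s) => [a1 a2 a3 a4 a5].
    by split=> // y; rewrite mem_cat negb_or => /andP[h1 h2]; auto.
- set n := evn e s; set s' := iteri _ _ _.
  suff [a1 a2 a3 a4 a5] : frame (For x e c) s s'.
    split=> // y hy /=; rewrite fupd_neq ?a1 //.
    by move: hy; rewrite /= inE negb_or => /andP[].
  rewrite {}/s'; elim: n => [|n IHn] /=; first exact: frame_refl.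
  move: IHn; set s' := iteri _ _ _ => -[a1 a2 a3 a4 [a5 a6]].
  case: (IH (setn s' x n)) => [b1 b2 b3 b4 [b5 b6]].
  split=> [y|y|y|y|] /=.
  + rewrite inE negb_or => /andP[h1 h2].
    by rewrite b1 //= fupd_neq // a1 // inE negb_or h1.
  + by move=> h; rewrite b2 //= a2.
  + by move=> h; rewrite b3 //= a3.
  + by move=> h; rewrite b4 //= a4.
  + by rewrite b5 b6 /= a5 a6.
Qed.

(** A Hoare triple anchored at one initial state, so that the postcondition and the budget may
    mention the values held in that state. *)
Definition tri (c : com) (s : st) (T : nat) (Q : st -> Prop) : Prop :=
  [/\ safe c s, (cost c s <= T)%N & Q (run c s)].

Lemma tri_weak c s T T' (Q Q' : st -> Prop) :
  tri c s T Q -> (T <= T')%N ->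
  (forall s', frame c s s' -> Q s' -> Q' s') -> tri c s T' Q'.
Proof.
move=> [h1 h2 h3] hT hQ; split=> //; first exact: leq_trans hT.
by apply: hQ => //; exact: run_frame.
Qed.

Lemma tri_seq c1 c2 s T1 T2 T P Q :
  tri c1 s T1 P ->
  (forall s1, frame c1 s s1 -> P s1 -> tri c2 s1 T2 Q) ->
  (T1 + T2 <= T)%N -> tri (Seq c1 c2) s T Q.
Proof.
move=> [h1 h2 h3] h hT; have [k1 k2 k3] := h _ (run_frame c1 s) h3.
by split=> //=; apply: leq_trans hT; apply: leq_add.
Qed.

(** The frame of the loop comes with the invariant, so an invariant need only describe what the loop
    writes. The budget [Tb] varies with the iteration because the climb in the tree is paid for by a
    geometric sum. *)
Lemma tri_for x e c s T (Tb : nat -> nat) (I : nat -> st -> Prop) Q :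
  okn e s -> I 0%N s ->
  (forall i s', (i < evn e s)%N -> I i s' -> frame (For x e c) s s' ->
     tri c (setn s' x i) (Tb i) (I i.+1)) ->
  (forall s', frame (For x e c) s s' -> I (evn e s) s' -> Q (setn s' x (evn e s))) ->
  ((\sum_(i < evn e s) (Tb i).+1).+1 <= T)%N ->
  tri (For x e c) s T Q.
Proof.
move=> he h0 hstep hQ hT; set n := evn e s in hstep hQ hT *.
have inv i : (i <= n)%N ->
   I i (iter_for c x i s) /\ frame (For x e c) s (iter_for c x i s).
  elim: i => [|i IH] hi; first by split=> //; exact: frame_refl.
  have [hI hF] := IH (ltnW hi).
  have [_ _ hI'] := hstep i _ hi hI hF.
  split=> //; rewrite /iter_for /= -/(iter_for c x i s).
  case: hF => [a1 a2 a3 a4 [a5 a6]].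
  case: (run_frame c (setn (iter_for c x i s) x i)) => [b1 b2 b3 b4 [b5 b6]].
  split=> [y|y|y|y|] /=.
  + rewrite inE negb_or => /andP[k1 k2].
    by rewrite b1 //= fupd_neq // a1 //= inE negb_or k1.
  + by move=> k; rewrite b2 //= a2.
  + by move=> k; rewrite b3 //= a3.
  + by move=> k; rewrite b4 //= a4.
  + by rewrite b5 b6 /= a5 a6.
split=> /=.
- split=> // i hi; have [hI hF] := inv i (ltnW hi).
  by have [] := hstep i _ hi hI hF.
- apply: leq_trans hT; rewrite -/n ltnS; apply: leq_sum => i _.
  have [hI hF] := inv i (ltnW (ltn_ord i)).
  by have [] := hstep i _ (ltn_ord i) hI hF.
- have [hI hF] := inv n (leqnn n).
  exact: hQ hF hI.
Qed.

Lemma tri_for_cst x e c s T Tb (I : nat -> st -> Prop) Q :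
  okn e s -> I 0%N s ->
  (forall i s', (i < evn e s)%N -> I i s' -> frame (For x e c) s s' ->
     tri c (setn s' x i) Tb (I i.+1)) ->
  (forall s', frame (For x e c) s s' -> I (evn e s) s' -> Q (setn s' x (evn e s))) ->
  ((evn e s * Tb.+1).+1 <= T)%N ->
  tri (For x e c) s T Q.
Proof.
move=> h1 h2 h3 h4 h5; apply: (tri_for (Tb := fun=> Tb) h1 h2 h3 h4).
by rewrite sum_nat_const card_ord.
Qed.

Lemma tri_if b c1 c2 s T Q :
  okb b s ->
  (evb b s -> tri c1 s T Q) -> (~~ evb b s -> tri c2 s T Q) ->
  tri (If b c1 c2) s T.+1 Q.
Proof.
move=> hb h1 h2; rewrite /tri /=; case: (boolP (evb b s)) => h.
- by have [? ? ?] := h1 h; split.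
- by have [? ? ?] := h2 h; split.
Qed.

Lemma tri_assoc c1 c2 c3 s T Q :
  tri (Seq c1 (Seq c2 c3)) s T Q -> tri (Seq (Seq c1 c2) c3) s T Q.
Proof. by case=> /= [[h1 [h2 h3]] h4 h5]; split=> //=; rewrite -addnA. Qed.

Lemma tri_end c s T Q : tri (Seq c Skip) s T Q -> tri c s T Q.
Proof. by case=> /= -[h1 h2] h3 h4; split=> //; rewrite -[cost c s]addn0. Qed.

Lemma tri_skip s T Q : Q s -> tri Skip s T Q.
Proof. by split. Qed.

(** The assigned value is abstracted into a variable with an equation; symbolic execution would
    otherwise nest the expressions of all earlier assignments. *)
Lemma tri_setn x e c s T Q : okn e s ->
  (forall v, v = evn e s -> tri c (setn s x v) T Q) ->
  tri (Seq (SetN x e) c) s T.+1 Q.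
Proof. by move=> h /(_ _ erefl) [? ? ?]; split=> /=. Qed.

Lemma tri_setr x e c s T Q : okr e s ->
  (forall v, v = evr e s -> tri c (setr s x v) T Q) ->
  tri (Seq (SetR x e) c) s T.+1 Q.
Proof. by move=> h /(_ _ erefl) [? ? ?]; split=> /=. Qed.

Lemma tri_ston A e v c s T Q : okn e s -> okn v s ->
  (forall k x, k = evn e s -> x = evn v s -> tri c (setna s A k x) T Q) ->
  tri (Seq (StoN A e v) c) s T.+1 Q.
Proof. by move=> h1 h2 /(_ _ _ erefl erefl) [? ? ?]; split=> /=. Qed.

Lemma tri_stor A e v c s T Q : okn e s -> okr v s ->
  (forall k x, k = evn e s -> x = evr v s -> tri c (setra s A k x) T Q) ->
  tri (Seq (StoR A e v) c) s T.+1 Q.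
Proof. by move=> h1 h2 /(_ _ _ erefl erefl) [? ? ?]; split=> /=. Qed.

Lemma tri_if_seq b c1 c2 c s T Q : okb b s ->
  (evb b s -> tri (Seq c1 c) s T Q) -> (~~ evb b s -> tri (Seq c2 c) s T Q) ->
  tri (Seq (If b c1 c2) c) s T.+1 Q.
Proof.
move=> hb h1 h2; rewrite /tri /=; case: (boolP (evb b s)) => h.
- by have [/= [? ?] ? ?] := h1 h; split=> //; rewrite addSn.
- by have [/= [? ?] ? ?] := h2 h; split=> //; rewrite addSn.
Qed.

Lemma tri_skip_seq c s T Q : tri c s T Q -> tri (Seq Skip c) s T Q.
Proof. by case=> ? ? ?; split. Qed.

End Semantics.

(** * Compilation *)

(* Layout of the compiled memory: integer scalar x in cell x, the bound of the
   loop on x in cell 64 + x, real scalar x in cell 128 + x, the start of the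
   array zone in cell 160, temporaries from cell 161 on; the arrays are
   interleaved with stride 64, so that each of them is unbounded. *)
Definition hb x := (64 + x)%N.
Definition cr x := (128 + x)%N.
Definition cbase := 160%N.
Definition tc d := (161 + d)%N.

Definition addr_code (A d : nat) : seq instr :=
  [:: ICst (tc d.+1) 64; IMul (tc d) (tc d) (tc d.+1);
      ICst (tc d.+1) (Posz A); IAdd (tc d) (tc d) (tc d.+1);
      IAdd (tc d) (tc d) cbase].

Arguments addr_code : simpl never.

Fixpoint cen (e : nexp) (d : nat) : seq instr :=
  match e with
  | NV x => [:: ICst (tc d) 0; IAdd (tc d) (tc d) x]
  | NC k => [:: ICst (tc d) (Posz k)]
  | NAdd a b => cen a d ++ cen b d.+1 ++ [:: IAdd (tc d) (tc d) (tc d.+1)]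
  | NSub a b => cen a d ++ cen b d.+1 ++ [:: ISub (tc d) (tc d) (tc d.+1)]
  | NMul a b => cen a d ++ cen b d.+1 ++ [:: IMul (tc d) (tc d) (tc d.+1)]
  | NA A a => cen a d ++ addr_code A d ++ [:: ILoad (tc d) (tc d)]
  end.

Fixpoint cer (e : rexp) (d : nat) : seq instr :=
  match e with
  | RV x => [:: ICst (tc d) 0; IAdd (tc d) (tc d) (cr x)]
  | RC z => [:: ICst (tc d) z]
  | RAdd a b => cer a d ++ cer b d.+1 ++ [:: IAdd (tc d) (tc d) (tc d.+1)]
  | RSub a b => cer a d ++ cer b d.+1 ++ [:: ISub (tc d) (tc d) (tc d.+1)]
  | RMul a b => cer a d ++ cer b d.+1 ++ [:: IMul (tc d) (tc d) (tc d.+1)]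
  | RDiv a b => cer a d ++ cer b d.+1 ++ [:: IDiv (tc d) (tc d) (tc d.+1)]
  | RSqrt a => cer a d ++ [:: ISqrt (tc d) (tc d)]
  | RA A a => cen a d ++ addr_code (32 + A) d ++ [:: ILoad (tc d) (tc d)]
  | RRaw a => cen a d ++ [:: ILoad (tc d) (tc d)]
  end.

Definition ceb (b : bexp) : seq instr :=
  match b with
  | BN a b => cen a 0 ++ cen b 1
  | BR a b => cer a 0 ++ cer b 1
  end.

Definition mov r a t : seq instr := [:: ICst t 0; IAdd r a t].

(** Jumps are absolute, hence the argument [pc]. A loop keeps its bound in the cell [hb x], so its
    body may change the variables of [e]. The exit address [p0 + size lb + 5] skips the test, the
    exit jump, the body and the three closing instructions. *)
Fixpoint cc (c : com) (pc : nat) : seq instr :=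
  match c with
  | Skip => [::]
  | SetN x e => cen e 0 ++ mov x (tc 0) (tc 1)
  | SetR x e => cer e 0 ++ mov (cr x) (tc 0) (tc 1)
  | StoN A e v =>
      cen e 0 ++ addr_code A 0 ++ cen v 1 ++ [:: IStore (tc 0) (tc 1)]
  | StoR A e v =>
      cen e 0 ++ addr_code (32 + A) 0 ++ cer v 1 ++ [:: IStore (tc 0) (tc 1)]
  | Seq c1 c2 => let l1 := cc c1 pc in l1 ++ cc c2 (pc + size l1)%N
  | If b c1 c2 =>
      let lb := ceb b in
      let p1 := (pc + size lb).+1 in
      let l2 := cc c2 p1 in
      let p2 := (p1 + size l2).+1 in
      let l1 := cc c1 p2 in
      lb ++ IJlt (tc 0) (tc 1) p2 :: l2 ++ IJmp (p2 + size l1)%N :: l1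
  | For x e c =>
      let lp := cen e 0 ++ mov (hb x) (tc 0) (tc 1) ++ [:: ICst x 0] in
      let p0 := (pc + size lp)%N in
      let lb := cc c p0.+2 in
      lp ++ IJlt x (hb x) p0.+2 :: IJmp (p0 + size lb + 5)%N :: lb
         ++ [:: ICst (tc 0) 1; IAdd x x (tc 0); IJmp p0]
  end.

(* A bound on the number of RAM steps per unit of [cost]. *)
Fixpoint weight (c : com) : nat :=
  match c with
  | Skip => 0
  | SetN _ _ | SetR _ _ | StoN _ _ _ | StoR _ _ _ => size (cc c 0)
  | Seq c1 c2 => maxn (weight c1) (weight c2)
  | If b c1 c2 => maxn (size (ceb b) + 2) (maxn (weight c1) (weight c2))
  | For x e c => maxn (size (cen e 0) + 5) (weight c)
  end.

(** The bound on the depth keeps the temporaries [tc d] and [tc d.+1] below the cell 200, where the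
    input and then the arrays begin. *)
Fixpoint wfn (e : nexp) (d : nat) : bool :=
  (d.+1 < 32)%N &&
  match e with
  | NV x => (x < 64)%N
  | NC _ => true
  | NAdd a b | NSub a b | NMul a b => wfn a d && wfn b d.+1
  | NA A a => (A < 32)%N && wfn a d
  end.

Fixpoint wfr (e : rexp) (d : nat) : bool :=
  (d.+1 < 32)%N &&
  match e with
  | RV x => (x < 32)%N
  | RC _ => true
  | RAdd a b | RSub a b | RMul a b | RDiv a b => wfr a d && wfr b d.+1
  | RSqrt a => wfr a d
  | RA A a => (A < 32)%N && wfn a d
  | RRaw a => wfn a d
  end.

Definition wfb (b : bexp) : bool :=
  match b with
  | BN a b => wfn a 0 && wfn b 1
  | BR a b => wfr a 0 && wfr b 1
  end.

(** A loop must not have its own variable among those written by its body: the compiled test reads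
    the counter from that cell, and an inner loop on the same variable would also overwrite the
    bound. *)
Fixpoint wfc (c : com) : bool :=
  match c with
  | Skip => true
  | SetN x e => (x < 64)%N && wfn e 0
  | SetR x e => (x < 32)%N && wfr e 0
  | StoN A e v => [&& (A < 32)%N, wfn e 0 & wfn v 1]
  | StoR A e v => [&& (A < 32)%N, wfn e 0 & wfr v 1]
  | Seq c1 c2 => wfc c1 && wfc c2
  | If b c1 c2 => [&& wfb b, wfc c1 & wfc c2]
  | For x e c => [&& (x < 64)%N, wfn e 0, x \notin wn c & wfc c]
  end.

(** * Simulation of the language by the machine *)

Section Compiler.
Variable R : realType.
Implicit Types (m : rmem R) (s : st R).

Definition arr (b A k : nat) := (b + 64 * k + A)%N.

(** Loop bounds and temporaries are left unconstrained: they have no counterpart in a state. The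
    surviving input is visible only between [cells] and the array zone. *)
Record sim s m : Prop := Sim {
  sim_base : m cbase = (bs s)%:R;
  sim_cells : (cells <= bs s)%N;
  sim_nv : forall x, (x < 64)%N -> m x = (nv s x)%:R;
  sim_rv : forall x, (x < 32)%N -> m (cr x) = rv s x;
  sim_na : forall A k, (A < 32)%N -> m (arr (bs s) A k) = (na s A k)%:R;
  sim_ra : forall A k, (A < 32)%N -> m (arr (bs s) (32 + A) k) = ra s A k;
  sim_raw : forall a, (cells <= a < bs s)%N -> m a = raw s a }.

Lemma sim_ext s m m' : sim s m ->
  (forall i, (i < tc 0)%N && ((i < 64) || (128 <= i))%N || (cells <= i)%N ->
     m' i = m i) ->
  sim s m'.
Proof.
move=> [h1 h2 h3 h4 h5 h6 h7] e; split=> //.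
- by rewrite e.
- by move=> x hx; rewrite e ?h3 // /tc; lia.
- by move=> x hx; rewrite e ?h4 // /cr /tc; lia.
- by move=> A k hA; rewrite e ?h5 // /arr; apply/orP; right; lia.
- by move=> A k hA; rewrite e ?h6 // /arr; apply/orP; right; lia.
- by move=> a ha; rewrite e ?h7 //; apply/orP; right; case/andP: ha.
Qed.

(** Straight-line execution without a program or a position: each instruction is required to step
    correctly in every program that holds it, at every address, so code fragments can be verified
    before being placed. *)
Inductive exs : seq instr -> rmem R -> rmem R -> Prop :=
| Exs0 m : exs [::] m m
| Exs1 i l m m1 m2 :
   (forall prog pc, nth IHalt prog pc = i -> rstep prog (pc, m) (pc.+1, m1)) ->
   exs l m1 m2 -> exs (i :: l) m m2.

Lemma exs_cat l1 l2 m m1 m2 :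
  exs l1 m m1 -> exs l2 m1 m2 -> exs (l1 ++ l2) m m2.
Proof.
by move=> h; elim: h l2 m2 => // i l a b c hi _ IH l2 m2 /IH; apply: Exs1.
Qed.

Lemma ex_cst l m m' r c :
  exs l (upd m r c%:~R) m' -> exs (ICst r c :: l) m m'.
Proof. by apply: Exs1 => *; exact: S_cst. Qed.
Lemma ex_add l m m' r a b :
  exs l (upd m r (m a + m b)) m' -> exs (IAdd r a b :: l) m m'.
Proof. by apply: Exs1 => *; exact: S_add. Qed.
Lemma ex_sub l m m' r a b :
  exs l (upd m r (m a - m b)) m' -> exs (ISub r a b :: l) m m'.
Proof. by apply: Exs1 => *; exact: S_sub. Qed.
Lemma ex_mul l m m' r a b :
  exs l (upd m r (m a * m b)) m' -> exs (IMul r a b :: l) m m'.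
Proof. by apply: Exs1 => *; exact: S_mul. Qed.
Lemma ex_div l m m' r a b : m b != 0 ->
  exs l (upd m r (m a / m b)) m' -> exs (IDiv r a b :: l) m m'.
Proof. by move=> h; apply: Exs1 => *; exact: S_div. Qed.
Lemma ex_sqrt l m m' r a : 0 <= m a ->
  exs l (upd m r (Num.sqrt (m a))) m' -> exs (ISqrt r a :: l) m m'.
Proof. by move=> h; apply: Exs1 => *; exact: S_sqrt. Qed.
Lemma ex_load l m m' r a k : m a = k%:R ->
  exs l (upd m r (m k)) m' -> exs (ILoad r a :: l) m m'.
Proof. by move=> h; apply: Exs1 => prog pc hi; apply: S_load hi h. Qed.
Lemma ex_store l m m' a b k : m a = k%:R ->
  exs l (upd m k (m b)) m' -> exs (IStore a b :: l) m m'.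
Proof. by move=> h; apply: Exs1 => prog pc hi; apply: S_store hi h. Qed.

Lemma upd_eq m r v : upd m r v r = v.
Proof. by rewrite /upd eqxx. Qed.

Lemma upd_neq m r v i : i != r -> upd m r v i = m i.
Proof. by rewrite /upd => /negbTE ->. Qed.

(* Evaluating in the temporaries from [d] on, with the result in the first. *)
Definition evals l m d v := exists2 m', exs l m m' &
  m' (tc d) = v /\ (forall i, (i < tc d)%N || (cells <= i)%N -> m' i = m i).

Lemma evals_sim s m m' d : sim s m ->
  (forall i, (i < tc d)%N || (cells <= i)%N -> m' i = m i) -> sim s m'.
Proof.
move=> hs h; apply: sim_ext hs _ => i hi; apply: h.
by move: hi; rewrite /tc; lia.
Qed.

Lemma evals_bin l1 l2 i d m v1 v2 v : (d.+1 < 32)%N ->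
  evals l1 m d v1 ->
  (forall m1, (forall i, (i < tc d)%N || (cells <= i)%N -> m1 i = m i) ->
    evals l2 m1 d.+1 v2) ->
  (forall m2, m2 (tc d) = v1 -> m2 (tc d.+1) = v2 ->
     exs [:: i] m2 (upd m2 (tc d) v)) ->
  evals (l1 ++ l2 ++ [:: i]) m d v.
Proof.
move=> hd [m1 e1 [v1E f1]] h2 h3; have [m2 e2 [v2E f2]] := h2 _ f1.
exists (upd m2 (tc d) v).
  apply: exs_cat e1 _; apply: exs_cat e2 _; apply: h3 => //.
  by rewrite f2 // ltnS leqnn.
split; first by rewrite upd_eq.
move=> i' hi'; rewrite upd_neq; last by move: hi'; rewrite /tc /cells; lia.
by rewrite f2 ?f1 //; move: hi'; rewrite /tc; lia.
Qed.

Lemma addr_code_ok A d m k s : (d.+1 < 32)%N -> sim s m -> m (tc d) = k%:R ->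
  exists2 m', exs (addr_code A d) m m' &
   m' (tc d) = (arr (bs s) A k)%:R /\
   (forall i, (i < tc d)%N || (cells <= i)%N -> m' i = m i).
Proof.
move=> hd hs hk.
have n1 : tc d != tc d.+1 by rewrite /tc; lia.
have n2 : cbase != tc d by rewrite /tc /cbase; lia.
have n3 : cbase != tc d.+1 by rewrite /tc /cbase; lia.
eexists.
  apply: ex_cst; apply: ex_mul; apply: ex_cst; apply: ex_add; apply: ex_add.
  exact: Exs0.
rewrite !upd_eq; split.
  rewrite (upd_neq _ _ n2) (upd_neq _ _ n3) (upd_neq _ _ n2) (upd_neq _ _ n3).
  rewrite (sim_base hs) !(upd_neq _ _ n1) hk !upd_eq.
  rewrite /arr natrD natrD natrM -!pmulrn.
  by rewrite addrC addrA [k%:R * _]mulrC.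
move=> i hi; rewrite !upd_neq //; move: hi; rewrite /tc /cells; lia.
Qed.

Lemma cen_ok e d s m : wfn e d -> sim s m -> okn e s ->
  evals (cen e d) m d (evn e s)%:R.
Proof.
elim: e d m => [x|k|a IHa b IHb|a IHa b IHb|a IHa b IHb|A a IHa] d m /=.
- move=> /andP[hd hx] hs _.
  eexists; first by apply: ex_cst; apply: ex_add; exact: Exs0.
  rewrite !upd_eq add0r upd_neq; last by rewrite /tc; lia.
  split; first by rewrite (sim_nv hs).
  by move=> i hi; rewrite !upd_neq //; move: hi; rewrite /tc /cells; lia.
- move=> /andP[hd _] hs _.
  eexists; first by apply: ex_cst; exact: Exs0.
  rewrite upd_eq; split => //.
  by move=> i hi; rewrite upd_neq //; move: hi; rewrite /tc /cells; lia.
- move=> /and3P[hd ha hb] hs [oa ob].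
  apply: evals_bin hd (IHa _ _ ha hs oa) _ _.
    by move=> m1 f1; apply: IHb => //; exact: evals_sim f1.
  by move=> m2 e1 e2; rewrite natrD -e1 -e2; apply: ex_add; exact: Exs0.
- move=> /and3P[hd ha hb] hs [oa ob oab].
  apply: evals_bin hd (IHa _ _ ha hs oa) _ _.
    by move=> m1 f1; apply: IHb => //; exact: evals_sim f1.
  by move=> m2 e1 e2; rewrite natrB // -e1 -e2; apply: ex_sub; exact: Exs0.
- move=> /and3P[hd ha hb] hs [oa ob].
  apply: evals_bin hd (IHa _ _ ha hs oa) _ _.
    by move=> m1 f1; apply: IHb => //; exact: evals_sim f1.
  by move=> m2 e1 e2; rewrite natrM -e1 -e2; apply: ex_mul; exact: Exs0.
- move=> /and3P[hd hA ha] hs oa; have [m1 e1 [v1 f1]] := IHa _ _ ha hs oa.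
  have hs1 := evals_sim hs f1.
  have [m2 e2 [v2 f2]] := addr_code_ok A hd hs1 v1.
  eexists.
    by apply: exs_cat e1 _; apply: exs_cat e2 _; apply: (ex_load v2); exact: Exs0.
  rewrite upd_eq (sim_na (evals_sim hs1 f2)) //; split=> // i hi.
  by rewrite upd_neq ?f2 ?f1 //; move: hi; rewrite /tc /cells; lia.
Qed.

Lemma cer_ok e d s m : wfr e d -> sim s m -> okr e s ->
  evals (cer e d) m d (evr e s).
Proof.
elim: e d m => [x|k|a IHa b IHb|a IHa b IHb|a IHa b IHb|a IHa b IHb|a IHa|A a|a]
  d m /=.
- move=> /andP[hd hx] hs _.
  eexists; first by apply: ex_cst; apply: ex_add; exact: Exs0.
  rewrite !upd_eq add0r upd_neq; last by rewrite /tc /cr; lia.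
  split; first by rewrite (sim_rv hs).
  by move=> i hi; rewrite !upd_neq //; move: hi; rewrite /tc /cells; lia.
- move=> /andP[hd _] hs _.
  eexists; first by apply: ex_cst; exact: Exs0.
  rewrite upd_eq; split => //.
  by move=> i hi; rewrite upd_neq //; move: hi; rewrite /tc /cells; lia.
- move=> /and3P[hd ha hb] hs [oa ob].
  apply: evals_bin hd (IHa _ _ ha hs oa) _ _.
    by move=> m1 f1; apply: IHb => //; exact: evals_sim f1.
  by move=> m2 e1 e2; rewrite -e1 -e2; apply: ex_add; exact: Exs0.
- move=> /and3P[hd ha hb] hs [oa ob].
  apply: evals_bin hd (IHa _ _ ha hs oa) _ _.
    by move=> m1 f1; apply: IHb => //; exact: evals_sim f1.
  by move=> m2 e1 e2; rewrite -e1 -e2; apply: ex_sub; exact: Exs0.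
- move=> /and3P[hd ha hb] hs [oa ob].
  apply: evals_bin hd (IHa _ _ ha hs oa) _ _.
    by move=> m1 f1; apply: IHb => //; exact: evals_sim f1.
  by move=> m2 e1 e2; rewrite -e1 -e2; apply: ex_mul; exact: Exs0.
- move=> /and3P[hd ha hb] hs [oa ob oab].
  apply: evals_bin hd (IHa _ _ ha hs oa) _ _.
    by move=> m1 f1; apply: IHb => //; exact: evals_sim f1.
  by move=> m2 e1 e2; rewrite -e1 -e2; apply: ex_div; rewrite ?e2 //; exact: Exs0.
- move=> /andP[hd ha] hs [oa oap]; have [m1 e1 [v1 f1]] := IHa _ _ ha hs oa.
  eexists.
    by apply: exs_cat e1 _; apply: ex_sqrt; rewrite ?v1 //; exact: Exs0.
  rewrite upd_eq; split=> // i hi.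
  by rewrite upd_neq ?f1 //; move: hi; rewrite /tc /cells; lia.
- move=> /and3P[hd hA ha] hs oa; have [m1 e1 [v1 f1]] := cen_ok ha hs oa.
  have hs1 := evals_sim hs f1.
  have [m2 e2 [v2 f2]] := addr_code_ok (32 + A) hd hs1 v1.
  eexists.
    by apply: exs_cat e1 _; apply: exs_cat e2 _; apply: (ex_load v2); exact: Exs0.
  rewrite upd_eq (sim_ra (evals_sim hs1 f2)) //; split=> // i hi.
  by rewrite upd_neq ?f2 ?f1 //; move: hi; rewrite /tc /cells; lia.
- move=> /andP[hd ha] hs [oa ob]; have [m1 e1 [v1 f1]] := cen_ok ha hs oa.
  have hs1 := evals_sim hs f1.
  eexists.
    by apply: exs_cat e1 _; apply: (ex_load v1); exact: Exs0.
  rewrite upd_eq (sim_raw hs1) //; split=> // i hi.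
  by rewrite upd_neq ?f1 //; move: hi; rewrite /tc /cells; lia.
Qed.

Inductive steps (prog : seq instr) : nat * rmem R -> nat -> nat * rmem R -> Prop :=
| St0 c : steps prog c 0 c
| StS c c' c'' k : rstep prog c c' -> steps prog c' k c'' -> steps prog c k.+1 c''.

Lemma steps_trans prog c1 c2 c3 k1 k2 :
  steps prog c1 k1 c2 -> steps prog c2 k2 c3 -> steps prog c1 (k1 + k2) c3.
Proof.
move=> h; elim: h c3 k2 => [c|c c' c'' k hr _ IH] c3 k2 h2; first exact: h2.
by rewrite addSn; apply: StS hr _; apply: IH.
Qed.

Lemma steps_exec prog c k pc m : steps prog c k (pc, m) ->
  nth IHalt prog pc = IHalt -> exec prog c k m.
Proof.
move: {-2}(pc, m) (erefl (pc, m)) => c' e h; elim: h e => [a|a b a' k' hr _ IH] e hh.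
  by rewrite e; apply: E_halt.
by apply: E_step hr _; apply: IH.
Qed.

Definition code_at (prog : seq instr) pc l :=
  forall i, (i < size l)%N -> nth IHalt prog (pc + i) = nth IHalt l i.

Lemma code_at_cat prog pc l1 l2 : code_at prog pc (l1 ++ l2) ->
  code_at prog pc l1 /\ code_at prog (pc + size l1) l2.
Proof.
move=> h; split=> i hi.
  by rewrite h ?size_cat ?nth_cat ?hi // ltn_addr.
rewrite -addnA h ?size_cat ?ltn_add2l // nth_cat ifN; last by rewrite -leqNgt leq_addr.
by rewrite addKn.
Qed.

Lemma code_at_cons prog pc i l : code_at prog pc (i :: l) ->
  nth IHalt prog pc = i /\ code_at prog pc.+1 l.
Proof.
move=> h; split; first by have := h 0%N isT; rewrite addn0.
by move=> j hj; rewrite addSnnS h.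
Qed.

Lemma exs_steps prog pc l m m' : code_at prog pc l -> exs l m m' ->
  steps prog (pc, m) (size l) ((pc + size l)%N, m').
Proof.
move=> h e; elim: e pc h => [a|i l' a a1 a2 hi _ IH] pc h.
  by rewrite addn0; exact: St0.
have [h1 h2] := code_at_cons h.
by apply: StS (hi _ _ h1) _; rewrite /= addnS -addSn; apply: IH.
Qed.

(** Addresses occur only as jump targets, so the length of the code is the same everywhere; this is
    why [weight] can measure it at address 0. *)
Lemma size_cc c pc pc' : size (cc c pc) = size (cc c pc').
Proof.
elim: c pc pc' => [|x e|x e|A e v|A e v|c1 IH1 c2 IH2|b c1 IH1 c2 IH2|x e c IH] pc pc' //=.
- by rewrite !size_cat (IH1 pc pc') (IH2 _ (pc' + size (cc c1 pc'))%N).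
- rewrite !size_cat /= !size_cat /=.
  rewrite (IH2 (pc + size (ceb b)).+1 (pc' + size (ceb b)).+1).
  by congr (_ + (_ + _.+1).+1)%N; apply: IH1.
- rewrite !size_cat /= !size_cat /=.
  by congr (_ + (_ + _).+2)%N; apply: IH.
Qed.

(** What an enclosing loop on [y] needs from its body. A state does not record the stored bounds, so
    [sim] cannot provide it. *)
Definition keeps_hb c m m' := forall y, (y < 64)%N -> y \notin wn c -> m' (hb y) = m (hb y).

Lemma sim_setn s m x v : (x < 64)%N -> sim s m -> sim (setn s x v) (upd m x v%:R).
Proof.
move=> hx [h1 h2 h3 h4 h5 h6 h7]; split=> //=.
- by rewrite upd_neq // /cbase; lia.
- move=> y hy; rewrite fupdE /upd; case: eqP => // _; exact: h3.
- by move=> y hy; rewrite upd_neq ?h4 // /cr; lia.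
- by move=> A k hA; rewrite upd_neq ?h5 // /arr; move: h2; rewrite /cells; lia.
- by move=> A k hA; rewrite upd_neq ?h6 // /arr; move: h2; rewrite /cells; lia.
- by move=> a ha; rewrite upd_neq ?h7 //; move: ha; rewrite /cells; lia.
Qed.

Lemma sim_setr s m x v : (x < 32)%N -> sim s m -> sim (setr s x v) (upd m (cr x) v).
Proof.
move=> hx [h1 h2 h3 h4 h5 h6 h7]; split=> //=.
- by rewrite upd_neq // /cbase /cr; lia.
- by move=> y hy; rewrite upd_neq ?h3 // /cr; lia.
- move=> y hy; rewrite fupdE /upd /cr eqn_add2l; case: eqP => // _; exact: h4.
- by move=> A k hA; rewrite upd_neq ?h5 // /arr /cr; move: h2; rewrite /cells; lia.
- by move=> A k hA; rewrite upd_neq ?h6 // /arr /cr; move: h2; rewrite /cells; lia.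
- by move=> a ha; rewrite upd_neq ?h7 //; move: ha; rewrite /cells /cr; lia.
Qed.

Lemma arr_inj b A k A' k' : (A < 64)%N -> (A' < 64)%N ->
  (arr b A k == arr b A' k') = (A == A') && (k == k').
Proof. by rewrite /arr; lia. Qed.

Lemma sim_setna s m A k v : (A < 32)%N -> sim s m ->
  sim (setna s A k v) (upd m (arr (bs s) A k) v%:R).
Proof.
move=> hx [h1 h2 h3 h4 h5 h6 h7].
split=> //=; rewrite /cells in h2.
- by rewrite upd_neq // /cbase /arr; lia.
- by move=> y hy; rewrite upd_neq ?h3 // /arr; lia.
- by move=> y hy; rewrite upd_neq ?h4 // /cr /arr; lia.
- move=> B j hB; rewrite fupdE /upd arr_inj ?(ltn_trans hB) ?(ltn_trans hx) //.
  case: eqP => [->|_] /=; last exact: h5.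
  by rewrite fupdE; case: eqP => // _; exact: h5.
- move=> B j hB; rewrite upd_neq ?h6 // arr_inj; lia.
- by move=> a ha; rewrite upd_neq ?h7 // /arr; lia.
Qed.

Lemma sim_setra s m A k v : (A < 32)%N -> sim s m ->
  sim (setra s A k v) (upd m (arr (bs s) (32 + A) k) v).
Proof.
move=> hx [h1 h2 h3 h4 h5 h6 h7].
split=> //=; rewrite /cells in h2.
- by rewrite upd_neq // /cbase /arr; lia.
- by move=> y hy; rewrite upd_neq ?h3 // /arr; lia.
- by move=> y hy; rewrite upd_neq ?h4 // /cr /arr; lia.
- move=> B j hB; rewrite upd_neq ?h5 // arr_inj; lia.
- move=> B j hB; rewrite fupdE /upd arr_inj; try lia.
  rewrite eqn_add2l; case: eqP => [->|_] /=; last exact: h6.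
  by rewrite fupdE; case: eqP => // _; exact: h6.
- by move=> a ha; rewrite upd_neq ?h7 // /arr; lia.
Qed.

Lemma ceb_ok b s m : wfb b -> sim s m -> okb b s ->
  exists2 m', exs (ceb b) m m' &
  (m' (tc 0) < m' (tc 1)) = evb b s /\
  (forall i, (i < tc 0)%N || (cells <= i)%N -> m' i = m i).
Proof.
case: b => a b /= /andP[wa wb] hs [oa ob].
- have [m1 e1 [v1 f1]] := cen_ok wa hs oa.
  have [m2 e2 [v2 f2]] := cen_ok wb (evals_sim hs f1) ob.
  exists m2; first exact: exs_cat e1 e2.
  split; first by rewrite v2 f2 // v1 ltr_nat.
  by move=> i hi; rewrite f2 ?f1 //; move: hi; rewrite /tc; lia.
- have [m1 e1 [v1 f1]] := cer_ok wa hs oa.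
  have [m2 e2 [v2 f2]] := cer_ok wb (evals_sim hs f1) ob.
  exists m2; first exact: exs_cat e1 e2.
  split; first by rewrite v2 f2 // v1.
  by move=> i hi; rewrite f2 ?f1 //; move: hi; rewrite /tc; lia.
Qed.

Definition implements c pc s m prog := exists k m',
  [/\ steps prog (pc, m) k ((pc + size (cc c pc))%N, m'),
      (k <= weight c * cost c s)%N, sim (run c s) m' & keeps_hb c m m'].

Lemma straight_ok c pc s m m' prog :
  code_at prog pc (cc c pc) -> exs (cc c pc) m m' ->
  weight c = size (cc c 0) -> cost c s = 1%N ->
  sim (run c s) m' -> (forall y, (y < 64)%N -> m' (hb y) = m (hb y)) ->
  implements c pc s m prog.
Proof.
move=> hc he hw hk hs hh; exists (size (cc c pc)), m'; split=> //.
- exact: exs_steps.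
- by rewrite hw hk muln1 (size_cc _ pc 0).
- by move=> y hy _; apply: hh.
Qed.

Lemma cc_ok c pc s m prog : wfc c -> code_at prog pc (cc c pc) ->
  sim s m -> safe c s -> implements c pc s m prog.
Proof.
elim: c pc s m => [|x e|x e|A e v|A e v|c1 IH1 c2 IH2|b c1 IH1 c2 IH2|x e c IH] pc s m.
- move=> _ _ hs _; exists 0%N, m; split=> //=; rewrite ?addn0 //; exact: St0.
- move=> /= /andP[hx we] hc hs ok; have [m1 e1 [v1 f1]] := cen_ok we hs ok.
  apply: (straight_ok (c := SetN x e) hc); [|by []|by []| |]; rewrite /=.
  + apply: exs_cat e1 _; apply: ex_cst; apply: ex_add; exact: Exs0.
  + rewrite upd_eq addr0 upd_neq ?v1 //.
    apply: sim_setn => //; apply: (sim_ext hs) => i hi.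
    rewrite upd_neq ?f1 //; move: hi; rewrite /tc /cells; lia.
  + by move=> y hy; rewrite !upd_neq ?f1 // /hb /tc; lia.
- move=> /= /andP[hx we] hc hs ok; have [m1 e1 [v1 f1]] := cer_ok we hs ok.
  apply: (straight_ok (c := SetR x e) hc); [|by []|by []| |]; rewrite /=.
  + apply: exs_cat e1 _; apply: ex_cst; apply: ex_add; exact: Exs0.
  + rewrite upd_eq addr0 upd_neq ?v1 //.
    apply: sim_setr => //; apply: (sim_ext hs) => i hi.
    rewrite upd_neq ?f1 //; move: hi; rewrite /tc /cells; lia.
  + by move=> y hy; rewrite !upd_neq ?f1 // /hb /tc /cr; lia.
- move=> /= /and3P[hx we wv] hc hs [oe ov]; have [m1 e1 [v1 f1]] := cen_ok we hs oe.
  have hs1 := evals_sim hs f1.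
  have [m2 e2 [v2 f2]] := addr_code_ok (d := 0) A isT hs1 v1.
  have hs2 := evals_sim hs1 f2.
  have [m3 e3 [v3 f3]] := cen_ok wv hs2 ov.
  have hcl := sim_cells hs; rewrite /cells in hcl.
  apply: (straight_ok (c := StoN A e v) hc); [|by []|by []| |]; rewrite /=.
  + apply: exs_cat e1 _; apply: (exs_cat e2) _; apply: exs_cat e3 _.
    by apply: ex_store; first (by rewrite f3 // v2); exact: Exs0.
  + rewrite v3; apply: sim_setna => //; exact: evals_sim hs2 f3.
  + move=> y hy; rewrite upd_neq; last by rewrite /hb /arr; lia.
    by rewrite f3 ?f2 ?f1 // /hb /tc; lia.
- move=> /= /and3P[hx we wv] hc hs [oe ov]; have [m1 e1 [v1 f1]] := cen_ok we hs oe.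
  have hs1 := evals_sim hs f1.
  have [m2 e2 [v2 f2]] := addr_code_ok (d := 0) (32 + A) isT hs1 v1.
  have hs2 := evals_sim hs1 f2.
  have [m3 e3 [v3 f3]] := cer_ok wv hs2 ov.
  have hcl := sim_cells hs; rewrite /cells in hcl.
  apply: (straight_ok (c := StoR A e v) hc); [|by []|by []| |]; rewrite /=.
  + apply: exs_cat e1 _; apply: (exs_cat e2) _; apply: exs_cat e3 _.
    by apply: ex_store; first (by rewrite f3 // v2); exact: Exs0.
  + rewrite v3; apply: sim_setra => //; exact: evals_sim hs2 f3.
  + move=> y hy; rewrite upd_neq; last by rewrite /hb /arr; lia.
    by rewrite f3 ?f2 ?f1 // /hb /tc; lia.
- move=> /= /andP[w1 w2] /code_at_cat[hc1 hc2] hs [s1 s2].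
  have [k1 [m1 [st1 le1 sim1 hb1]]] := IH1 _ _ _ w1 hc1 hs s1.
  have [k2 [m2 [st2 le2 sim2 hb2]]] := IH2 _ _ _ w2 hc2 sim1 s2.
  exists (k1 + k2)%N, m2; split=> //=.
  + rewrite size_cat addnA; exact: steps_trans st1 st2.
  + by rewrite mulnDr leq_add // (leq_trans le1, leq_trans le2) // leq_mul2r
      ?leq_maxl ?leq_maxr orbT.
  + move=> y hy; rewrite /= mem_cat negb_or => /andP[y1 y2].
    by rewrite hb2 ?hb1.
- move=> /= /and3P[wb w1 w2] /code_at_cat[hcb /code_at_cons[hj /code_at_cat[hc2 /code_at_cons[hj2 hc1]]]] hs [ob h].
  have [m0 e0 [c0 f0]] := ceb_ok wb hs ob.
  have hs0 := evals_sim hs f0.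
  have st0 := exs_steps hcb e0.
  have hh y : (y < 64)%N -> m0 (hb y) = m (hb y) by move=> hy; rewrite f0 // /hb /tc; lia.
  rewrite !addSn in hj2 hc1; case: ifP h => hE h.
  + have [k1 [m1 [st1 le1 sim1 hb1]]] := IH1 _ _ _ w1 hc1 hs0 h.
    exists (size (ceb b) + (1 + k1))%N, m1; split=> //.
    * apply: steps_trans st0 _; apply: steps_trans.
        by apply: StS; [apply: S_jlt_t hj _; rewrite c0 hE|exact: St0].
      rewrite size_cat /= size_cat /=.
      set l2 := size (cc c2 _); set l1 := size (cc c1 _).
      suff -> : (pc + (size (ceb b) + (l2 + l1.+1).+1) = (pc + size (ceb b) + l2).+2 + l1)%N by [].
      lia.
    * rewrite /= hE; move: le1 => /=; nia.
    * by rewrite /= hE.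
    * by move=> y hy; rewrite /= mem_cat negb_or => /andP[y1 y2]; rewrite hb1 // hh.
  + have [k2 [m2 [st2 le2 sim2 hb2]]] := IH2 _ _ _ w2 hc2 hs0 h.
    exists (size (ceb b) + (1 + (k2 + 1)))%N, m2; split=> //.
    * apply: steps_trans st0 _; apply: steps_trans.
        by apply: StS; [apply: S_jlt_f hj _; rewrite c0 hE|exact: St0].
      apply: steps_trans st2 _.
      rewrite addSn; apply: StS; first exact: S_jmp hj2.
      rewrite size_cat /= size_cat /=.
      set l2 := size (cc c2 _); set l1 := size (cc c1 _).
      suff -> : (pc + (size (ceb b) + (l2 + l1.+1).+1) = (pc + size (ceb b) + l2).+2 + l1)%N by exact: St0.
      lia.
    * rewrite /= hE; move: le2 => /=; nia.
    * by rewrite /= hE.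
    * by move=> y hy; rewrite /= mem_cat negb_or => /andP[y1 y2]; rewrite hb2 // hh.
- move=> /= /and4P[hx we hn wc].
  set lp := cen e 0 ++ _; set p0 := (pc + size lp)%N; set lb := cc c p0.+2.
  move=> /code_at_cat[hcp /code_at_cons[hj /code_at_cons[hj2]]].
  move=> /code_at_cat[hcb /code_at_cons[hl1 /code_at_cons[hl2 /code_at_cons[hl3 _]]]].
  rewrite -/p0 in hj hj2 hcb hl1 hl2 hl3.
  move=> hs [oe hsafe]; set n := evn e s in hsafe *.
  have [m0 e0 [v0 f0]] := cen_ok we hs oe.
  pose ma := upd (upd (upd m0 (tc 1) 0) (hb x) n%:R) x 0.
  have ea : exs lp m ma.
    apply: exs_cat e0 _; apply: ex_cst; apply: ex_add; apply: ex_cst.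
    by rewrite upd_eq addr0 upd_neq ?v0 //; exact: Exs0.
  have sa : sim (setn s x 0) ma.
    apply: sim_setn => //; apply: (sim_ext hs) => i hi.
    rewrite !upd_neq ?f0 //; move: hi; rewrite /tc /hb /cells; lia.
  have hba y : (y < 64)%N -> y != x -> ma (hb y) = m (hb y).
    by move=> hy yx; rewrite /ma !upd_neq ?f0 //; rewrite /tc /hb; lia.
  have sta := exs_steps hcp ea.
  (* The 4 extra steps of an iteration are the test and the three closing instructions. *)
  have loop i : (i <= n)%N -> exists k mi,
     [/\ steps prog (p0, ma) k (p0, mi),
      (k <= \sum_(j < i) ((weight c) * cost c (setn (iter_for c x j s) x j) + 4))%N,
      sim (setn (iter_for c x i s) x i) mi, mi (hb x) = n%:R &
      forall y, (y < 64)%N -> y \notin x :: wn c -> mi (hb y) = m (hb y)].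
    elim: i => [|i IHi] hi.
      exists 0%N, ma; split=> //; first exact: St0.
        by rewrite /ma upd_neq ?upd_eq //; rewrite /hb; lia.
      by move=> y hy; rewrite inE negb_or => /andP[y1 _]; rewrite hba.
    have [k [mi [sti lei simi hbi hbyi]]] := IHi (ltnW hi).
    have [k' [mj [stj lej simj hbj]]] := IH _ _ _ wc hcb simi (hsafe _ hi).
    set si := run c _ in simj.
    have hxi : nv si x = i.
      by have [-> //] := run_frame c (setn (iter_for c x i s) x i); rewrite /= fupd_eq.
    have mjx : mj x = i%:R by rewrite (sim_nv simj) // hxi.
    exists (k + (1 + (k' + 3)))%N, (upd (upd mj (tc 0) 1) x i.+1%:R); split=> //.
    - apply: steps_trans sti _; apply: steps_trans.
        apply: StS; last exact: St0.
        apply: S_jlt_t hj _; rewrite hbi (sim_nv simi) //= fupd_eq ltr_nat //.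
      apply: steps_trans stj _.
      apply: StS; first exact: S_cst hl1.
      apply: StS; first exact: S_add hl2.
      rewrite upd_eq upd_neq; last by rewrite /tc; lia.
      rewrite mjx -mulrSr.
      by apply: StS; [exact: S_jmp hl3|exact: St0].
    - have -> : (k + (1 + (k' + 3)) = k + (k' + 4))%N by lia.
      by rewrite big_ord_recr; apply: leq_add lei _; rewrite leq_add2r.
    - have -> : setn (iter_for c x i.+1 s) x i.+1 = setn si x i.+1 by [].
      apply: sim_setn => //; apply: (sim_ext simj) => j hj'.
      rewrite upd_neq //; move: hj'; rewrite /tc /cells; lia.
    - rewrite !upd_neq; try by rewrite /tc /hb; lia.
      by rewrite hbj.
    - move=> y hy; rewrite inE negb_or => /andP[y1 y2].
      rewrite !upd_neq; try by rewrite /tc /hb; lia.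
      by rewrite hbj // hbyi // inE negb_or y1.
  have [k [mi [sti lei simi hbi hbyi]]] := loop n (leqnn n).
  exists (size lp + (k + 2))%N, mi; split=> //.
  + apply: steps_trans sta _; apply: steps_trans sti _.
    apply: StS.
      by apply: S_jlt_f hj _; rewrite hbi (sim_nv simi) //= fupd_eq ltxx.
    apply: StS; first exact: S_jmp hj2.
    rewrite /= -/lp -/p0 -/lb size_cat /= size_cat /=.
    suff -> : (p0 + size lb + 5 = pc + (size lp + (size lb + 3).+2))%N by exact: St0.
    rewrite /p0; lia.
  + move: lei; rewrite /= -/n.
    set F := fun j : 'I_n => cost c (setn (iter_for c x j s) x j).
    have -> : (\sum_(j < n) (weight c * cost c (setn (iter_for c x j s) x j) + 4) =
              weight c * \sum_(j < n) F j + n * 4)%N.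
      by rewrite big_split /= big_distrr /= sum_nat_const card_ord.
    have -> : (\sum_(j < n) (cost c (setn (iter_for c x j s) x j)).+1 =
              \sum_(j < n) F j + n)%N.
      under eq_bigr do rewrite -addn1.
      by rewrite big_split /= sum_nat_const card_ord muln1.
    rewrite /lp size_cat /=; set S := (\sum_(j < n) F j)%N.
    set W := maxn _ _; move=> hk.
    (* Three instructions after the evaluation of the bound and two steps on exit make 5, paid by
       the unit charged for the loop; the unit charged for each iteration pays its 4 extra steps. *)
    have h1 : (size (cen e 0) + 5 <= W)%N by rewrite leq_maxl.
    have h2 : (weight c <= W)%N by rewrite leq_maxr.
    have h3 : (weight c * S <= W * S)%N by rewrite leq_mul2r h2 orbT.
    have h4 : (n * 4 <= W * n)%N by rewrite mulnC leq_mul2r; lia.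
    rewrite mulnS mulnDr; lia.
Qed.

End Compiler.

(* The cells below [cells] hold part of the input.  They are first copied to
   the zone starting at [256 * (m + n)], which lies beyond the input; the
   pointer to that zone has to be built in cell 0 alone. *)
Definition stash (j : nat) : seq instr :=
  flatten [seq [:: IAdd 0 0 2; IStore 0 r] | r <- iota 3 j].

Lemma stashS j : stash j.+1 = stash j ++ [:: IAdd 0 0 2; IStore 0 (3 + j)].
Proof. by rewrite /stash -[j.+1]addn1 iotaD map_cat flatten_cat. Qed.

(** One addition and eight doublings turn m into b = 256 (m + n) in cell 0. Then delta goes to cell
    b, the constant 1 to cell 2, and the cells 3 to 199 to b + 1, ..., b + 197. With b restored, m
    is recovered as b / 256 - n; delta moves to the real scalar 0, the array zone is placed at b +
    200, and the remaining integer scalars are cleared. *)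
Definition prologue : seq instr :=
  (IAdd 0 0 1 :: nseq 8 (IAdd 0 0 0)) ++ [:: IStore 0 2; ICst 2 1] ++
  stash 197 ++
  [:: ICst 3 197; ISub 0 0 3; ICst 4 256; IDiv 4 0 4; ISub 4 4 1;
      ILoad 128 0; ICst 5 200; IAdd 160 0 5; ICst 6 0;
      IAdd 2 1 6; IAdd 1 4 6; IAdd 3 0 6; ICst 0 0] ++
  [seq ICst r 0 | r <- iota 4 60].

Section Prologue.
Variable R : realType.
Implicit Types (m : rmem R) (P Q : seq (pt R)).

Lemma stash_ok b j m : (256 < b)%N -> (j <= 197)%N ->
  m 0%N = b%:R -> m 2%N = 1 ->
  exists2 m', exs (stash j) m m' &
   [/\ m' 0%N = (b + j)%:R,
       forall i, (0 < i <= b)%N || (b + j < i)%N -> m' i = m i &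
       forall i, (i < j)%N -> m' (b + 1 + i)%N = m (3 + i)%N].
Proof.
move=> hb hj h0 h2; elim: j hj => [|j IH] hj.
  by exists m; [exact: Exs0|rewrite addn0; split=> // i; rewrite ltnn /=; case: i].
have [m' e [k0 k1 k2]] := IH (ltnW hj).
exists (upd (upd m' 0 (b + j.+1)%:R) (b + j.+1) (m' (3 + j)%N)).
  rewrite stashS; apply: exs_cat e _; apply: ex_add; rewrite k0 (k1 2%N) ?h2 -?mulrSr; last by lia.
  apply: (ex_store (k := b + j.+1)); first by rewrite upd_eq addnS.
  rewrite [in X in upd _ _ X]upd_neq // addnS; exact: Exs0.
split.
- by rewrite upd_neq ?upd_eq //; lia.
- by move=> i hi; rewrite !upd_neq ?k1 //; lia.
- move=> i; rewrite ltnS leq_eqVlt => /orP[/eqP ->|hi].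
    by rewrite addnAC -addnA addn1 upd_eq k1 //; lia.
  rewrite !upd_neq ?k2 //; lia.
Qed.

Record initial (P Q : seq (pt R)) (delta : R) (s : st R) : Prop := Initial {
  ini_nv : forall x, nv s x = if x == 1%N then size P else
     if x == 2%N then size Q else
     if x == 3%N then (256 * (size P + size Q))%N else 0%N;
  ini_delta : rv s 0%N = delta;
  ini_na : forall A k, na s A k = 0%N;
  ini_bs : bs s = (256 * (size P + size Q) + cells)%N;
  ini_raw : forall k, (3 + k < 256 * (size P + size Q))%N ->
     raw s (if (k + 3 < cells)%N then 256 * (size P + size Q) + 1 + k
            else 3 + k)%N = input_mem P Q delta (3 + k)%N }.

Lemma zero_cells_ok m lo len :
  exists2 m', exs [seq ICst r 0 | r <- iota lo len] m m' &
   forall i, m' i = if (lo <= i < lo + len)%N then 0 else m i.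
Proof.
elim: len lo m => [|n IH] lo m.
  by exists m; [exact: Exs0|move=> i; case: ifP => // /andP[]; lia].
have [m' e h] := IH lo.+1 (upd m lo 0).
exists m'; first by apply: ex_cst.
move=> i; rewrite h /upd; case: eqP => [->|ne].
  by rewrite ltnn /= leqnn /= addnS ltnS leq_addr.
by congr (if _ then _ else _); lia.
Qed.

Lemma input_mem_big P Q delta i : (3 + 2 * (size P + size Q) <= i)%N ->
  input_mem P Q delta i = 0.
Proof.
by move=> h; rewrite /input_mem !ifN //; lia.
Qed.

Lemma prologue_ok P Q delta : (0 < size P)%N -> (0 < size Q)%N ->
  exists m' s, [/\ exs prologue (input_mem P Q delta) m', sim s m' &
    initial P Q delta s].
Proof.
move=> hP hQ; set b := (256 * (size P + size Q))%N.
have hb : (256 <= b)%N by rewrite /b; lia.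
set inp := input_mem P Q delta.
have [m1 e1 [p0 p1]] : exists2 m1, exs (IAdd 0 0 1 :: nseq 8 (IAdd 0 0 0)) inp m1 &
    m1 0%N = b%:R /\ forall i, (0 < i)%N -> m1 i = inp i.
  eexists; first by do 9! apply: ex_add; exact: Exs0.
  split; last by move=> i hi; rewrite !upd_neq //; lia.
  rewrite /upd /= /inp /input_mem /= -!natrD; congr _%:R.
  by rewrite /b; lia.
pose m2 := upd (upd m1 b delta) 2 1.
have e2 : exs [:: IStore 0 2; ICst 2 1] m1 m2.
  apply: (ex_store p0); apply: ex_cst; rewrite p1 //; exact: Exs0.
have q0 : m2 0%N = b%:R by rewrite /m2 !upd_neq //; lia.
have qb : m2 b = delta by rewrite /m2 upd_neq ?upd_eq //; lia.
have q2 : m2 2%N = 1 by rewrite /m2 upd_eq.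
have q1 i : (0 < i)%N && (i != 2)%N && (i != b) -> m2 i = inp i.
  by move=> hi; rewrite /m2 !upd_neq ?p1 //; lia.
have bgt : (256 < b)%N by rewrite /b; lia.
have [m3 e3 [r0 r1 r2]] := stash_ok bgt (leqnn 197) q0 q2.
set tl := [:: ICst 3 197; ISub 0 0 3; ICst 4 256; IDiv 4 0 4; ISub 4 4 1;
      ILoad 128 0; ICst 5 200; IAdd 160 0 5; ICst 6 0;
      IAdd 2 1 6; IAdd 1 4 6; IAdd 3 0 6; ICst 0 0].
have m31 : m3 1%N = (size Q)%:R.
  by rewrite r1 //= ?q1 //; lia.
have [m4 e4 [s1 s2 s3 [s4 s5] [s7 s6]]] : exists2 m4, exs tl m3 m4 &
   [/\ m4 0%N = 0, m4 1%N = (size P)%:R, m4 2%N = (size Q)%:R,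
       m4 3%N = b%:R /\ m4 128 = delta &
       m4 160 = (b + 200)%:R /\
       forall i, (cells <= i)%N -> m4 i = m3 i].
  have x1 : (b + 197)%:R - 197%:~R = b%:R :> R.
    by rewrite natrD -pmulrn addrK.
  have x2 : b%:R / 256%:~R - (size Q)%:R = (size P)%:R :> R.
    have h : 256%:R != 0 :> R by rewrite pnatr_eq0.
    by rewrite /b natrM -pmulrn mulrAC mulfV // mul1r natrD addrK.
  have [a1 f1 [a10 a14 a1i]] : exists2 a1,
     exs [:: ICst 3 197; ISub 0 0 3; ICst 4 256; IDiv 4 0 4; ISub 4 4 1] m3 a1 &
     [/\ a1 0%N = b%:R, a1 4%N = (size P)%:R &
       forall i, (i != 0)%N && (i != 3)%N && (i != 4)%N -> a1 i = m3 i].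
    have [c1 g1 [c10 c1i]] : exists2 c1, exs [:: ICst 3 197; ISub 0 0 3] m3 c1 &
       c1 0%N = b%:R /\ forall i, (i != 0)%N && (i != 3)%N -> c1 i = m3 i.
      eexists; first by apply: ex_cst; apply: ex_sub; exact: Exs0.
      rewrite upd_eq upd_eq upd_neq // r0 x1; split=> // i hi.
      by rewrite !upd_neq //; lia.
    eexists.
      apply: (exs_cat g1 (l2 := [:: ICst 4 256; IDiv 4 0 4; ISub 4 4 1])).
      apply: ex_cst; apply: ex_div; first by rewrite upd_eq -pmulrn pnatr_eq0.
      rewrite upd_eq upd_neq // c10; apply: ex_sub; exact: Exs0.
    rewrite upd_eq upd_eq !upd_neq // c10 c1i // m31 x2; split=> // i hi.
    by rewrite !upd_neq ?c1i //; lia.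
  have [a2 f2 [a20 a2d a2b a2i]] : exists2 a2,
     exs [:: ILoad 128 0; ICst 5 200; IAdd 160 0 5; ICst 6 0] a1 a2 &
     [/\ a2 0%N = b%:R, a2 128%N = delta, a2 160%N = (b + 200)%:R &
       a2 6%N = 0 /\
       forall i, [&& i != 5, i != 6, i != 128 & i != 160]%N -> a2 i = a1 i].
    eexists.
      apply: (ex_load a10); apply: ex_cst; apply: ex_add; apply: ex_cst.
      exact: Exs0.
    split.
    - by rewrite 4?upd_neq.
    - by rewrite 3?upd_neq // upd_eq a1i ?r1 ?qb //; lia.
    - by rewrite upd_neq // upd_eq [in X in _ + X]upd_eq !upd_neq // a10 natrD -pmulrn.
    - split; first by rewrite upd_eq.
      by move=> i /and4P[? ? ? ?]; rewrite !upd_neq.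
  have [a26 a2j] := a2i.
  eexists.
    apply: (exs_cat f1 (exs_cat f2 (l2 := [:: IAdd 2 1 6; IAdd 1 4 6; IAdd 3 0 6; ICst 0 0] ) _)).
    do 3! [apply: ex_add]; apply: ex_cst; exact: Exs0.
  split.
  - by rewrite upd_eq.
  - by rewrite 2?upd_neq // upd_eq !upd_neq // a26 addr0 a2j // a14.
  - by rewrite 3?upd_neq // upd_eq a26 addr0 a2j // a1i // m31.
  - split; last by rewrite !upd_neq.
    by rewrite upd_neq // upd_eq !upd_neq // a26 addr0 a20.
  - split; first by rewrite !upd_neq.
    move=> i; rewrite /cells => hi; rewrite !upd_neq ?a2j ?a1i //; lia.
have [m5 e5 t] := zero_cells_ok m4 4 60.
exists m5.
pose s0 := St (fun x => if x == 1%N then size P else if x == 2%N then size Q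
                        else if x == 3%N then b else 0%N)
  (fun x => m5 (cr x)) (fun _ _ => 0%N) (fun _ _ => 0) m5 (b + cells)%N.
have u i : (cells <= i)%N -> m5 i = m3 i.
  by rewrite /cells => hi; rewrite t ifN ?s6 //; lia.
have z i : (b + cells <= i)%N -> m5 i = 0.
  rewrite /cells => hi; rewrite u ?r1 ?q1; try (rewrite /cells; lia).
  by rewrite /inp input_mem_big //; move: hi; rewrite /b; lia.
exists s0; split.
- exact: exs_cat e1 (exs_cat e2 (exs_cat e3 (exs_cat e4 e5))).
- split=> //=.
  + by rewrite t /= /cbase s7.
  + by rewrite leq_addl.
  + move=> x hx; rewrite t.
    move: x hx => [|[|[|[|x]]]] hx //=; try by rewrite ?s1 ?s2 ?s3 ?s4.
    by rewrite ifT //; lia.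
  + by move=> A k hA; rewrite z // /arr -addnA leq_addr.
  + by move=> A k hA; rewrite z // /arr -addnA leq_addr.
- split=> //=.
  + by rewrite t /= /cr addn0 s5.
  + move=> k; rewrite -/b -/inp => hk.
    case: ifP => hk'; rewrite u; try (rewrite /cells in hk' *; lia).
      by rewrite r2 ?q1 //; rewrite /cells in hk'; lia.
    rewrite r1 ?q1 //; lia.
Qed.

Lemma ram_program (c : com) : wfc c -> exists prog W, forall P Q delta,
  (0 < size P)%N -> (0 < size Q)%N -> exists2 s : st R, initial P Q delta s &
   (safe c s -> exists k out,
     [/\ exec prog (0%N, input_mem P Q delta) k out,
         out 0%N = (nv (run c s) 0%N)%:R & (k <= W * (cost c s).+1)%N]).
Proof.
move=> wc; exists (prologue ++ cc c (size prologue)), (size prologue + weight c)%N.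
move=> P Q delta hP hQ; have [m [s [he hs hi]]] := prologue_ok delta hP hQ.
exists s => // hsafe; set prog := _ ++ _.
have [h1 h2] : code_at prog 0 prologue /\ code_at prog (0 + size prologue) (cc c (size prologue)).
  by apply: code_at_cat.
have [k [m' [hk le hs' _]]] := cc_ok wc h2 hs hsafe.
exists (size prologue + k)%N, m'; split.
- apply: steps_exec (steps_trans (exs_steps h1 he) hk) _.
  by rewrite nth_default // size_cat add0n.
- by rewrite (sim_nv hs').
- rewrite mulnS; lia.
Qed.
End Prologue.

(** * Planar reachability relations and their hulls *)

Section Relations.
Implicit Types (X Y : nat -> nat -> Prop) (lo hi lp hp : nat -> nat).

Definition half N lo hi X := forall a, (a < N)%N ->
  [/\ (lo a <= N)%N, (hi a <= N)%N,
      forall b, (b < N)%N -> X a b -> (lo a <= b < hi a)%N &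
      (lo a < hi a)%N -> X a (lo a) /\ X a (hi a).-1].

(** Planarity in combinatorial form: entries and exits are both numbered from the lower left corner,
    so paths joining a to b' and a' to b must meet and can exchange their tails. It is checked
    directly for one cell and for the partial identities, and it is inherited by extensions and
    compositions. *)
Definition cross N X := forall a a' b b',
  (a < a')%N -> (a' < N)%N -> (b < b')%N -> (b' < N)%N ->
  X a b' -> X a' b -> X a b /\ X a' b'.

(* For a relation with the crossing property of planar connectivity, the
   half-open hulls of its rows and of its columns determine it. *)
Definition rep N lo hi lp hp X :=
  [/\ half N lo hi X, half N lp hp (fun b a => X a b) & cross N X].

Lemma rep_tr N lo hi lp hp X : rep N lo hi lp hp X ->
  rep N lp hp lo hi (fun b a => X a b).
Proof.
move=> [h1 h2 h3]; split=> // a a' b b' ha ha' hb hb' x1 x2.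
by have [] := h3 _ _ _ _ hb hb' ha ha' x2 x1.
Qed.

(** If column b is nonempty, its first element lies at, before or after a. Unless it is a itself, it
    forms a crossing with one end of the hull of row a, and the exchange puts (a, b) into the
    relation. *)
Lemma rep_mem N lo hi lp hp X a b : rep N lo hi lp hp X ->
  (a < N)%N -> (b < N)%N -> X a b <-> ((lo a <= b < hi a)%N /\ (lp b < hp b)%N).
Proof.
move=> [h1 h2 h3] ha hb; have [l1 l2 l3 l4] := h1 a ha.
have [k1 k2 k3 k4] := h2 b hb; split=> [x|[hab hpb]].
  by split; [exact: l3|have := k3 a ha x; lia].
have [x1 x2] := l4 ltac:(lia); have [y1 _] := k4 hpb.
case: (ltngtP (lp b) a) => [lt|lt|<-] //.
- move: hab; rewrite leq_eqVlt => /andP[/orP[/eqP <- //|lb] _].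
  by have [] := h3 _ _ _ _ lt ha lb hb y1 x1.
- case: (ltngtP b (hi a).-1) => [lb|lb|-> //].
    by have [] := h3 _ _ _ _ lt ltac:(lia) lb ltac:(lia) x2 y1.
  by move: hab lb; lia.
Qed.

Definition rcomp N X Y a c := exists b, [/\ (b < N)%N, X a b & Y b c].

Lemma cross_rcomp N X Y : cross N X -> cross N Y -> cross N (rcomp N X Y).
Proof.
move=> hX hY a a' c c' ha ha' hc hc' [b [hb xb yb]] [b' [hb' xb' yb']].
case: (ltngtP b b') => [lt|lt|e].
- have [y1 y2] := hY _ _ _ _ lt hb' hc hc' yb yb'.
  by split; [exists b|exists b'].
- have [x1 x2] := hX _ _ _ _ ha ha' lt hb xb xb'.
  by split; [exists b'|exists b].
- by subst b'; split; exists b.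
Qed.

Definition nx_spec N (ok : nat -> bool) (nx : nat -> nat) := forall f, (f <= N)%N ->
  [/\ (f <= nx f <= N)%N, forall g, (f <= g < nx f)%N -> ~~ ok g &
      (nx f < N)%N -> ok (nx f)].

Definition pv_spec N (ok : nat -> bool) (pv : nat -> nat) := forall f, (f <= N)%N ->
  [/\ (pv f <= f)%N, forall g, (pv f <= g < f)%N -> ~~ ok g &
      (0 < pv f)%N -> ok (pv f).-1].

(** A fixed form for empty hulls. Without it the ends of an empty hull could exceed the smaller
    number of ports left after a restriction. *)
Definition tidy N lo hi :=
  forall a, (a < N)%N -> (lo a < hi a)%N \/ (lo a = 0 /\ hi a = 0)%N.

Lemma half_and N lo hi X :
  (forall a, (a < N)%N ->
    [/\ (lo a <= N)%N, (hi a <= N)%N,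
      forall b, (b < N)%N -> X a b -> (lo a <= b < hi a)%N &
      (lo a < hi a)%N -> X a (lo a) /\ X a (hi a).-1] /\
    ((lo a < hi a)%N \/ (lo a = 0 /\ hi a = 0)%N)) ->
  half N lo hi X /\ tidy N lo hi.
Proof. by move=> h; split=> a /h []. Qed.

(** Call an interface port useful if something reaches it through X and it leads somewhere through
    Y. By [rep_mem], the useful ports within the hull of row a are exactly those through which a can
    continue. By the crossing property of Y, the first of them has the leftmost exit and the last
    one the rightmost exit, so two table lookups yield the hull of the composed row. *)
Lemma half_rcomp N ok nx pv rlo rhi rlp rhp slo shi slp shp lo hi X Y :
  rep N rlo rhi rlp rhp X -> rep N slo shi slp shp Y ->
  nx_spec N ok nx -> pv_spec N ok pv ->
  (forall b, (b < N)%N -> ok b = (slo b < shi b)%N && (rlp b < rhp b)%N) ->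
  (forall a, (a < N)%N ->
    (lo a, hi a) = if (nx (rlo a) < pv (rhi a))%N
      then (slo (nx (rlo a)), shi (pv (rhi a)).-1) else (0, 0)%N) ->
  half N lo hi (rcomp N X Y) /\ tidy N lo hi.
Proof.
move=> hX hY hn hp ho hlh; apply: half_and => a ha.
have [X1 X2 X3] := hX; have [Y1 Y2 Y3] := hY.
have [l1 l2 l3 l4] := X1 a ha.
have [n1 n2 n3] := hn _ l1; have [p1 p2 p3] := hp _ l2.
have key b c : (b < N)%N -> (c < N)%N -> X a b -> Y b c ->
    (nx (rlo a) <= b < pv (rhi a))%N.
  move=> hb hc xb yb.
  have ob : ok b.
    rewrite ho //; have /(rep_mem hX ha hb) [_ ->] := xb.
    have [_ _ k3 _] := Y1 b hb; have := k3 c hc yb; lia.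
  have := l3 b hb xb => hab.
  have : ~~ ((rlo a <= b < nx (rlo a))%N) by apply/negP => /n2; rewrite ob.
  have : ~~ ((pv (rhi a) <= b < rhi a)%N) by apply/negP => /p2; rewrite ob.
  lia.
have := hlh a ha; case: ifP => hc [-> ->]; last first.
  split; last by right.
  split=> // c hcN [b [hb xb yb]]; have := key b c hb hcN xb yb; lia.
set f := nx (rlo a) in n1 n2 n3 key hc *; set g := (pv (rhi a)).-1 in p3 *.
have fN : (f < N)%N by lia.
have gN : (g < N)%N by rewrite /g; lia.
have of1 := n3 fN; have og := p3 ltac:(lia).
have xf : X a f.
  apply/(rep_mem hX ha fN); move: of1; rewrite ho //; lia.
have xg : X a g.
  apply/(rep_mem hX ha gN); move: og; rewrite ho // /g; lia.
have [kf1 kf2 kf3 kf4] := Y1 f fN; have [kg1 kg2 kg3 kg4] := Y1 g gN.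
have [yf _] := kf4 ltac:(by move: of1; rewrite ho // => /andP[]).
have [_ yg] := kg4 ltac:(by move: og; rewrite ho // => /andP[]).
have lt_f : (slo f < shi f)%N by move: of1; rewrite ho // => /andP[].
have lt_g : (slo g < shi g)%N by move: og; rewrite ho // => /andP[].
have mem c : (c < N)%N -> rcomp N X Y a c -> (slo f <= c < shi g)%N.
  move=> hcN [b [hb xb yb]]; have := key b c hb hcN xb yb => hbr.
  apply/andP; split.
  + rewrite leqNgt; apply/negP => hlt.
    have : (f <= b)%N by case/andP: hbr.
    rewrite leq_eqVlt => /orP[/eqP e|lt]; first by rewrite -e in yb; have := kf3 c hcN yb; lia.
    have [y1 _] := Y3 _ _ _ _ lt hb hlt ltac:(lia) yf yb.
    by have := kf3 c hcN y1; lia.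
  + rewrite ltnNge; apply/negP => hge.
    have : (b <= g)%N by rewrite /g; lia.
    rewrite leq_eqVlt => /orP[/eqP e|lt]; first by rewrite e in yb; have := kg3 c hcN yb; lia.
    have [_ y2] := Y3 b g (shi g).-1 c lt gN ltac:(lia) hcN yb yg.
    by have := kg3 c hcN y2; lia.
have cf : rcomp N X Y a (slo f) by exists f.
split; last by left; have := mem (slo f) ltac:(lia) cf; lia.
by split=> // _; split=> //; exists g.
Qed.

Lemma half_eqv N lo hi X Y :
  (forall a b, (a < N)%N -> (b < N)%N -> X a b <-> Y a b) ->
  half N lo hi X -> half N lo hi Y.
Proof.
move=> e h a ha; have [h1 h2 h3 h4] := h a ha.
split=> // [b hb /(e _ _ ha hb)|hlt]; first exact: h3.
by have [x y] := h4 hlt; split; apply/e => //; lia.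
Qed.

(** The columns follow by transposition. Usefulness of a port is symmetric, so the same two tables
    serve rows and columns. *)
Lemma rep_rcomp N ok nx pv rlo rhi rlp rhp slo shi slp shp lo hi lp hp X Y :
  rep N rlo rhi rlp rhp X -> rep N slo shi slp shp Y ->
  nx_spec N ok nx -> pv_spec N ok pv ->
  (forall b, (b < N)%N -> ok b = (slo b < shi b)%N && (rlp b < rhp b)%N) ->
  (forall a, (a < N)%N ->
    (lo a, hi a) = if (nx (rlo a) < pv (rhi a))%N
      then (slo (nx (rlo a)), shi (pv (rhi a)).-1) else (0, 0)%N) ->
  (forall a, (a < N)%N ->
    (lp a, hp a) = if (nx (slp a) < pv (shp a))%N
      then (rlp (nx (slp a)), rhp (pv (shp a)).-1) else (0, 0)%N) ->
  [/\ rep N lo hi lp hp (rcomp N X Y), tidy N lo hi & tidy N lp hp].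
Proof.
move=> hX hY hn hp' ho h1 h2.
have [k1 k2] := half_rcomp hX hY hn hp' ho h1.
have [|k3 k4] := half_rcomp (rep_tr hY) (rep_tr hX) hn hp' _ h2.
  by move=> b hb; rewrite ho // andbC.
split=> //; split=> //.
- by apply: half_eqv k3 => a b _ _; split=> -[x [? ? ?]]; exists x.
- by case: hX hY => [_ _ c1] [_ _ c2]; exact: cross_rcomp.
Qed.

Lemma rep_shrink N n lo hi lp hp X : rep N lo hi lp hp X -> (n <= N)%N ->
  (forall a, (a < n)%N -> [&& lo a <= n, hi a <= n, lp a <= n & hp a <= n]%N) ->
  rep n lo hi lp hp X.
Proof.
move=> [h1 h2 h3] hn hb; split.
- move=> a ha; have [k1 k2 k3 k4] := h1 a (leq_trans ha hn).
  have /and4P[b1 b2 b3 b4] := hb a ha; split=> // b hb'.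
  by apply: k3; apply: leq_trans hn.
- move=> a ha; have [k1 k2 k3 k4] := h2 a (leq_trans ha hn).
  have /and4P[b1 b2 b3 b4] := hb a ha; split=> // b hb'.
  by apply: k3; apply: leq_trans hn.
- move=> a a' b b' ha ha' hb1 hb'; apply: h3 => //; exact: leq_trans hn.
Qed.

Lemma rep_eqv N lo hi lp hp X Y :
  (forall a b, (a < N)%N -> (b < N)%N -> X a b <-> Y a b) ->
  rep N lo hi lp hp X -> rep N lo hi lp hp Y.
Proof.
move=> e [h1 h2 h3]; split.
- exact: half_eqv h1.
- by apply: half_eqv h2 => a b ha hb; exact: e.
- move=> a a' b b' ha ha' hb hb' x1 x2.
  have la : (a < N)%N by lia.
  have lb : (b < N)%N by lia.
  have [||y1 y2] := h3 _ _ _ _ ha ha' hb hb'; try by apply/e.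
  by split; apply/e.
Qed.

Lemma rep_ext_fun N lo hi lp hp lo' hi' lp' hp' X :
  (forall a, (a < N)%N ->
    [/\ lo' a = lo a, hi' a = hi a, lp' a = lp a & hp' a = hp a]) ->
  rep N lo hi lp hp X -> rep N lo' hi' lp' hp' X.
Proof.
move=> e [h1 h2 h3]; split=> //.
- by move=> a ha; have [-> -> _ _] := e a ha; exact: h1.
- by move=> a ha; have [_ _ -> ->] := e a ha; exact: h2.
Qed.

(** Ports outside the window belong to the sibling block and pass through unchanged. Merging two
    blocks thus becomes the composition of two relations on one set of ports. *)
Definition ext o n X a b :=
  ((o <= a < o + n)%N /\ (o <= b < o + n)%N /\ X (a - o)%N (b - o)%N) \/
  (a = b /\ ~~ (o <= a < o + n)%N).

Lemma half_ext N o n lo hi lo' hi' X : (o + n <= N)%N -> half n lo hi X ->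
  (forall i, (i < N)%N -> (lo' i, hi' i) =
     if (o <= i < o + n)%N then (lo (i - o) + o, hi (i - o) + o)%N else (i, i.+1)) ->
  half N lo' hi' (ext o n X).
Proof.
move=> hN h e a ha; have := e a ha; case: ifP => ha' [-> ->]; last first.
  split=> // [|b hb|_]; first exact: ltnW.
    by case=> [[h1]|[<- _]]; [rewrite h1 in ha'|rewrite leqnn ltnSn].
  by split; right; rewrite ha'.
have [k1 k2 k3 k4] := h (a - o)%N ltac:(lia).
split; try lia.
- move=> b hb [[_ [hb' x]]|[_]]; last by rewrite ha'.
  by have := k3 (b - o)%N ltac:(lia) x; lia.
- move=> hlt; have [x1 x2] := k4 ltac:(lia).
  split; left; split=> //; split; try lia.
  + by rewrite addnK.
  + by have -> : ((hi (a - o) + o).-1 - o = (hi (a - o)).-1)%N by lia.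
Qed.

Lemma cross_ext N o n X : cross n X -> cross N (ext o n X).
Proof.
move=> h a a' b b' ha ha' hb hb' x1 x2.
case: x1 => [[h1 [h2 x1]]|[e1 h1]]; case: x2 => [[h3 [h4 x2]]|[e2 h3]]; try lia.
have [y1 y2] := h (a - o)%N (a' - o)%N (b - o)%N (b' - o)%N ltac:(lia) ltac:(lia)
  ltac:(lia) ltac:(lia) x1 x2.
by split; left.
Qed.

Lemma ext_tr o n X a b : ext o n (fun b a => X a b) a b <-> ext o n X b a.
Proof. by rewrite /ext; split=> -[[? [? ?]]|[-> ?]]; tauto. Qed.

Lemma rep_ext N o n lo hi lp hp lo' hi' lp' hp' X : (o + n <= N)%N ->
  rep n lo hi lp hp X ->
  (forall i, (i < N)%N -> (lo' i, hi' i) =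
     if (o <= i < o + n)%N then (lo (i - o) + o, hi (i - o) + o)%N else (i, i.+1)) ->
  (forall i, (i < N)%N -> (lp' i, hp' i) =
     if (o <= i < o + n)%N then (lp (i - o) + o, hp (i - o) + o)%N else (i, i.+1)) ->
  rep N lo' hi' lp' hp' (ext o n X).
Proof.
move=> hN [h1 h2 h3] e1 e2; split.
- exact: half_ext h1 e1.
- apply: half_eqv (half_ext hN h2 e2) => a b _ _; exact: ext_tr.
- exact: cross_ext.
Qed.

(* The partial identities that keep the left entries of a square block and its
   right exits. *)
Definition pleft M a b := a = b /\ (a < M)%N.
Definition pright M a b := a = (b + M)%N /\ (b < M)%N.

Lemma rep_pleft M lo hi lp hp :
  (forall i, (i < M + M)%N -> (lo i, hi i) = if (i < M)%N then (i, i.+1) else (0, 0)%N) ->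
  (forall i, (i < M + M)%N -> (lp i, hp i) = if (i < M)%N then (i, i.+1) else (0, 0)%N) ->
  rep (M + M) lo hi lp hp (pleft M).
Proof.
move=> e1 e2; rewrite /pleft; split.
- move=> a ha; have := e1 a ha; case: ifP => h [-> ->]; split; try lia.
- move=> a ha; have := e2 a ha; case: ifP => h [-> ->]; split; try lia.
- by move=> a a' b b' *; lia.
Qed.

Lemma rep_pright M lo hi lp hp :
  (forall i, (i < M + M)%N -> (lo i, hi i) = if (i < M)%N then (0, 0)%N else (i - M, (i - M).+1)%N) ->
  (forall i, (i < M + M)%N -> (lp i, hp i) = if (i < M)%N then (i + M, (i + M).+1)%N else (0, 0)%N) ->
  rep (M + M) lo hi lp hp (pright M).
Proof.
move=> e1 e2; rewrite /pright; split.
- by move=> a ha; have := e1 a ha; case: ifP => h [-> ->]; split; lia.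
- by move=> a ha; have := e2 a ha; case: ifP => h [-> ->]; split; lia.
- by move=> a a' b b' *; lia.
Qed.

(** Once a block has the full height M, nothing enters from above and nothing is needed below.
    Keeping only its left and right sides holds the number of ports at M while the blocks grow
    wider. *)
Definition restr M X := rcomp (M + M) (rcomp (M + M) (pleft M) X) (pright M).

Lemma rep_restr M lo hi lp hp X :
  rep (M + M) lo hi lp hp (restr M X) -> tidy (M + M) lo hi -> tidy (M + M) lp hp ->
  rep M lo hi lp hp (restr M X).
Proof.
move=> h t1 t2; apply: (rep_shrink h); first by rewrite leq_addr.
move=> a ha; have ha' : (a < M + M)%N by lia.
have in_M x y : restr M X x y -> (x < M)%N /\ (y < M)%N.
  by case=> c [_ [d [_ [-> ?] _]] [_ ?]].
have [h1 h2 _] := h.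
have /andP[-> ->] : (lo a <= M)%N && (hi a <= M)%N.
  have [_ _ _ k] := h1 a ha'; case: (t1 a ha') => [lt|[-> ->]] //.
  by have [/in_M [_ ?] /in_M [_ ?]] := k lt; lia.
have [_ _ _ k] := h2 a ha'; case: (t2 a ha') => [lt|[-> ->]] //.
by have [/in_M [? _] /in_M [? _]] := k lt; lia.
Qed.

Lemma restrE M X a b : (a < M)%N -> (b < M)%N -> restr M X a b <-> X a (M + b)%N.
Proof.
move=> ha hb; split.
  by case=> c [_ [d [_ [<- _] x]] [e _]]; rewrite addnC -e.
move=> x; exists (M + b)%N; split; [lia| |by split; rewrite // addnC].
by exists a; split; [lia| |].
Qed.

(* [H i j] and [V i j]: a path may enter cell [(i, j)] from the left, or from
   above.  A diagonal step from [(i, j)] to [(i.+1, j.+1)] is routed through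
   the upper right corner of cell [(i.+1, j)], free or not; thus [V i j] always
   yields [H i j.+1]. *)
Section Transfer.
Variables (H V : nat -> nat -> Prop).

Definition cell_eqs (F : Prop) r c :=
  (V r.+1 c <-> F /\ (H r c \/ V r c)) /\ (H r c.+1 <-> V r c \/ (F /\ H r c)).

(* The entries of a block, from its lower left corner to its upper right one
   along the left and upper sides, and its exits along the other two sides. *)
Definition pin r c s a := if (a < s)%N then H (r + (s - a.+1)) c else V r (c + (a - s)).
Definition pout r c s w b :=
  if (b < w)%N then V (r + s) (c + b) else H (r + (s - (b - w).+1)) (c + w).

Definition trans N X (vi vo : nat -> Prop) := forall b, (b < N)%N ->
  (vo b <-> exists a, [/\ (a < N)%N, vi a & X a b]).

Definition block_tr r c s w X := trans (s + w) X (pin r c s) (pout r c s w).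

Lemma trans_rcomp N X Y vi vm vo : trans N X vi vm -> trans N Y vm vo ->
  trans N (rcomp N X Y) vi vo.
Proof.
move=> h1 h2 b hb; split.
  case/(h2 b hb) => a [ha /(h1 a ha) [a' [ha' v x]] y].
  by exists a'; split=> //; exists a.
case=> a [ha v [a' [ha' x y]]]; apply/(h2 b hb).
by exists a'; split=> //; apply/(h1 a' ha'); exists a.
Qed.

Lemma trans_ext N o n X vi vo : (o + n <= N)%N ->
  trans n X (fun a => vi (o + a)%N) (fun b => vo (o + b)%N) ->
  (forall b, (b < N)%N -> ~~ (o <= b < o + n)%N -> vi b <-> vo b) ->
  trans N (ext o n X) vi vo.
Proof.
move=> hN h1 h2 b hb; case: (boolP (o <= b < o + n)%N) => hb'.
- have := h1 (b - o)%N ltac:(lia); rewrite subnKC => [->|]; last by lia.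
  split=> [[a [ha v x]]|[a [ha v [[h3 [h4 x]]|[e h3]]]]].
  + exists (o + a)%N; split=> //; first by lia.
    left; rewrite addKn; split; first by lia.
    by split.
  + exists (a - o)%N; split=> //; first by lia.
    by rewrite subnKC //; lia.
  + by subst b; rewrite hb' in h3.
- split=> [v|[a [ha v [[h3 [h4 x]]|[e h3]]]]].
  + by exists b; split=> //; [apply/h2|right].
  + by rewrite h4 in hb'.
  + by subst b; apply/h2.
Qed.

Lemma eq_trans N X vi vo vi' vo' :
  (forall a, (a < N)%N -> vi a <-> vi' a) -> (forall a, (a < N)%N -> vo a <-> vo' a) ->
  trans N X vi vo -> trans N X vi' vo'.
Proof.
move=> e1 e2 h b hb; rewrite -e2 // h //.
by split=> -[a [ha v x]]; exists a; split=> //; apply/e1.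
Qed.

Lemma eq_vec (P : nat -> nat -> Prop) i j i' j' : i = i' -> j = j' -> P i j <-> P i' j'.
Proof. by move=> -> ->. Qed.

(** The left block consumes the first s + w ports. It leaves w lower exits, then s right exits, and
    these s ports followed by the upper side of the right block are the entries of the latter: hence
    the windows 0 and w. *)
Lemma block_hmerge r c s w X Y :
  block_tr r c s w X -> block_tr r (c + w) s w Y ->
  block_tr r c s (w + w)
    (rcomp (s + w + w) (ext 0 (s + w) X) (ext w (s + w) Y)).
Proof.
move=> hX hY; rewrite /block_tr addnA.
pose vm b := if (b < s + w)%N then pout r c s w b else V r (c + (b - s)).
apply: (@trans_rcomp _ _ _ _ vm).
- apply: trans_ext; first by lia.
  + apply: eq_trans hX => a ha.
      by rewrite add0n.
    by rewrite /vm add0n ha.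
  + move=> b hb hb'; rewrite /pin /vm !ifN //; lia.
- apply: trans_ext; first by lia.
  + apply: eq_trans hY => a ha; rewrite /vm /pin /pout.
      do ?case: ifP => ? //; try lia; apply: eq_vec; lia.
    do ?case: ifP => ? //; try lia; apply: eq_vec; lia.
  + move=> b hb hb'; rewrite /vm /pout; do ?case: ifP => ? //; try lia; apply: eq_vec; lia.
Qed.

(** Here the first s ports are the left side of the lower block, so the upper block acts in the
    window s. Its w lower exits then sit just behind those s ports and complete the entries of the
    lower block, in the window 0. *)
Lemma block_vmerge r c s w X Y :
  block_tr r c s w X -> block_tr (r + s) c s w Y ->
  block_tr r c (s + s) w
    (rcomp (s + s + w) (ext s (s + w) X) (ext 0 (s + w) Y)).
Proof.
move=> hX hY; rewrite /block_tr.
pose vm b := if (b < s)%N then H (r + (s + s - b.+1)) c else pout r c s w (b - s).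
apply: (@trans_rcomp _ _ _ _ vm).
- apply: trans_ext; first by lia.
  + apply: eq_trans hX => a ha; rewrite /vm /pin /pout.
      do ?case: ifP => ? //; try lia; apply: eq_vec; lia.
    do ?case: ifP => ? //; try lia; apply: eq_vec; lia.
  + move=> b hb hb'; rewrite /vm /pin; do ?case: ifP => ? //; try lia; apply: eq_vec; lia.
- apply: trans_ext; first by lia.
  + apply: eq_trans hY => a ha; rewrite /vm /pin /pout add0n.
      do ?case: ifP => ? //; try lia; apply: eq_vec; lia.
    do ?case: ifP => ? //; try lia; apply: eq_vec; lia.
  + move=> b hb hb'; rewrite /vm /pout; do ?case: ifP => ? //; try lia; apply: eq_vec; lia.
Qed.

(* Relation between the left and the right side of a block of full height. *)
Definition wide_tr M c w X :=
  trans M X (fun a => H (M - a.+1) c) (fun b => H (M - b.+1) (c + w)).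

Lemma block_restr M c X : (forall j, ~ V 0 j) ->
  block_tr 0 c M M X -> wide_tr M c M (restr M X).
Proof.
move=> hV h b hb; have := h (M + b)%N ltac:(lia).
rewrite /pout ifN; last by lia.
rewrite add0n addKn => ->; split=> -[a [ha v x]].
  move: v; rewrite /pin; case: ifP => ha' v; last by have := hV _ v.
  by exists a; split=> //; apply/restrE.
exists a; split; [lia|by rewrite /pin ha|exact/restrE].
Qed.

Lemma wide_merge M c w X Y : wide_tr M c w X -> wide_tr M (c + w) w Y ->
  wide_tr M c (w + w) (rcomp M (ext 0 M X) (ext 0 M Y)).
Proof.
move=> hX hY; apply: (@trans_rcomp _ _ _ _ (fun b => H (M - b.+1) (c + w))).
- by apply: trans_ext => // b hb; rewrite add0n hb.
- apply: trans_ext => //; last by move=> b hb; rewrite add0n hb.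
  apply: eq_trans hY => // a _; apply: eq_vec; lia.
Qed.

(** The pair (1, 1), from the upper entry to the right exit, is the detour of a diagonal step and
    exists even in a blocked cell. *)
Definition cell_rel (F : Prop) a b := F \/ (a = 1%N /\ b = 1%N).

Lemma block_cell F r c : cell_eqs F r c -> block_tr r c 1 1 (cell_rel F).
Proof.
move=> [e1 e2] [|[|b]] // _; rewrite /pout /pin /cell_rel /=.
- rewrite addn1 addn0 e1; split.
    case=> f [h|v]; [exists 0%N|exists 1%N]; split=> //=; try by left.
      by rewrite ?subnn ?addn0.
    by rewrite ?subnn ?addn0.
  case=> -[|[|a]] [] // _ /=; rewrite ?subnn ?addn0 => h [f|[? ?]] //.
    by split=> //; left.
  by split=> //; right.
- rewrite ?subnn ?addn0 ?addn1 e2; split.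
    case=> [v|[f h]]; [exists 1%N|exists 0%N]; split=> //=.
      by rewrite ?subnn ?addn0.
      by right.
    by left.
  case=> -[|[|a]] [] // _ /=; rewrite ?subnn ?addn0 => h [f|[? ?]] //.
  - by right.
  - by left.
  - by left.
Qed.
End Transfer.

Lemma rep_cell (F : bool) lo hi lp hp :
  (forall i, (i < 2)%N -> (lo i, hi i) =
     if F then (0, 2)%N else if i == 0%N then (0, 0)%N else (1, 2)%N) ->
  (forall i, (i < 2)%N -> (lp i, hp i) =
     if F then (0, 2)%N else if i == 0%N then (0, 0)%N else (1, 2)%N) ->
  rep 2 lo hi lp hp (cell_rel F).
Proof.
move=> e1 e2; rewrite /cell_rel; case: F e1 e2 => e1 e2; split.
- move=> a ha; have [-> ->] := e1 a ha; split=> //= *; lia.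
- move=> a ha; have [-> ->] := e2 a ha; split=> //= *; lia.
- by move=> *; lia.
- by move=> [|[|a]] // ha; have [-> ->] := e1 _ ha; split=> //= *; lia.
- by move=> [|[|a]] // ha; have [-> ->] := e2 _ ha; split=> //= *; lia.
- by move=> *; lia.
Qed.
End Relations.

(** * Arcs of a circle inside a disk *)

Section Arcs.
Variable R : realType.
Implicit Types (delta s : R) (c d t : pt R).

Definition in_disk delta c t := (c.1 - t.1) ^+ 2 + (c.2 - t.2) ^+ 2 <= delta ^+ 2.

(* Stereographic parametrisation of the right half of a circle by [-1, 1]. *)
Definition circ delta c s : pt R :=
  (c.1 + delta * (1 - s ^+ 2) / (1 + s ^+ 2), c.2 + delta * (2 * s) / (1 + s ^+ 2)).

(** With [d] the difference of the centres, membership in the second disk, multiplied by 1 + s^2,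
    reads E s^2 + F <= 2 b s. A quarter of its discriminant, b^2 - E F, equals D (4 delta^2 - D),
    and [qr] is its square root. *)
Definition qD (d : pt R) := d.1 ^+ 2 + d.2 ^+ 2.
Definition qE delta d := qD d + 2 * delta * d.1.
Definition qF delta d := qD d - 2 * delta * d.1.
Definition qb delta d := 2 * delta * d.2.
Definition qr delta d := Num.sqrt (qD d * (4 * delta ^+ 2 - qD d)).

Lemma in_disk_circ delta c0 c s :
  in_disk delta c (circ delta c0 s) <->
  let d := (c.1 - c0.1, c.2 - c0.2) in
  qE delta d * s ^+ 2 + qF delta d <= 2 * qb delta d * s.
Proof.
rewrite /in_disk /circ /qE /qF /qb /qD /=.
set dx := c.1 - c0.1; set dy := c.2 - c0.2.
have p0 : 0 < 1 + s ^+ 2 by have := sqr_ge0 s; lra.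
set x := _ / _; set y := _ / _.
have hx : x * (1 + s ^+ 2) = delta * (1 - s ^+ 2) by rewrite mulfVK // gt_eqF.
have hy : y * (1 + s ^+ 2) = delta * (2 * s) by rewrite mulfVK // gt_eqF.
have hxy : x ^+ 2 + y ^+ 2 = delta ^+ 2.
  apply: (mulIf (x := (1 + s ^+ 2) ^+ 2)); first by rewrite expf_neq0 // gt_eqF.
  rewrite mulrDl -!exprMn hx hy; ring.
have -> : (c.1 - (c0.1 + x)) ^+ 2 + (c.2 - (c0.2 + y)) ^+ 2 =
  delta ^+ 2 + (dx ^+ 2 + dy ^+ 2 - 2 * (x * dx + y * dy)).
  rewrite -hxy /dx /dy; ring.
rewrite gerDl subr_le0 -(ler_pM2r p0).
have -> : 2 * (x * dx + y * dy) * (1 + s ^+ 2) =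
  2 * (delta * (1 - s ^+ 2) * dx + delta * (2 * s) * dy).
  rewrite -hx -hy; ring.
split=> h; lra.
Qed.

(* The parameters of the arc of a circle inside another disk of the same radius
   form an interval, written [al, be], or are empty when [~~ ne]. *)
Definition arc_spec delta d (ne : bool) (al be : R) :=
  (forall s, -1 <= s <= 1 ->
     (qE delta d * s ^+ 2 + qF delta d <= 2 * qb delta d * s <->
      ne /\ al <= s <= be)) /\
  (ne -> [/\ -1 <= al, al <= be & be <= 1]).

Lemma arc_same delta d : qD d <= 0 -> arc_spec delta d true (-1) 1.
Proof.
move=> h; have [dx0 dy0] : d.1 = 0 /\ d.2 = 0.
  move: h; rewrite /qD => h; have := sqr_ge0 d.1; have := sqr_ge0 d.2 => h1 h2.
  by split; apply/eqP; rewrite -sqrf_eq0; apply/eqP; lra.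
split; last by split; lra.
move=> s hs; rewrite /qE /qF /qb /qD dx0 dy0; split=> // _; nra.
Qed.

Lemma arc_far delta d al be : 0 < delta -> 4 * delta ^+ 2 < qD d ->
  arc_spec delta d false al be.
Proof.
move=> d0 h; split=> // s _; split=> [hq|[]] //; exfalso; move: hq h.
rewrite /qE /qF /qb /qD; set x := d.1; set y := d.2 => hq h.
have p0 : 0 < 1 + s ^+ 2 by have := sqr_ge0 s; lra.
(* A certificate: a parameter inside the disk makes the last summand nonnegative next to two
   squares, so 4 delta^2 could not be smaller than D. *)
have e : (4 * delta ^+ 2 - (x ^+ 2 + y ^+ 2)) * (1 + s ^+ 2) ^+ 2 =
   (2 * delta * (1 - s ^+ 2) - x * (1 + s ^+ 2)) ^+ 2 +
   (4 * delta * s - y * (1 + s ^+ 2)) ^+ 2 +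
   2 * (1 + s ^+ 2) * (2 * x * delta * (1 - s ^+ 2) + y * 4 * delta * s -
     (x ^+ 2 + y ^+ 2) * (1 + s ^+ 2)) by ring.
have : 0 <= (4 * delta ^+ 2 - (x ^+ 2 + y ^+ 2)) * (1 + s ^+ 2) ^+ 2.
  rewrite e; apply: addr_ge0; first by apply: addr_ge0; exact: sqr_ge0.
  by apply: mulr_ge0; lra.
rewrite pmulr_lge0; last by rewrite exprn_gt0.
lra.
Qed.

Lemma qr_sqr delta d : 0 < qD d -> qD d <= 4 * delta ^+ 2 ->
  qr delta d ^+ 2 = qb delta d ^+ 2 - qE delta d * qF delta d.
Proof.
move=> h1 h2; rewrite /qr sqr_sqrtr; last by apply: mulr_ge0; lra.
rewrite /qE /qF /qb /qD; ring.
Qed.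

(** The parabola opens upwards: multiplied by E, the inequality is (E s - b)^2 <= r^2. The interval
    between the roots is clipped to the parameter range. *)
Lemma arc_pos delta d al be : 0 < qD d -> qD d <= 4 * delta ^+ 2 ->
  0 < qE delta d ->
  let lo := (qb delta d - qr delta d) / qE delta d in
  let hi := (qb delta d + qr delta d) / qE delta d in
  al = (if lo < -1 then -1 else lo) -> be = (if 1 < hi then 1 else hi) ->
  arc_spec delta d (~~ (be < al)) al be.
Proof.
move=> h1 h2 hE lo hi; have := qr_sqr h1 h2.
have r0 : 0 <= qr delta d by exact: sqrtr_ge0.
rewrite /lo /hi; move: r0 hE; set E := qE _ _; set F := qF _ _.
set b := qb _ _; set r := qr _ _ => r0 hE hr.
have hlo s : ((b - r) / E <= s) = (b - r <= s * E) by rewrite ler_pdivrMr.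
have hhi s : (s <= (b + r) / E) = (s * E <= b + r) by rewrite ler_pdivlMr.
have key s : E * s ^+ 2 + F <= 2 * b * s <-> (b - r) / E <= s /\ s <= (b + r) / E.
  rewrite hlo hhi -(ler_pM2l hE).
  have -> : E * (E * s ^+ 2 + F) <= E * (2 * b * s) <-> (E * s - b) ^+ 2 <= r ^+ 2.
    by rewrite hr; split=> h; lra.
  rewrite -ler_sqrt ?sqr_ge0 // !sqrtr_sqr [`|r|]ger0_norm // ler_norml.
  by split=> [/andP[] *|[] *]; [split; lra|apply/andP; split; lra].
have lohi : (b - r) / E <= (b + r) / E by rewrite ler_pM2r ?invr_gt0 //; lra.
move=> eal ebe.
have hal s : -1 <= s -> (al <= s) = ((b - r) / E <= s).
  by rewrite eal; case: ltP => // h hs; rewrite hs (ltW (lt_le_trans h hs)).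
have hbe s : s <= 1 -> (s <= be) = (s <= (b + r) / E).
  by rewrite ebe; case: ltP => // h hs; rewrite hs (ltW (le_lt_trans hs h)).
rewrite -leNgt; split.
- move=> s /andP[s1 s2]; rewrite key (hal s) // (hbe s) //.
  split=> [[k1 k2]|[_ /andP[]] //]; rewrite k1 k2; split=> //.
  by apply: (@le_trans _ _ s); rewrite ?hal ?hbe.
- by move=> h; split=> //; [rewrite eal; case: ltP|rewrite ebe; case: ltP].
Qed.

(** From E + F = 2 D one gets F > 0, and the roots can be written F / (b + r) and F / (b - r),
    without dividing by E, which may vanish. Since |b| <= r, a parameter qualifies when it lies
    beyond one of two bounds of opposite sign, so at most two pieces could appear. *)
Lemma arc_npos delta d (ne : bool) al be : 0 < qD d -> qD d <= 4 * delta ^+ 2 ->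
  qE delta d <= 0 ->
  let b := qb delta d in let r := qr delta d in let F := qF delta d in
  (if ~~ (b + r < F) then [/\ ne, al = F / (b + r) & be = 1]
   else if ~~ (r - b < F) then [/\ ne, al = -1 & be = F / (b - r)]
   else ~~ ne) ->
  arc_spec delta d ne al be.
Proof.
move=> h1 h2 hE b r F; have hr := qr_sqr h1 h2.
have r0 : 0 <= qr delta d by exact: sqrtr_ge0.
have hEF : qE delta d + qF delta d = 2 * qD d by rewrite /qE /qF; ring.
rewrite -/r -/b -/F in hr r0 hEF *; move: hE hr hEF; set E := qE _ _ => hE hr hEF.
have F0 : 0 < F by lra.
have br : 0 <= b + r /\ b - r <= 0.
  have : `|b| <= r.
    rewrite -(ler_pXn2r (n := 2)) ?nnegrE ?normr_ge0 // real_normK ?num_real //.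
    by rewrite hr; nra.
  by rewrite ler_norml => /andP[]; split; lra.
case: br => br1 br2.
have key s : E * s ^+ 2 + F <= 2 * b * s <->
    (F - (b + r) * s) * (F - (b - r) * s) <= 0.
  have -> : (F - (b + r) * s) * (F - (b - r) * s) =
     F ^+ 2 - 2 * F * b * s + (b ^+ 2 - r ^+ 2) * s ^+ 2 by ring.
  rewrite hr -(ler_pM2l F0).
  by split=> h; lra.
have key2 s : E * s ^+ 2 + F <= 2 * b * s <-> F <= (b + r) * s \/ F <= (b - r) * s.
  rewrite key; case: (lerP 0 s) => hs.
  - have p : 0 < F - (b - r) * s by nra.
    rewrite pmulr_lle0 //; split=> [h|[h|h]]; [left|..]; lra.
  - have p : 0 < F - (b + r) * s by nra.
    rewrite pmulr_rle0 //; split=> [h|[h|h]]; [right|..]; lra.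
(* Both pieces cannot meet [[-1, 1]]: the product of the two inequalities gives F^2 <= -E F, that is
   E + F <= 0. Hence the arc is one interval and touches an end of the range. *)
have excl : F <= b + r -> F <= r - b -> False.
  move=> k1 k2; have : F * F <= (b + r) * (r - b) by apply: ler_pM; lra.
  have -> : (b + r) * (r - b) = - (E * F) by lra.
  by nra.
case: (ltP (b + r) F) => /= c1; last first.
  case=> -> -> ->; have p : 0 < b + r by lra.
  split; last first.
    split=> //; last by rewrite ler_pdivrMr // mul1r.
    by apply: (@le_trans _ _ 0); [lra|apply: divr_ge0; lra].
  move=> s /andP[s1 s2]; rewrite key2 s2 andbT ler_pdivrMr // [s * _]mulrC.
  split=> [[h|h]|[_ h]]; [by split| |by left].
  by exfalso; apply: excl c1 _; nra.
case: (ltP (r - b) F) => /= c2.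
  move=> /negbTE ->; split=> // s /andP[s1 s2]; rewrite key2.
  by split=> [[h|h]|[]] //; exfalso; nra.
case=> -> -> ->; have p : b - r < 0 by lra.
split; last first.
  split=> //; last first.
    by apply: (@le_trans _ _ 0); [rewrite nmulr_lle0 ?invr_lt0 //; lra|lra].
  by rewrite ler_ndivlMr //; lra.
move=> s /andP[s1 s2]; rewrite key2 s1 /= ler_ndivlMr // [s * _]mulrC.
split=> [[h|h]|[_ h]]; [|by split|by right].
by exfalso; nra.
Qed.

Lemma seq_min (T : eqType) (f : T -> R) (x : T) (l : seq T) :
  x \in l -> exists2 y, y \in l & forall z, z \in l -> f y <= f z.
Proof.
elim: l x => // a [|b l] IH x _.
  by exists a; rewrite ?mem_head // => z; rewrite inE => /eqP ->.
have [y yl hy] := IH b (mem_head _ _).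
case: (lerP (f a) (f y)) => h.
- exists a; rewrite ?mem_head // => z; rewrite inE => /orP[/eqP -> //|/hy].
  exact: le_trans.
- exists y; first by rewrite inE yl orbT.
  by move=> z; rewrite inE => /orP[/eqP ->|/hy //]; exact: ltW.
Qed.

(* A translation common to some disks is moved to the right until it leaves
   one of them: it leaves through the right half of a circle. *)
Lemma right_half delta t (l : seq (pt R)) c0 : 0 < delta -> c0 \in l ->
  (forall c, c \in l -> in_disk delta c t) ->
  exists c s, [/\ c \in l, -1 <= s <= 1 &
    forall c', c' \in l -> in_disk delta c' (circ delta c s)].
Proof.
(* Half the width of the disk around c at the height of t. *)
move=> d0 hc0 ht; pose w (c : pt R) := Num.sqrt (delta ^+ 2 - (c.2 - t.2) ^+ 2).
have w0 c : 0 <= w c by exact: sqrtr_ge0.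
have hw c : c \in l -> w c ^+ 2 = delta ^+ 2 - (c.2 - t.2) ^+ 2.
  move=> /ht; rewrite /in_disk /w => h; rewrite sqr_sqrtr //.
  by have := sqr_ge0 (c.1 - t.1); lra.
have hcw c : c \in l -> `|c.1 - t.1| <= w c.
  move=> hc; rewrite -(ler_pXn2r (n := 2)) ?nnegrE ?normr_ge0 //.
  by rewrite real_normK ?num_real // hw //; have := ht _ hc; rewrite /in_disk; lra.
(* The function is the distance t can move to the right within the disk of c; its minimum names the
   disk that is left first. *)
have [c hc hmin] := seq_min (fun c : pt R => c.1 - t.1 + w c) hc0.
pose e := c.1 - t.1 + w c.
have e0 : 0 <= e by have := hcw _ hc; rewrite ler_norml => /andP[]; rewrite /e; lra.
pose X := w c; pose Y := t.2 - c.2.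
have hXY : X ^+ 2 + Y ^+ 2 = delta ^+ 2 by rewrite /X hw // /Y; ring.
have X0 : 0 <= X := w0 c.
have Xd : 0 < X + delta by lra.
have Xdn : X + delta != 0 by rewrite gt_eqF.
have hY : `|Y| <= delta.
  rewrite -(ler_pXn2r (n := 2)) ?nnegrE ?normr_ge0 ?(ltW d0) //.
  by rewrite real_normK ?num_real //; have := sqr_ge0 X; lra.
(* The tangent of half the angle at which the moved point is seen from c. *)
pose s := Y / (X + delta).
have hs : s * (X + delta) = Y by rewrite /s mulfVK.
have s1 : (1 + s ^+ 2) * (X + delta) = 2 * delta.
  apply: (mulIf Xdn); rewrite -mulrA -expr2 mulrDl mul1r -exprMn hs.
  have -> : Y ^+ 2 = delta ^+ 2 - X ^+ 2 by lra.
  ring.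
have s2 : (1 - s ^+ 2) * (X + delta) = 2 * X.
  apply: (mulIf Xdn); rewrite -mulrA -expr2 mulrBl mul1r -exprMn hs.
  have -> : Y ^+ 2 = delta ^+ 2 - X ^+ 2 by lra.
  ring.
have sn : 1 + s ^+ 2 != 0 by rewrite gt_eqF //; have := sqr_ge0 s; lra.
have ecirc : circ delta c s = (t.1 + e, t.2).
  rewrite /circ; congr (_, _).
    have -> : delta * (1 - s ^+ 2) / (1 + s ^+ 2) = X.
      apply: (mulIf sn); rewrite mulfVK //; apply: (mulIf Xdn).
      transitivity (delta * ((1 - s ^+ 2) * (X + delta))); first by ring.
      transitivity (X * ((1 + s ^+ 2) * (X + delta))); last by ring.
      by rewrite s1 s2; ring.
    by rewrite /e /X; ring.
  have -> : delta * (2 * s) / (1 + s ^+ 2) = Y.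
    apply: (mulIf sn); rewrite mulfVK //; apply: (mulIf Xdn).
    transitivity (Y * ((1 + s ^+ 2) * (X + delta))); last by ring.
    by rewrite s1 -hs; ring.
  by rewrite /Y; ring.
exists c, s; split=> //.
  move: hY; rewrite ler_norml => /andP[y1 y2].
  by rewrite /s ler_pdivlMr // ler_pdivrMr //; apply/andP; split; lra.
move=> c' hc'; rewrite ecirc /in_disk /=.
have /andP[k1 k2] : - w c' <= t.1 + e - c'.1 <= w c'.
  have := hcw _ hc'; rewrite ler_norml => /andP[h1 h2].
  by have := hmin _ hc'; rewrite -/e => h3; apply/andP; split; lra.
have : (c'.1 - (t.1 + e)) ^+ 2 <= w c' ^+ 2 by rewrite !expr2; nra.
by rewrite hw //; lra.
Qed.

End Arcs.

(** * Composing relations in linear time *)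

Notation "c1 ;; c2" := (Seq c1 c2) (at level 92, right associativity).

Notation vout := 0%N. Notation vm := 1%N. Notation vn := 2%N. Notation vB := 3%N.
Notation vM := 4%N. Notation vN := 5%N. Notation vNL := 6%N. Notation vL := 7%N.
Notation vW := 8%N. Notation vs := 9%N. Notation vw := 10%N. Notation vh := 11%N.
Notation ve := 12%N. Notation vp := 13%N. Notation vi := 14%N. Notation vt := 15%N.
Notation vc := 16%N. Notation vl := 17%N. Notation vj := 18%N. Notation vf := 19%N.
Notation vg := 20%N. Notation vph := 21%N. Notation vo := 22%N. Notation va := 23%N.
Notation vk := 24%N. Notation vq := 25%N.
(* Integer arrays: row and column hulls of the nodes and of two scratch
   relations (from 4 and from 8 on), tables of the levels and of the tree. *)
Notation aLO := 0%N. Notation aHI := 1%N. Notation aLP := 2%N. Notation aHP := 3%N.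
Notation aNX := 12%N. Notation aPV := 13%N.
Notation aPN := 14%N. Notation aPA := 15%N. Notation aOR := 16%N. Notation aOS := 17%N.
Notation aDR := 18%N. Notation aDC := 19%N. Notation aRS := 20%N. Notation aLEV := 21%N.
Notation aROW := 22%N. Notation aCOL := 23%N. Notation aPAR := 24%N.
Notation aTYP := 25%N. Notation aEV := 26%N.
(* Real arrays: centres of the disks, next event of a leaf, end of its arc. *)
Notation aCX := 0%N. Notation aCY := 1%N. Notation aKEY := 2%N. Notation aBE := 3%N.

Definition sto4 b e e0 e1 e2 e3 : com :=
  StoN b e e0;; StoN b.+1 e e1;; StoN b.+2 e e2;; StoN b.+3 e e3.

Definition ident b : com :=
  sto4 b (NV vi) (NV vi) (NAdd (NV vi) (NC 1)) (NV vi) (NAdd (NV vi) (NC 1)).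

(* Into the scratch relation at [b]: the relation stored from [vk] on, shifted
   by [vo] and extended with the identity to [vp] ports. *)
Definition fill b : com :=
  For vi (NV vp)
   (If (BN (NV vi) (NV vo)) (ident b)
     (If (BN (NV vi) (NAdd (NV vo) (NV va)))
        (SetN vj (NAdd (NV vk) (NSub (NV vi) (NV vo)));;
         sto4 b (NV vi) (NAdd (NA aLO (NV vj)) (NV vo)) (NAdd (NA aHI (NV vj)) (NV vo))
           (NAdd (NA aLP (NV vj)) (NV vo)) (NAdd (NA aHP (NV vj)) (NV vo)))
        (ident b))).

(* Ports of the interface that are reached from the first scratch relation and
   lead somewhere through the second: the next one, and one plus the last one. *)
Definition scan_nx : com :=
  StoN aNX (NV vp) (NV vp);;
  For vi (NV vp)
   (SetN vf (NSub (NV vp) (NAdd (NV vi) (NC 1)));;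
    StoN aNX (NV vf) (NA aNX (NAdd (NV vf) (NC 1)));;
    If (BN (NA 8 (NV vf)) (NA 9 (NV vf)))
      (If (BN (NA 6 (NV vf)) (NA 7 (NV vf))) (StoN aNX (NV vf) (NV vf)) Skip) Skip).

Definition scan_pv : com :=
  StoN aPV (NC 0) (NC 0);;
  For vi (NV vp)
   (StoN aPV (NAdd (NV vi) (NC 1)) (NA aPV (NV vi));;
    If (BN (NA 8 (NV vi)) (NA 9 (NV vi)))
      (If (BN (NA 6 (NV vi)) (NA 7 (NV vi)))
        (StoN aPV (NAdd (NV vi) (NC 1)) (NAdd (NV vi) (NC 1))) Skip) Skip).

(* Hulls [dlo, dhi) of the composition, from the hulls [xlo, xhi) and [ylo, yhi)
   of the two relations. *)
Definition half_code xlo xhi ylo yhi dlo dhi : com :=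
  SetN vf (NA aNX (NA xlo (NV vi)));; SetN vg (NA aPV (NA xhi (NV vi)));;
  If (BN (NV vf) (NV vg))
   (StoN dlo (NAdd (NV vk) (NV vi)) (NA ylo (NV vf));;
    StoN dhi (NAdd (NV vk) (NV vi)) (NA yhi (NSub (NV vg) (NC 1))))
   (StoN dlo (NAdd (NV vk) (NV vi)) (NC 0);;
    StoN dhi (NAdd (NV vk) (NV vi)) (NC 0)).

Definition compose : com :=
  scan_nx;; scan_pv;;
  SetN vk (NMul (NV vh) (NV vW));;
  For vi (NV vp) (half_code 4 5 8 9 0 1;; half_code 10 11 6 7 2 3).

Definition pleft_code : com :=
  For vi (NV vp) (If (BN (NV vi) (NV vM)) (ident 4)
    (sto4 4 (NV vi) (NC 0) (NC 0) (NC 0) (NC 0))).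

Definition pright_code : com :=
  For vi (NV vp) (If (BN (NV vi) (NV vM))
    (sto4 8 (NV vi) (NC 0) (NC 0) (NAdd (NV vi) (NV vM))
       (NAdd (NAdd (NV vi) (NV vM)) (NC 1)))
    (sto4 8 (NV vi) (NSub (NV vi) (NV vM))
       (NAdd (NSub (NV vi) (NV vM)) (NC 1)) (NC 0) (NC 0))).

Definition restrict : com :=
  pleft_code;; SetN vo (NC 0);; SetN va (NV vp);; SetN vk (NMul (NV vh) (NV vW));;
  fill 8;; compose;; fill 4;; pright_code;; compose.

Ltac rwn H s' := repeat match goal with
  | |- context [nv s' ?x] => rewrite (H x isT) /= ?fupdE /=
  | h : context [nv s' ?x] |- _ => rewrite (H x isT) /= ?fupdE /= in h end.
Ltac rwa H s' := repeat match goal with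
  | |- context [na s' ?x] => rewrite (H x isT) /= ?fupdE /=
  | h : context [na s' ?x] |- _ => rewrite (H x isT) /= ?fupdE /= in h end.

(* One step of symbolic execution; the values assigned are kept as equations. *)
Ltac ok1 := rewrite /= ?fupdE /= ?fupdE /=; repeat (match goal with |- _ /\ _ => split | |- and3 _ _ _ => split end); try by [].
Ltac val1 h := rewrite /= ?fupdE /= ?fupdE /= in h.
Ltac step :=
  lazymatch goal with
  | |- tri (Seq (Seq _ _) _) _ _ _ => apply: tri_assoc; step
  | |- tri (Seq Skip _) _ _ _ => apply: tri_skip_seq; step
  | |- tri (Seq (SetN _ _) _) _ _ _ => apply: tri_setn; [ok1|
      let v := fresh "v" in let e := fresh "ev" in move=> v e; val1 e]
  | |- tri (Seq (SetR _ _) _) _ _ _ => apply: tri_setr; [ok1|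
      let v := fresh "x" in let e := fresh "ex" in move=> v e; val1 e]
  | |- tri (Seq (StoN _ _ _) _) _ _ _ => apply: tri_ston; [ok1|ok1|
      let k := fresh "k" in let ek := fresh "ek" in
      let v := fresh "v" in let e := fresh "ev" in
      move=> k v ek e; val1 ek; val1 e]
  | |- tri (Seq (StoR _ _ _) _) _ _ _ => apply: tri_stor; [ok1|ok1|
      let k := fresh "k" in let ek := fresh "ek" in
      let v := fresh "x" in let e := fresh "ex" in
      move=> k v ek e; val1 ek; val1 e]
  | |- tri (Seq (If _ _ _) _) _ _ _ => apply: tri_if_seq; [ok1|
      let h := fresh "hc" in move=> h; val1 h|
      let h := fresh "hc" in move=> h; val1 h]
  | |- tri (Seq _ _) _ _ _ => fail "no step"
  | |- tri Skip _ _ _ => apply: tri_skip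
  | |- tri _ _ _ _ => apply: tri_end; step
  end.
Ltac steps := repeat step.

(* Splits an invariant on all indices below [i.+1] at [i]. *)
Ltac snext hI :=
  let j := fresh "j" in let hj := fresh "hj" in
  move=> j; rewrite ltnS leq_eqVlt => /orP[/eqP ->|hj];
  rewrite /= ?fupdE /= ?fupdE ?eqxx ?(ltn_eqF hj); [|exact: hI].

(** * Correctness and linear cost of composition and restriction *)

Section Pull.
Variable R : realType.
Implicit Types (s : st R).

Definition nrep N s b x X :=
  rep N (fun i => na s b (x + i)%N) (fun i => na s b.+1 (x + i)%N)
    (fun i => na s b.+2 (x + i)%N) (fun i => na s b.+3 (x + i)%N) X.

Lemma fill_ok b s : ((b == 4) || (b == 8))%N ->
  tri (fill b) s (1 + nv s vp * 8) (fun s' => forall X, (nv s vo + nv s va <= nv s vp)%N ->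
    nrep (nv s va) s 0 (nv s vk) X -> nrep (nv s vp) s' b 0 (ext (nv s vo) (nv s va) X)).
Proof.
move=> hb.
pose I i s' := forall k, (k < i)%N ->
  (na s' b k, na s' b.+1 k) =
    (if (nv s vo <= k < nv s vo + nv s va)%N
     then (na s 0 (nv s vk + (k - nv s vo)) + nv s vo,
           na s 1 (nv s vk + (k - nv s vo)) + nv s vo) else (k, k.+1))%N /\
  (na s' b.+2 k, na s' b.+3 k) =
    (if (nv s vo <= k < nv s vo + nv s va)%N
     then (na s 2 (nv s vk + (k - nv s vo)) + nv s vo,
           na s 3 (nv s vk + (k - nv s vo)) + nv s vo) else (k, k.+1))%N.
apply: (tri_for_cst (Tb := 7) (I := I)) => //.
  - move=> i s' hi hI [fn _ fa _ _].
    case/orP: hb => /eqP hb; subst b.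
    + rewrite /fill /ident /sto4; steps; rwn fn s'; rwa fa s'; subst.
      * by snext hI; rewrite (_ : (_ <= i < _)%N = false) ?addn1 //; lia.
      * lia.
      * by snext hI; rewrite (_ : (_ <= i < _)%N = true) //; lia.
      * by snext hI; rewrite (_ : (_ <= i < _)%N = false) ?addn1 //; lia.
    + rewrite /fill /ident /sto4; steps; rwn fn s'; rwa fa s'; subst.
      * by snext hI; rewrite (_ : (_ <= i < _)%N = false) ?addn1 //; lia.
      * lia.
      * by snext hI; rewrite (_ : (_ <= i < _)%N = true) //; lia.
      * by snext hI; rewrite (_ : (_ <= i < _)%N = false) ?addn1 //; lia.
  - move=> s' _ hI X hN hX; apply: (rep_ext hN hX).
      by move=> i /hI []; rewrite /= ?fupdE.
    by move=> i /hI []; rewrite /= ?fupdE.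
Qed.

Definition okf s b := (na s 8 b < na s 9 b)%N && (na s 6 b < na s 7 b)%N.

Lemma scan_nx_ok s : tri scan_nx s (2 + nv s vp * 6)
  (fun s' => nx_spec (nv s vp) (okf s) (na s' aNX)).
Proof.
rewrite /scan_nx; step.
pose N := nv s vp.
pose I i s' := forall f, (N - i <= f <= N)%N ->
  [/\ (f <= na s' aNX f <= N)%N, forall g, (f <= g < na s' aNX f)%N -> ~~ okf s g &
      (na s' aNX f < N)%N -> okf s (na s' aNX f)].
apply: (tri_for_cst (Tb := 5) (I := I)) => //.
- move=> f; rewrite subn0 /= !fupdE /= fupdE ek ev -/N => /andP[h1 h2].
  have -> : f = N by lia.
  by rewrite eqxx; split; [rewrite leqnn|move=> g; lia|rewrite ltnn].
- move=> i s'; rewrite /= => hi hI [fn _ fa _ _].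
  have hN : nv s' 13 = N by rwn fn s'.
  have h68 A : (A \in [:: 6; 7; 8; 9])%N -> na s' A = na s A.
    by rewrite !inE => /or4P[] /eqP ->; rwa fa s'.
  have hstep x : (na s' 12 (N - (i + 1) + 1) <= N)%N ->
      x = (if okf s (N - (i + 1))%N then N - (i + 1) else na s' 12 (N - (i + 1) + 1))%N ->
      forall s2, (forall f, na s2 12 f = if f == (N - (i + 1))%N then x else na s' 12 f) ->
      I i.+1 s2.
    move=> _ -> s2 h2 f hf; rewrite h2; case: eqP => [->|ne]; last by apply: hI; lia.
    case: ifP => ho; first by split=> //; [rewrite leqnn; lia|move=> g; lia].
    have [p1 p2 p3] := hI (N - (i + 1) + 1)%N ltac:(lia).
    split=> //; first by lia.
    move=> g hg; case: (ltnP (N - (i + 1)) g) => hlt; first by apply: p2; lia.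
    have -> : g = (N - (i + 1))%N by lia.
    by rewrite ho.
  have hle : (na s' 12 (N - (i + 1) + 1) <= N)%N.
    by have [/andP[_ h] _ _] := hI (N - (i + 1) + 1)%N ltac:(lia).
  apply: tri_setn; first by ok1; rewrite hN; lia.
  move=> v' ev'; val1 ev'; rewrite hN in ev'.
  have hok : okf s v' = (na s' 8 v' < na s' 9 v')%N && (na s' 6 v' < na s' 7 v')%N.
    by rewrite /okf !h68.
  rewrite -ev' in hstep.
  steps; subst.
  + apply: (hstep _ hle (erefl _)) => f.
    by rewrite hok hc hc0 ?addn1 /= ?fupdE /= ?fupdE /= ?fupdE; do ?case: eqP.
  + apply: (hstep _ hle (erefl _)) => f.
    by rewrite hok hc (negbTE hc0) ?addn1 /= ?fupdE /= ?fupdE /= ?fupdE; do ?case: eqP.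
  + apply: (hstep _ hle (erefl _)) => f.
    by rewrite hok (negbTE hc) ?addn1 /= ?fupdE /= ?fupdE /= ?fupdE; do ?case: eqP.
- by move=> s' _ /= hI f hf; apply: hI; rewrite /N; lia.
Qed.

Lemma scan_pv_ok s : tri scan_pv s (2 + nv s vp * 5)
  (fun s' => pv_spec (nv s vp) (okf s) (na s' aPV)).
Proof.
rewrite /scan_pv; step.
pose N := nv s vp.
pose I i s' := forall f, (f <= i)%N ->
  [/\ (na s' aPV f <= f)%N, forall g, (na s' aPV f <= g < f)%N -> ~~ okf s g &
      (0 < na s' aPV f)%N -> okf s (na s' aPV f).-1].
apply: (tri_for_cst (Tb := 4) (I := I)) => //.
- move=> f; rewrite leqn0 => /eqP ->; rewrite /= !fupdE /= fupdE ek ev.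
  by rewrite eqxx; split=> // g; lia.
- move=> i s'; rewrite /= => hi hI [fn _ fa _ _].
  have h68 A : (A \in [:: 6; 7; 8; 9])%N -> na s' A = na s A.
    by rewrite !inE => /or4P[] /eqP ->; rwa fa s'.
  have hok : okf s i = (na s' 8 i < na s' 9 i)%N && (na s' 6 i < na s' 7 i)%N.
    by rewrite /okf !h68.
  have hstep s2 : (forall f, na s2 aPV f = if f == i.+1 then
      (if okf s i then i.+1 else na s' aPV i) else na s' aPV f) -> I i.+1 s2.
    move=> h2 f hf; rewrite h2; case: eqP => [->|ne]; last by apply: hI; lia.
    case: ifP => ho; first by split=> //; move=> g; lia.
    have [p1 p2 p3] := hI i (leqnn i).
    split=> //; first by lia.
    move=> g hg; case: (ltnP g i) => hlt; first by apply: p2; lia.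
    have -> : g = i by lia.
    by rewrite ho.
  steps; subst.
  + apply: hstep => f.
    by rewrite hok hc hc0 ?addn1 /= ?fupdE /= ?fupdE /= ?fupdE; do ?case: eqP.
  + apply: hstep => f.
    by rewrite hok hc (negbTE hc0) ?addn1 /= ?fupdE /= ?fupdE /= ?fupdE; do ?case: eqP.
  + apply: hstep => f.
    by rewrite hok (negbTE hc) ?addn1 /= ?fupdE /= ?fupdE /= ?fupdE; do ?case: eqP.
Qed.

Definition only_at x n s s' := forall A j, (A < 4)%N -> ~~ (x <= j < x + n)%N ->
  na s' A j = na s A j.

Lemma half_code_ok xlo xhi ylo yhi dlo dhi s : dlo != dhi -> yhi != dlo ->
  let i := nv s vi in
  let f := na s aNX (na s xlo i) in let g := na s aPV (na s xhi i) in
  let F := if (f < g)%N then (na s ylo f, na s yhi g.-1) else (0, 0)%N in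
  tri (half_code xlo xhi ylo yhi dlo dhi) s 5 (fun s' =>
    (forall j, na s' dlo j = if j == (nv s vk + i)%N then F.1 else na s dlo j) /\
    (forall j, na s' dhi j = if j == (nv s vk + i)%N then F.2 else na s dhi j)).
Proof.
move=> h1 h2 i f g F; rewrite /half_code; steps.
- by lia.
- rewrite -/i -/f in ev; rewrite -/i -/g in ev0; subst; rewrite /= !fupdE.
  rewrite (negbTE h1) !eqxx eq_sym (negbTE h1) (negbTE h2) /F hc /=.
  by split=> j; rewrite fupdE // subn1.
- rewrite -/i -/f in ev; rewrite -/i -/g in ev0; subst; rewrite /= !fupdE.
  rewrite (negbTE h1) !eqxx eq_sym (negbTE h1) /F (negbTE hc) /=.
  by split=> j; rewrite fupdE.
Qed.

Lemma compose_ok s :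
  tri compose s (6 + nv s vp * 22) (fun s' =>
    let x := (nv s vh * nv s vW)%N in
    [/\ nv s' vk = x, only_at x (nv s vp) s s' &
    forall X Y, nrep (nv s vp) s 4 0 X -> nrep (nv s vp) s 8 0 Y ->
      [/\ nrep (nv s vp) s' 0 x (rcomp (nv s vp) X Y),
          tidy (nv s vp) (fun i => na s' 0 (x + i)%N) (fun i => na s' 1 (x + i)%N) &
          tidy (nv s vp) (fun i => na s' 2 (x + i)%N) (fun i => na s' 3 (x + i)%N)]]).
Proof.
pose N := nv s vp; pose x := (nv s vh * nv s vW)%N.
rewrite /compose.
apply: (tri_seq (T2 := 4 + nv s vp * 16) (scan_nx_ok s)); last by lia.
move=> s1 [fn1 _ fa1 _ _] hnx.
have eN : nv s1 vp = N by rewrite fn1.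
apply: (tri_seq (T2 := 2 + nv s vp * 11) (scan_pv_ok s1)); last by rewrite eN -/N; lia.
move=> s2 [fn2 _ fa2 _ _] hpv; rewrite eN in hpv.
have e2 A : A \notin [:: aNX; aPV] -> na s2 A = na s A.
  by rewrite !inE negb_or => /andP[k1 k2]; rewrite fa2 ?fa1 //= !inE ?(negbTE k1) ?(negbTE k2).
have eok b : okf s1 b = okf s b by rewrite /okf !fa1.
step; rewrite fn2 ?fn1 // [nv s2 vW]fn2 ?fn1 // -/x in ev.
have hnx2 : nx_spec N (okf s) (na s2 aNX) by rewrite fa2.
have hpv2 : pv_spec N (okf s) (na s2 aPV).
  by move=> f hf; have [p1 p2 p3] := hpv f hf; split=> // [g /p2|/p3]; rewrite eok.
pose F (a b c d : nat) i := if (na s2 aNX (na s a i) < na s2 aPV (na s b i))%N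
  then (na s c (na s2 aNX (na s a i)), na s d (na s2 aPV (na s b i)).-1)
  else (0, 0)%N.
pose I i s' := only_at x N s s' /\ forall j, (j < i)%N ->
  (na s' 0 (x + j), na s' 1 (x + j))%N = F 4 5 8 9 j /\
  (na s' 2 (x + j), na s' 3 (x + j))%N = F 10 11 6 7 j.
apply: (tri_for_cst (Tb := 10) (I := I)) => //.
- by split=> // A j hA hj; rewrite /= e2 // !inE; lia.
- move=> i s'; rewrite /= fupdE /= fn2 // eN => hi [hI1 hI2] [fn _ fa _ _].
  have ea A : (A < 12)%N && (3 < A)%N -> na s' A = na s A.
    by move=> hA; rewrite fa /= ?e2 // !inE; lia.
  have e12 : na s' aNX = na s2 aNX by rewrite fa.
  have e13 : na s' aPV = na s2 aPV by rewrite fa.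
  have ek' : nv s' vk = x by rewrite fn //= fupd_eq.
  apply: (tri_seq (T2 := 5) (half_code_ok 4 5 8 (yhi := 9%N) (dlo := 0%N) (dhi := 1%N) _ isT isT)) => //.
  move=> s3 [fn3 _ fa3 _ _] [c1 c2].
  rewrite /= !fupdE /= ek' e12 e13 (ea 4%N isT) (ea 5%N isT) (ea 8%N isT) (ea 9%N isT) in c1; rewrite /= !fupdE /= ek' e12 e13 (ea 4%N isT) (ea 5%N isT) (ea 8%N isT) (ea 9%N isT) in c2.
  have {}c1 j : na s3 0 j = if j == (x + i)%N then (F 4 5 8 9 i).1 else na s' 0 j := c1 j.
  have {}c2 j : na s3 1 j = if j == (x + i)%N then (F 4 5 8 9 i).2 else na s' 1 j := c2 j.
  apply: tri_weak (half_code_ok 10 11 6 (yhi := 7%N) (dlo := 2%N) (dhi := 3%N) _ isT isT) _ _ => //.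
  move=> s4 [_ _ fa4 _ _]; rewrite !fn3 //= !fupdE /= ek' !fa3 //= e12 e13 (ea 10%N isT) (ea 11%N isT) (ea 6%N isT) (ea 7%N isT) => -[c3 c4].
  have {}c3 j : na s4 2 j = if j == (x + i)%N then (F 10 11 6 7 i).1 else na s' 2 j := c3 j.
  have {}c4 j : na s4 3 j = if j == (x + i)%N then (F 10 11 6 7 i).2 else na s' 3 j := c4 j.
  have d0 j : na s4 0 j = if j == (x + i)%N then (F 4 5 8 9 i).1 else na s' 0 j.
    by rewrite fa4.
  have d1 j : na s4 1 j = if j == (x + i)%N then (F 4 5 8 9 i).2 else na s' 1 j.
    by rewrite fa4.
  split.
  + move=> [|[|[|[|A]]]] j // _ hj; rewrite ?d0 ?d1 ?c3 ?c4 ifN ?hI1 //; lia.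
  + move=> j; rewrite ltnS leq_eqVlt => /orP[/eqP ->|hj].
      by rewrite d0 d1 c3 c4 eqxx; case: (F _ _ _ _ i) => ? ?; case: (F _ _ _ _ i).
    rewrite d0 d1 c3 c4 eqn_add2l (ltn_eqF hj); exact: hI2.
- move=> s' [fn _ _ _ _]; rewrite /= fupdE /= fn2 // eN => -[hI1 hI2]; split=> //.
    by rewrite fupdE /= fn //= fupd_eq ev.
  move=> X Y hX hY; apply: (rep_rcomp hX hY hnx2 hpv2) => //.
  + by move=> a /hI2 [].
  + by move=> a /hI2 [].
- rewrite /= fupdE /= fn2 // eN; lia.
Qed.
Lemma pleft_ok s : nv s vp = (nv s vM + nv s vM)%N ->
  tri pleft_code s (1 + nv s vp * 6) (fun s' => nrep (nv s vp) s' 4 0 (pleft (nv s vM))).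
Proof.
move=> hp; pose M := nv s vM.
pose G i := if (i < M)%N then (i, i.+1) else (0, 0)%N.
pose I i s' := forall k, (k < i)%N -> (na s' 4 k, na s' 5 k) = G k /\ (na s' 6 k, na s' 7 k) = G k.
apply: (tri_for_cst (Tb := 5) (I := I)) => //.
- move=> i s'; rewrite /= => hi hI [fn _ fa _ _].
  rewrite /ident /sto4; steps; rwn fn s'; subst.
  + by snext hI; rewrite /G hc addn1.
  + by snext hI; rewrite /G (negbTE hc).
- move=> s' _ hI; rewrite /nrep hp; apply: rep_pleft => i hi.
    by have [] := hI i ltac:(rewrite /= hp; exact: hi); rewrite /= -/M.
  by have [] := hI i ltac:(rewrite /= hp; exact: hi); rewrite /= -/M.
Qed.

Lemma pright_ok s : nv s vp = (nv s vM + nv s vM)%N ->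
  tri pright_code s (1 + nv s vp * 6) (fun s' => nrep (nv s vp) s' 8 0 (pright (nv s vM))).
Proof.
move=> hp; pose M := nv s vM.
pose G i := if (i < M)%N then (0, 0)%N else (i - M, (i - M).+1)%N.
pose G' i := if (i < M)%N then (i + M, (i + M).+1)%N else (0, 0)%N.
pose I i s' := forall k, (k < i)%N -> (na s' 8 k, na s' 9 k) = G k /\ (na s' 10 k, na s' 11 k) = G' k.
apply: (tri_for_cst (Tb := 5) (I := I)) => //.
- move=> i s'; rewrite /= => hi hI [fn _ fa _ _].
  rewrite /ident /sto4; steps; rwn fn s'; subst.
  + by snext hI; rewrite /G /G' hc addn1.
  + lia.
  + lia.
  + by snext hI; rewrite /G /G' (negbTE hc) addn1.
- move=> s' _ hI; rewrite /nrep hp; apply: rep_pright => i hi.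
    by have [] := hI i ltac:(rewrite /= hp; exact: hi); rewrite /= -/M.
  by have [] := hI i ltac:(rewrite /= hp; exact: hi); rewrite /= -/M.
Qed.

Lemma nrep_ext N n s s' b b' x x' X : (forall i, (i < n)%N ->
    [/\ na s' b' (x' + i)%N = na s b (x + i)%N, na s' b'.+1 (x' + i)%N = na s b.+1 (x + i)%N,
        na s' b'.+2 (x' + i)%N = na s b.+2 (x + i)%N &
        na s' b'.+3 (x' + i)%N = na s b.+3 (x + i)%N]) -> n = N ->
  nrep N s b x X -> nrep N s' b' x' X.
Proof. by move=> h <-; apply: rep_ext_fun => a /h. Qed.

Lemma restrict_ok s : nv s vp = (nv s vM + nv s vM)%N ->
  tri restrict s (24 + nv s vp * 72) (fun s' =>
    let x := (nv s vh * nv s vW)%N in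
    only_at x (nv s vp) s s' /\
    forall X, nrep (nv s vp) s 0 x X -> nrep (nv s vM) s' 0 x (restr (nv s vM) X)).
Proof.
move=> hp; pose N := nv s vp; pose x := (nv s vh * nv s vW)%N.
rewrite /restrict.
apply: (tri_seq (T2 := 23 + N * 66) (pleft_ok hp)); last by rewrite /N; lia.
move=> s1 [fn1 _ fa1 _ _] r1; step; step; step.
rewrite !fn1 // in ev0 ev1; subst v v0.
set s2 := setn _ _ _.
have n2 A : na s2 A = na s1 A by [].
have e2 : [/\ nv s2 vo = 0%N, nv s2 va = N, nv s2 vk = x & nv s2 vp = N].
  by rewrite /= !fupdE /= !fn1.
have h2 : (nv s2 vh = nv s vh)  /\ nv s2 vW = nv s vW /\ nv s2 vM = nv s vM.
  by rewrite /= !fupdE /= !fn1.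
clearbody s2; case: e2 h2 => [z2 a2 k2 p2] [hh2 [w2 m2]].
apply: (tri_seq (T2 := 19 + N * 58) (fill_ok (b := 8%N) s2 isT)); last by rewrite p2; lia.
move=> s3 [fn3 _ fa3 _ _] r3.
apply: (tri_seq (T2 := 13 + N * 36) (compose_ok s3)); last by rewrite fn3 // p2; lia.
rewrite !fn3 // hh2 w2 p2 -/x => s4 [fn4 _ fa4 _ _] [k4 o4 r4].
apply: (tri_seq (T2 := 10 + N * 28) (fill_ok (b := 4%N) s4 isT)); last first.
  by rewrite fn4 // fn3 // p2; lia.
rewrite k4 !fn4 // !fn3 // z2 a2 p2 => s5 [fn5 _ fa5 _ _] r5.
have p5 : nv s5 vp = N by rewrite fn5 // fn4 // fn3.
have m5 : nv s5 vM = nv s vM by rewrite fn5 // fn4 // fn3.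
apply: (tri_seq (T2 := 6 + N * 22) (@pright_ok s5 _)); first by rewrite p5 m5.
  rewrite p5 m5 => s6 [fn6 _ fa6 _ _] r6.
  have p6 : nv s6 vp = N by rewrite fn6.
  have x6 : (nv s6 vh * nv s6 vW = x)%N.
    by rewrite !fn6 // !fn5 // !fn4 // !fn3 // hh2 w2.
  apply: tri_weak (compose_ok s6) _ _; first by rewrite p6.
  rewrite p6 x6 => s7 _ [_ o7 r7]; split.
    case=> [|[|[|[|A]]]] j // hA hj;
      by rewrite o7 // fa6 // fa5 // o4 // fa3 // n2 fa1.
  move=> X hX; rewrite -/x in hX *.
  have hX2 : nrep N s2 0 x X.
    by apply: nrep_ext hX => // i hi; rewrite !n2 !fa1.
  rewrite z2 a2 k2 p2 add0n in r3; have {}r3 := r3 X (leqnn _) hX2.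
  have r1' : nrep N s3 4 0 (pleft (nv s vM)).
    by apply: nrep_ext r1 => // i _; rewrite !fa3 ?n2.
  have [r8 t1 t2] := r4 _ _ r1' r3.
  rewrite add0n in r5; have {}r5 := r5 _ (leqnn _) r8.
  have r5' : nrep N s6 4 0 (ext 0 N (rcomp N (pleft (nv s vM)) (ext 0 N X))).
    by apply: nrep_ext r5 => // i _; rewrite !fa6.
  have [r9 t3 t4] := r7 _ _ r5' r6.
  have NM : N = (nv s vM + nv s vM)%N by [].
  (* With offset 0 and all N ports in the window, [fill] adds no identity pairs, so both extensions
     drop out. *)
  have key : nrep N s7 0 x (restr (nv s vM) X).
    apply: (rep_eqv _ r9) => a b ha hb; rewrite /restr -NM.
    split=> -[c [hc xc yc]]; exists c; split=> //.
    + move: xc; case=> [[_ [_]]|[_]]; rewrite ?subn0 ?ha //.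
      case=> d [hd pd]; case=> [[_ [_]]|[_]]; rewrite ?subn0 ?hd // => xd.
      by exists d.
    + left; rewrite !subn0 /= ha hc; split=> //; split=> //.
      case: xc => d [hd pd xd]; exists d; split=> //.
      by left; rewrite !subn0 /= hd hc.
  rewrite /nrep; apply: rep_restr; rewrite -NM //.
by rewrite p5; lia.
Qed.

End Pull.

(** * Updating the tree of blocks *)

Definition pull_rel : com :=
  SetN ve (NA aLEV (NV vh));; SetN vp (NA aPN (NV ve));; SetN va (NA aPA (NV ve));;
  SetN vo (NA aOR (NV ve));; SetN vk (NMul (NMul (NC 2) (NV vh)) (NV vW));;
  fill 4;;
  SetN vo (NA aOS (NV ve));;
  SetN vk (NMul (NAdd (NMul (NC 2) (NV vh)) (NC 1)) (NV vW));;
  fill 8;; compose;;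
  If (BN (NC 0) (NA aRS (NV ve))) restrict Skip.

(* Events are compared by key first, with insertions before removals. *)
Definition pull_key : com :=
  SetN vk (NMul (NC 2) (NV vh));; SetN vj (NAdd (NMul (NC 2) (NV vh)) (NC 1));;
  SetN vf (NV vk);;
  If (BR (RA aKEY (NV vj)) (RA aKEY (NV vk))) (SetN vf (NV vj))
    (If (BR (RA aKEY (NV vk)) (RA aKEY (NV vj))) Skip
      (If (BN (NA aTYP (NV vj)) (NA aTYP (NV vk))) (SetN vf (NV vj)) Skip));;
  StoR aKEY (NV vh) (RA aKEY (NV vf));; StoN aTYP (NV vh) (NA aTYP (NV vf));;
  StoN aEV (NV vh) (NA aEV (NV vf)).

Definition pull : com := pull_rel;; pull_key.

Definition leaf_sto a0 b0 a1 b1 : com :=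
  StoN 0 (NV vk) (NC a0);; StoN 1 (NV vk) (NC b0);;
  StoN 0 (NAdd (NV vk) (NC 1)) (NC a1);; StoN 1 (NAdd (NV vk) (NC 1)) (NC b1);;
  StoN 2 (NV vk) (NC a0);; StoN 3 (NV vk) (NC b0);;
  StoN 2 (NAdd (NV vk) (NC 1)) (NC a1);; StoN 3 (NAdd (NV vk) (NC 1)) (NC b1).

Definition set_leaf : com :=
  SetN vk (NMul (NV vh) (NV vW));;
  If (BN (NC 0) (NA aTYP (NV vh)))
    (If (BN (NA aTYP (NV vh)) (NC 2)) (leaf_sto 0 2 0 2) (leaf_sto 0 0 1 2))
    (leaf_sto 0 0 1 2).

Definition climb : com :=
  For vt (NV vL) (SetN vh (NA aPAR (NV vh));; pull).

Definition build : com :=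
  For vl (NSub (NV vNL) (NC 1))
    (SetN vh (NSub (NV vNL) (NAdd (NV vl) (NC 1)));; pull).

(** * Recomputing one node from its children *)

Section PullNode.
Variable R : realType.
Implicit Types (s : st R).

Definition lvl_ok s e := let N := na s aPN e in let n := na s aPA e in
  [/\ (na s aOR e + n <= N)%N, (na s aOS e + n <= N)%N, (N <= nv s vW)%N &
      (0 < na s aRS e)%N -> N = (nv s vM + nv s vM)%N].

(** Consistency of a node with its children only, for whatever relations the children represent. No
    free cell is mentioned, so changing a leaf can invalidate nothing but its parent. *)
Definition rel_ok s h :=
  let e := na s aLEV h in let N := na s aPN e in let n := na s aPA e in
  forall X Y, nrep n s 0 (2 * h * nv s vW) X -> nrep n s 0 ((2 * h + 1) * nv s vW) Y ->
  let Z := rcomp N (ext (na s aOR e) n X) (ext (na s aOS e) n Y) in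
  if (0 < na s aRS e)%N then nrep (nv s vM) s 0 (h * nv s vW) (restr (nv s vM) Z)
  else nrep N s 0 (h * nv s vW) Z.

Lemma only_at_trans x n s1 s2 s3 : only_at x n s1 s2 -> only_at x n s2 s3 ->
  only_at x n s1 s3.
Proof. by move=> h1 h2 A j hA hj; rewrite h2 // h1. Qed.

Lemma pull_rel_ok s : let h := nv s vh in let e := na s aLEV h in
  (0 < h)%N -> lvl_ok s e ->
  tri pull_rel s (40 + na s aPN e * 110) (fun s' =>
    rel_ok s' h /\ only_at (h * nv s vW) (na s aPN e) s s').
Proof.
move=> h e h0 [l1 l2 l3 l4]; pose N := na s aPN e; pose n := na s aPA e.
pose W := nv s vW.
rewrite /pull_rel.
step; rewrite -/h -/e in ev; step; step; step; step.
subst v; rewrite -/h in ev3; subst v0 v1 v2 v3.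
set s1 := setn _ _ _.
have sc1 : [/\ nv s1 ve = e, nv s1 vp = N, nv s1 va = n, nv s1 vo = na s aOR e &
   [/\ nv s1 vk = (2 * h * W)%N, nv s1 vh = h, nv s1 vW = W & nv s1 vM = nv s vM]].
  by rewrite /= !fupdE /=.
have e1 A : na s1 A = na s A by [].
clearbody s1; case: sc1 => [q1 q2 q3 q4 [q5 q6 q7 q8]].
apply: (tri_seq (T2 := 34 + N * 102) (fill_ok (b := 4%N) s1 isT)); last by rewrite q2 -/N; lia.
rewrite q2 q3 q4 q5 => s2 [fn2 _ fa2 _ _] r2; step; step.
rewrite !fn2 // q1 fa2 // e1 in ev; rewrite !fn2 // q6 q7 in ev0; subst v v0.
set s3 := setn _ _ _.
have sc3 : [/\ nv s3 ve = e, nv s3 vp = N, nv s3 va = n, nv s3 vo = na s aOS e &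
   [/\ nv s3 vk = ((2 * h + 1) * W)%N, nv s3 vh = h, nv s3 vW = W & nv s3 vM = nv s vM]].
  by rewrite /= !fupdE /= !fn2.
have e3 A : na s3 A = na s2 A by [].
clearbody s3; case: sc3 => [u1 u2 u3 u4 [u5 u6 u7 u8]].
apply: (tri_seq (T2 := 31 + N * 94) (fill_ok (b := 8%N) s3 isT)); last by rewrite u2; lia.
rewrite u2 u3 u4 u5 => s4 [fn4 _ fa4 _ _] r4.
apply: (tri_seq (T2 := 25 + N * 72) (compose_ok s4)); last by rewrite fn4 // u2; lia.
rewrite !fn4 // u2 u6 u7 => s5 [fn5 _ fa5 _ _] [_ o5 r5].
have a5 A : (A < 4)%N -> na s4 A = na s A.
  by case: A => [|[|[|[|A]]]] // _; rewrite fa4 // e3 fa2.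
have o5' : only_at (h * W) N s s5 by move=> A j hA hj; rewrite o5 // a5.
(* As h > 0, the region of [h] is disjoint from those of its children, so these represent the same
   relations before and after the update. *)
have away s' : only_at (h * W) N s s' -> forall c, (c = 2 * h \/ c = 2 * h + 1)%N ->
    forall X, nrep n s' 0 (c * W) X -> nrep n s 0 (c * W) X.
  move=> ho c hc X; apply: nrep_ext => // i hi.
  have hi' : (i < W)%N by move: l1 l3; rewrite -/n -/N -/W; lia.
  have hj : ~~ (h * W <= c * W + i < h * W + N)%N by move: l3; rewrite -/N -/W; case: hc => ->; nia.
  by rewrite !ho.
have main X Y : nrep n s 0 (2 * h * W) X -> nrep n s 0 ((2 * h + 1) * W) Y ->
   nrep N s5 0 (h * W) (rcomp N (ext (na s aOR e) n X) (ext (na s aOS e) n Y)).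
  move=> hX hY.
  have hX1 : nrep n s1 0 (2 * h * W) X by apply: nrep_ext hX => // i _; rewrite !e1.
  have hY3 : nrep n s3 0 ((2 * h + 1) * W) Y.
    by apply: nrep_ext hY => // i _; rewrite !e3 !fa2 // !e1.
  have k2 := r2 X l1 hX1; have k4 := r4 Y l2 hY3.
  have k2' : nrep N s4 4 0 (ext (na s aOR e) n X).
    by apply: nrep_ext k2 => // i _; rewrite !fa4 // !e3.
  by have [] := r5 _ _ k2' k4.
have tab A : (13 < A)%N && (A < 27)%N -> na s5 A = na s A.
  move=> hA; rewrite fa5 /= ?fa4 ?e3 ?fa2 ?e1 //= !inE; lia.
have n5 x : x \in [:: ve; vh; vW; vM; vp] -> nv s5 x = nv s3 x.
  by rewrite !inE => /or4P[/eqP ->|/eqP ->|/eqP ->|/orP[/eqP ->|/eqP ->]]; rewrite fn5 // fn4.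
have tabE A : (13 < A)%N && (A < 27)%N -> na s5 A e = na s A e by move=> hA; rewrite tab.
have hb : evb (BN (NC 0) (NA aRS (NV ve))) s5 = (0 < na s aRS e)%N.
  by rewrite /evb /evn n5 // u1 tabE.
have p5 : nv s5 vp = N by rewrite n5 // u2.
have x5 : (nv s5 vh * nv s5 vW = h * W)%N by rewrite !n5 // u6 u7.
have m5 : nv s5 vM = nv s vM by rewrite n5 // u8.
apply: (@tri_weak _ _ _ (24 + N * 72).+1 _ (fun s' =>
  only_at (h * W) N s5 s' /\ (forall Z, nrep N s5 0 (h * W) Z ->
    if (0 < na s aRS e)%N then nrep (nv s vM) s' 0 (h * W) (restr (nv s vM) Z)
    else nrep N s' 0 (h * W) Z))); last first.
- move=> s' [fn _ fa _ _] [d' r']; have oo := only_at_trans o5' d'.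
  split=> //; rewrite /rel_ok.
  have tab' A : (13 < A)%N && (A < 27)%N -> na s' A = na s A.
    move=> hA; rewrite fa ?tab //=; move: hA; rewrite !inE; lia.
  rewrite !tab' // -/e -/N -/n.
  have w' : nv s' vW = W by rewrite fn // n5 // u7.
  have m' : nv s' vM = nv s vM by rewrite fn.
  rewrite w' m' => X Y hX hY; apply: r'; apply: main.
    by apply: (away _ oo) => //; left.
  by apply: (away _ oo) => //; right.
- by lia.
apply: tri_if; rewrite ?hb.
- by [].
- move=> hr; have eM : N = (nv s vM + nv s vM)%N by exact: l4.
  apply: tri_weak (@restrict_ok _ s5 _) _ _; rewrite ?p5 ?m5 //.
  by move=> s' _; rewrite x5 => -[k1 k2]; split=> // Z; rewrite hr; exact: k2.
- by move=> hr; apply: tri_skip; split=> // Z; rewrite (negbTE hr).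
Qed.

Definition key_le s a b := (ra s aKEY a < ra s aKEY b) ||
  ((ra s aKEY a == ra s aKEY b) && (na s aTYP a <= na s aTYP b)%N).

Definition key_ok s h := exists c,
  [/\ (c = 2 * h \/ c = 2 * h + 1)%N, ra s aKEY h = ra s aKEY c,
      na s aTYP h = na s aTYP c, na s aEV h = na s aEV c &
      key_le s c (2 * h) /\ key_le s c (2 * h + 1)].

Definition same_keys (P : nat -> Prop) s s' := forall j, P j ->
  [/\ ra s' aKEY j = ra s aKEY j, na s' aTYP j = na s aTYP j &
      na s' aEV j = na s aEV j].

Lemma pull_key_ok s : (0 < nv s vh)%N ->
  tri pull_key s 12 (fun s' =>
    key_ok s' (nv s vh) /\ same_keys (fun j => j != nv s vh) s s').
Proof.
move=> h0; set h := nv s vh in h0 *.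
have key c s' : (c = 2 * h \/ c = 2 * h + 1)%N ->
    key_le s c (2 * h) -> key_le s c (2 * h + 1) ->
    ra s' aKEY =1 fupd (ra s aKEY) h (ra s aKEY c) ->
    na s' aTYP =1 fupd (na s aTYP) h (na s aTYP c) ->
    na s' aEV =1 fupd (na s aEV) h (na s aEV c) ->
    key_ok s' h /\ same_keys (fun j => j != h) s s'.
  move=> hc k1 k2 e1 e2 e3.
  have n1 j : (j = 2 * h \/ j = 2 * h + 1)%N -> j == h = false by lia.
  split; last by move=> j /negbTE hj; rewrite e1 e2 e3 !fupdE hj.
  exists c; rewrite /key_le !e1 !e2 !e3 !fupdE eqxx !n1 //; by [left|right].
rewrite /pull_key; steps; rewrite -/h in ev ev0; subst.
- apply: (key (2 * h + 1)%N); rewrite ?fupdE //=; first by right.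
  + by rewrite /key_le hc.
  + by rewrite /key_le eqxx leqnn orbT.
- apply: (key (2 * h)%N); rewrite ?fupdE //=; first by left.
  + by rewrite /key_le eqxx leqnn orbT.
  + by rewrite /key_le hc0.
- have e : ra s aKEY (2 * h)%N = ra s aKEY (2 * h + 1)%N.
    by apply/le_anti; rewrite !leNgt hc hc0.
  apply: (key (2 * h + 1)%N); rewrite ?fupdE //=; first by right.
  + by rewrite /key_le e eqxx (ltnW hc1) orbT.
  + by rewrite /key_le eqxx leqnn orbT.
- have e : ra s aKEY (2 * h)%N = ra s aKEY (2 * h + 1)%N.
    by apply/le_anti; rewrite !leNgt hc hc0.
  apply: (key (2 * h)%N); rewrite ?fupdE //=; first by left.
  + by rewrite /key_le eqxx leqnn orbT.
  + by rewrite /key_le e eqxx leqNgt hc1 orbT.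
Qed.

Lemma leaf_sto_ok (F : bool) a0 b0 a1 b1 s x : nv s vk = x ->
  (a0, b0) = (if F then (0, 2) else (0, 0))%N ->
  (a1, b1) = (if F then (0, 2) else (1, 2))%N ->
  tri (leaf_sto a0 b0 a1 b1) s 8 (fun s' =>
    only_at x 2 s s' /\ nrep 2 s' 0 x (cell_rel F)).
Proof.
move=> hk h0 h1; rewrite /leaf_sto; steps; rewrite hk in ek ek0 ek1 ek2 ek3 ek4 ek5 ek6.
set s' := setna _ _ _ _.
have e0 j : na s' 0 j = if j == (x + 1)%N then a1 else if j == x then a0 else na s 0 j.
  by rewrite /s' /= ?fupdE /= ?fupdE /= ?fupdE; subst.
have e1 j : na s' 1 j = if j == (x + 1)%N then b1 else if j == x then b0 else na s 1 j.
  by rewrite /s' /= ?fupdE /= ?fupdE /= ?fupdE; subst.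
have e2 j : na s' 2 j = if j == (x + 1)%N then a1 else if j == x then a0 else na s 2 j.
  by rewrite /s' /= ?fupdE /= ?fupdE /= ?fupdE; subst.
have e3 j : na s' 3 j = if j == (x + 1)%N then b1 else if j == x then b0 else na s 3 j.
  by rewrite /s' /= ?fupdE /= ?fupdE /= ?fupdE; subst.
clearbody s'; split.
  move=> [|[|[|[|A]]]] j // _ hj; rewrite ?e0 ?e1 ?e2 ?e3.
  - do 2 (rewrite ifN; last by lia). by [].
  - do 2 (rewrite ifN; last by lia). by [].
  - do 2 (rewrite ifN; last by lia). by [].
  - do 2 (rewrite ifN; last by lia). by [].
have n1 : (x == x + 1)%N = false by lia.
apply: rep_cell => -[|[|i]] // _.
- by rewrite e0 e1 addn0 n1 eqxx h0; case: F {h0 h1}.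
- by rewrite e0 e1 eqxx h1; case: F {h0 h1}.
- by rewrite e2 e3 addn0 n1 eqxx h0; case: F {h0 h1}.
- by rewrite e2 e3 eqxx h1; case: F {h0 h1}.
Qed.

Lemma set_leaf_ok s : tri set_leaf s 12 (fun s' =>
  only_at (nv s vh * nv s vW) 2 s s' /\
  nrep 2 s' 0 (nv s vh * nv s vW) (cell_rel (na s aTYP (nv s vh) == 1)%N)).
Proof.
rewrite /set_leaf; step.
have hk : nv (setn s vk v) vk = (nv s vh * nv s vW)%N by rewrite /= fupd_eq.
apply: (@tri_weak _ _ _ 11 _ (fun s' => only_at (nv s vh * nv s vW) 2 (setn s vk v) s' /\
  nrep 2 s' 0 (nv s vh * nv s vW) (cell_rel (na s aTYP (nv s vh) == 1)%N))) => //.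
set ty := na s aTYP (nv s vh).
have t0 : evb (BN (NC 0) (NA aTYP (NV vh))) (setn s vk v) = (0 < ty)%N by rewrite /= fupdE.
have t2 : evb (BN (NA aTYP (NV vh)) (NC 2)) (setn s vk v) = (ty < 2)%N by rewrite /= fupdE.
apply: tri_if => //; rewrite ?t0 // => h1.
  apply: tri_if => //; rewrite ?t2 // => h2.
    have -> : (ty == 1)%N by lia.
    by apply: tri_weak (leaf_sto_ok (F := true) hk _ _) _ _.
  have -> : (ty == 1)%N = false by lia.
  by apply: tri_weak (leaf_sto_ok (F := false) hk _ _) _ _.
have -> : (ty == 1)%N = false by lia.
by apply: tri_weak (leaf_sto_ok (F := false) hk _ _) _ _.
Qed.

Lemma pull_ok s : let h := nv s vh in let e := na s aLEV h in
  (0 < h)%N -> lvl_ok s e ->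
  tri pull s (52 + na s aPN e * 110) (fun s' =>
    [/\ rel_ok s' h, key_ok s' h, only_at (h * nv s vW) (na s aPN e) s s' &
        same_keys (fun j => j != h) s s']).
Proof.
move=> h e h0 hl; apply: (tri_seq (T2 := 12) (pull_rel_ok h0 hl)); last by rewrite -/h -/e; lia.
move=> s1 [fn1 _ fa1 fra1 _] [r1 o1].
have hh : nv s1 vh = h by rewrite fn1.
have p1 : (0 < nv s1 vh)%N by rewrite hh.
apply: tri_weak (pull_key_ok p1) _ _ => //.
move=> s2 [fn2 _ fa2 _ _]; rewrite hh => -[k2 q2].
have ea A : (A < 25)%N -> na s2 A = na s1 A.
  by move=> hA; rewrite fa2 //= !inE; lia.
split=> //.
- by rewrite /rel_ok /nrep !ea // !fn2.
- by move=> A j hA hj; rewrite ea ?o1 //; lia.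
- by move=> j hj; have [-> -> ->] := q2 j hj; rewrite fra1 // !fa1.
Qed.

End PullNode.

(* Heights and widths of the blocks, from the leaves up: cells are stacked and
   juxtaposed alternately up to M x M squares, which are then juxtaposed. *)
Definition next_dim M (d : nat * nat) :=
  if (d.2 < d.1)%N then (d.1, d.2 + d.2)%N
  else if (d.1 < M)%N then (d.1 + d.1, d.2)%N else (d.1, d.2 + d.2)%N.

Definition dims M e := iter e (next_dim M) (1, 1)%N.

Arguments dims : simpl never.

(** The step from level e to e + 1: ports of a child, ports of the node, windows of the first and
    the second child, row and column shift of the second child, and a flag set when the node
    completes the M x M square and must be restricted. *)
Definition level_row M e :=
  let: (s, w) := dims M e in
  if (w < s)%N then (s + w, s + w + w, (0, w), (0, w), nat_of_bool (w + w == M))%N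
  else if (s < M)%N then (s + w, s + s + w, (s, 0), (s, 0), 0)%N
  else (M, M, (0, 0), (0, w), 0)%N.

Definition ports M e := (level_row M e).1.1.1.2.

Lemma dims_sq a b : (b <= a)%N -> dims (2 ^ a) (b + b) = (2 ^ b, 2 ^ b)%N.
Proof.
elim: b => // b IH hb; rewrite addSn addnS /dims !iterS -/(dims _ _) IH; last by lia.
have h : (2 ^ b < 2 ^ a)%N by rewrite ltn_exp2l.
rewrite {2}/next_dim /= ltnn h /next_dim /= ifT ?addnn -?mul2n -?expnS //.
by rewrite expnS; have := expn_gt0 2 b; lia.
Qed.

Lemma dims_half a b : (b < a)%N -> dims (2 ^ a) (b + b).+1 = (2 ^ b.+1, 2 ^ b)%N.
Proof.
move=> hb; rewrite /dims iterS -/(dims _ _) dims_sq; last by lia.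
have h : (2 ^ b < 2 ^ a)%N by rewrite ltn_exp2l.
by rewrite /next_dim /= ltnn h addnn -mul2n -expnS.
Qed.

Lemma dims_wide a j : dims (2 ^ a) (a + a + j) = (2 ^ a, 2 ^ (a + j))%N.
Proof.
elim: j => [|j IH]; first by rewrite !addn0 dims_sq.
rewrite addnS /dims iterS -/(dims _ _) IH /next_dim /=.
have h : (2 ^ a <= 2 ^ (a + j))%N by rewrite leq_exp2l // leq_addr.
by rewrite ltnNge h /= ltnn addnn -mul2n -expnS addnS.
Qed.

Variant dims_spec a e : nat * nat -> Type :=
| DimsSq b of (b < a)%N & e = (b + b)%N : dims_spec a e (2 ^ b, 2 ^ b)%N
| DimsHalf b of (b < a)%N & e = (b + b).+1 : dims_spec a e (2 ^ b.+1, 2 ^ b)%N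
| DimsWide j of e = (a + a + j)%N : dims_spec a e (2 ^ a, 2 ^ (a + j))%N.

Lemma dimsP a e : dims_spec a e (dims (2 ^ a) e).
Proof.
case: (leqP (a + a) e) => h.
  have e1 : e = (a + a + (e - (a + a)))%N by lia.
  by rewrite {2}e1 dims_wide; apply: DimsWide e1.
have e1 := odd_double_half e; rewrite -addnn in e1.
case: (odd e) e1 => /= e1.
- have hb : (e./2 < a)%N by lia.
  rewrite -{2}e1 add1n dims_half //; apply: DimsHalf => //; lia.
- have hb : (e./2 < a)%N by lia.
  rewrite -{2}e1 add0n dims_sq; last by lia.
  by apply: DimsSq => //; lia.
Qed.

Lemma exp2_gt0 b : (0 < 2 ^ b)%N. Proof. by rewrite expn_gt0. Qed.

Lemma level_rowP a e : let M := (2 ^ a)%N in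
  let: (n, N, (r, s), _, q) := level_row M e in
  [/\ (r + n <= N)%N, (s + n <= N)%N, (N <= M + M)%N & (0 < q)%N -> N = (M + M)%N].
Proof.
move=> M; rewrite /level_row -/M; case: dimsP => [b hb _|b hb _|j _].
- have h : (2 ^ b.+1 <= M)%N by rewrite leq_exp2l.
  have p := exp2_gt0 b; rewrite expnS in h.
  by rewrite ltnn ifT; [split; lia|lia].
- have h : (2 ^ b.+1 <= M)%N by rewrite leq_exp2l.
  have p := exp2_gt0 b; rewrite expnS in h *.
  rewrite ifT; last by lia.
  by split; try lia; case: eqP => // e1 _; lia.
- have h : (2 ^ a <= 2 ^ (a + j))%N by rewrite leq_exp2l // leq_addr.
  by rewrite ltnNge h /= ltnn; split; lia.
Qed.

(** Two levels lead from side 2^b to side 2^(b+1). They have 3 * 2^b and 4 * 2^b ports, 7 * 2^b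
    together, and the geometric sum is 7 (2^b - 1). *)
Lemma sum_ports_sq a b : (b <= a)%N ->
  (\sum_(e < b + b) ports (2 ^ a) e + 7 <= 7 * 2 ^ b)%N.
Proof.
elim: b => [|b IH] hb; first by rewrite big_ord0.
have -> : (b.+1 + b.+1 = (b + b).+2)%N by lia.
rewrite !big_ord_recr /= /ports /level_row dims_sq ?dims_half //; last by lia.
have h : (2 ^ b.+1 <= 2 ^ a)%N by rewrite leq_exp2l.
have p := exp2_gt0 b; have := IH (ltnW hb); rewrite /ports /level_row expnS in h *.
set S := (\sum_(i < b + b) _)%N.
rewrite ltnn ifT /=; last by lia.
rewrite ifT /=; last by lia.
lia.
Qed.

Lemma sum_ports a k :
  (\sum_(e < a + a + k) ports (2 ^ a) e <= (7 + k) * 2 ^ a)%N.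
Proof.
elim: k => [|k IH]; first by rewrite !addn0; have := sum_ports_sq (leqnn a); lia.
rewrite addnS big_ord_recr /= {2}/ports /level_row dims_wide.
have h : (2 ^ a <= 2 ^ (a + k))%N by rewrite leq_exp2l // leq_addr.
rewrite ltnNge h /= ltnn /=; set S := (\sum_(i < _) _)%N in IH *.
by rewrite -[X in (X + _)%N]/S; lia.
Qed.

(** * The tables of the tree and the propagation of changes *)

Section Tree.
Variable R : realType.
Implicit Types (s : st R).

(* Node h has children 2 h and 2 h + 1; its level is 0 at the leaves. *)
Record tabs s a k : Prop := Tabs {
  tb_M : nv s vM = (2 ^ a)%N; tb_N : nv s vN = (2 ^ (a + k))%N;
  tb_W : nv s vW = (2 ^ a + 2 ^ a)%N;
  tb_L : nv s vL = (a + a + k)%N; tb_NL : nv s vNL = (2 ^ (a + a + k))%N;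
  tb_lvl : forall e, (e < a + a + k)%N ->
    (na s aPA e.+1, na s aPN e.+1, (na s aOR e.+1, na s aOS e.+1),
     (na s aDR e.+1, na s aDC e.+1), na s aRS e.+1) = level_row (2 ^ a) e;
  tb_lev : forall h, (0 < h < 2 * 2 ^ (a + a + k))%N ->
    na s aLEV h = (a + a + k - trunc_log 2 h)%N;
  tb_par : forall h, (0 < h < 2 * 2 ^ (a + a + k))%N -> na s aPAR h = h./2;
  tb_root : na s aROW 1 = 0%N /\ na s aCOL 1 = 0%N;
  tb_kids : forall h, (0 < h < 2 ^ (a + a + k))%N ->
    [/\ na s aROW (2 * h)%N = na s aROW h, na s aCOL (2 * h)%N = na s aCOL h,
        na s aROW (2 * h + 1)%N = (na s aROW h + na s aDR (na s aLEV h))%N &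
        na s aCOL (2 * h + 1)%N = (na s aCOL h + na s aDC (na s aLEV h))%N] }.

Definition same_tabs s s' :=
  (forall x, x \in [:: vM; vN; vW; vL; vNL] -> nv s' x = nv s x) /\
  (forall A, (13 < A < 25)%N -> na s' A = na s A).

Lemma tabs_same s s' a k : same_tabs s s' -> tabs s a k -> tabs s' a k.
Proof.
case=> h1 h2 [? ? ? ? ? t1 t2 t3 t4 t5].
split; rewrite ?h1 //.
- by move=> e he; rewrite -t1 // !h2.
- by move=> h hh; rewrite -t2 // !h2.
- by move=> h hh; rewrite -t3 // !h2.
- by rewrite !h2.
- by move=> h hh; have := t5 h hh; rewrite !h2.
Qed.

Lemma same_tabs_trans s1 s2 s3 : same_tabs s1 s2 -> same_tabs s2 s3 -> same_tabs s1 s3.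
Proof.
by move=> [a b] [c d]; split=> x hx; [rewrite c // a|rewrite d // b].
Qed.

Lemma lev_gt0 s a k h : tabs s a k -> (0 < h < 2 ^ (a + a + k))%N ->
  (0 < na s aLEV h <= a + a + k)%N.
Proof.
move=> t hh; rewrite (tb_lev t); last by lia.
have h1 : (2 ^ trunc_log 2 h <= h)%N by rewrite trunc_logP //; lia.
have : (2 ^ trunc_log 2 h < 2 ^ (a + a + k))%N by lia.
by rewrite ltn_exp2l //; lia.
Qed.

Lemma tabs_lvl s a k e : tabs s a k -> (0 < e <= a + a + k)%N -> lvl_ok s e.
Proof.
move=> t; case: e => // e he; have /= := level_rowP a e.
rewrite -(tb_lvl t) //= => -[? ? ? ?]; rewrite /lvl_ok (tb_W t) (tb_M t).
by split.
Qed.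

Definition node_ok s h := rel_ok s h /\ key_ok s h.

Lemma region_keep s s' h1 n A c i W : only_at (h1 * W) n s s' -> (n <= W)%N ->
  c != h1 -> (i < W)%N -> (A < 4)%N -> na s' A (c * W + i)%N = na s A (c * W + i)%N.
Proof.
move=> ho hn hc hi hA; apply: ho => //; case: (ltngtP c h1) hc => // hc _.
  have : (c.+1 * W <= h1 * W)%N by rewrite leq_mul2r hc orbT.
  by rewrite mulSn; lia.
have : (h1.+1 * W <= c * W)%N by rewrite leq_mul2r hc orbT.
by rewrite mulSn; lia.
Qed.

Lemma nrep_keep s s' h1 n c W m X : only_at (h1 * W) n s s' -> (n <= W)%N ->
  c != h1 -> (m <= W)%N -> nrep m s 0 (c * W) X <-> nrep m s' 0 (c * W) X.
Proof.
move=> ho hn hc hm; split; apply: nrep_ext => // i hi.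
- by rewrite !(region_keep ho hn hc) //; lia.
- by rewrite !(region_keep ho hn hc) //; lia.
Qed.

(** The conditions at [h] read the regions and keys of [h] and its two children only. *)
Lemma node_keep s s' a k h h1 n : tabs s a k -> same_tabs s s' ->
  only_at (h1 * nv s vW) n s s' -> (n <= nv s vW)%N ->
  same_keys (fun j => j != h1) s s' ->
  h1 \notin [:: h; (2 * h)%N; (2 * h + 1)%N] -> (0 < h < 2 ^ (a + a + k))%N ->
  node_ok s h -> node_ok s' h.
Proof.
move=> t [q1 q2] ho hn hk; rewrite !inE !negb_or => /and3P[n1 n2 n3] hh [r1 r2].
have hl := tabs_lvl t (lev_gt0 t hh); have [l1 l2 l3 l4] := hl.
split.
- rewrite /rel_ok !q2 // !q1 // => X Y hX hY.
  have := r1 X Y; rewrite -/(rel_ok _ _).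
  set n' := na s aPA _ in l1 l2 hX hY *; set N := na s aPN _ in l1 l2 l3 l4 *.
  have n'W : (n' <= nv s vW)%N by lia.
  move=> {}r1; have := r1 ((nrep_keep _ ho hn _ n'W).2 hX) ((nrep_keep _ ho hn _ n'W).2 hY).
  rewrite ![_ == h1]eq_sym => /(_ n2 n3); case: ifP => _ r3.
    apply: (nrep_keep _ ho hn _ _).1 r3; first by rewrite eq_sym.
    by rewrite (tb_M t) (tb_W t); lia.
  by apply: (nrep_keep _ ho hn _ l3).1 r3; rewrite eq_sym.
- have [c [hc k1 k2 k3 k4]] := r2.
  have e j : j != h1 -> [/\ ra s' aKEY j = ra s aKEY j, na s' aTYP j = na s aTYP j
     & na s' aEV j = na s aEV j] := hk j.
  have [a1 a2 a3] := e h ltac:(by rewrite eq_sym).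
  have [b1 b2 b3] := e (2 * h)%N ltac:(by rewrite eq_sym).
  have [c1 c2 c3] := e (2 * h + 1)%N ltac:(by rewrite eq_sym).
  have nc : c != h1 by case: hc => ->; rewrite eq_sym.
  have [d1 d2 d3] := e c nc.
  exists c; rewrite /key_le a1 a2 a3 b1 b2 c1 c2 d1 d2 d3; split=> //.
Qed.
Definition leaves_same NL s s' := forall j, (NL <= j)%N ->
  (forall A i, (A < 4)%N -> (i < 2)%N ->
     na s' A (j * nv s vW + i)%N = na s A (j * nv s vW + i)%N) /\
  [/\ ra s' aKEY j = ra s aKEY j, na s' aTYP j = na s aTYP j &
      na s' aEV j = na s aEV j].

Lemma frame_same_tabs c s s' : frame c s s' ->
  ~~ has (mem [:: vM; vN; vW; vL; vNL]) (wn c) ->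
  ~~ has (fun A => 13 < A < 25)%N (wna c) -> same_tabs s s'.
Proof.
move=> [f1 _ f2 _ _] /hasPn h1 /hasPn h2; split.
- by move=> x hx; apply: f1; apply/negP => /h1 /negP; apply.
- by move=> A hA; apply: f2; apply/negP => /h2 /negP; apply.
Qed.

Lemma leaves_same_trans NL s1 s2 s3 : nv s2 vW = nv s1 vW ->
  leaves_same NL s1 s2 -> leaves_same NL s2 s3 -> leaves_same NL s1 s3.
Proof.
move=> w h1 h2 j hj; have [a1 [a2 a3 a4]] := h1 j hj.
have [b1 [b2 b3 b4]] := h2 j hj; rewrite w in b1.
split; first by move=> A i hA hi; rewrite b1 // a1.
by rewrite b2 b3 b4.
Qed.

Lemma leaves_same_pull NL s s' h n : (h < NL)%N -> (n <= nv s vW)%N ->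
  (1 < nv s vW)%N -> only_at (h * nv s vW) n s s' -> same_keys (fun j => j != h) s s' ->
  leaves_same NL s s'.
Proof.
move=> hh hn hW ho hk j hj; have ne : j != h by lia.
split; last exact: hk.
move=> A i hA hi; apply: (region_keep ho hn ne) => //; lia.
Qed.

Definition climb_cost a k := (1 + (a + a + k) * 54 + (7 + k) * 2 ^ a * 110)%N.

(** At any time only the parent of the current node may be inconsistent. Recomputing that parent
    moves the defect one level up, at a cost linear in the ports of the level. *)
Lemma climb_ok s a k : let NL := (2 ^ (a + a + k))%N in
  tabs s a k -> (NL <= nv s vh < 2 * NL)%N ->
  (forall h, (0 < h < NL)%N -> h != (nv s vh)./2 -> node_ok s h) ->
  tri climb s (climb_cost a k) (fun s' =>
    (forall h, (0 < h < NL)%N -> node_ok s' h) /\ leaves_same NL s s').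
Proof.
move=> NL t hl hn; pose L := (a + a + k)%N; have eNL : NL = (2 ^ L)%N by [].
pose I i s' := [/\ (0 < nv s' vh < 2 * NL)%N, (trunc_log 2 (nv s' vh) + i = L)%N,
  forall h, (0 < h < NL)%N -> h != (nv s' vh)./2 -> node_ok s' h &
  leaves_same NL s s'].
apply: (tri_for (Tb := fun e => (52 + ports (2 ^ a) e * 110).+1) (I := I)).
- by [].
- split=> //; first by lia.
  rewrite addn0; apply: trunc_log_eq => //; rewrite expnS -eNL; lia.
- move=> i s'; rewrite /= (tb_L t) -/L => hi [i1 i2 i3 i4] hF.
  have st : same_tabs s s' by exact: frame_same_tabs hF _ _.
  have t' := tabs_same st t.
  step; rewrite (tb_par t' i1) in ev.
  have c1 : (1 < nv s' vh)%N.
    have : (0 < trunc_log 2 (nv s' vh))%N by lia.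
    by rewrite trunc_log_gt0.
  have l1 := trunc_log2S c1; rewrite -ev in l1.
  have v0 : (0 < v < NL)%N by rewrite ev; have := odd_double_half (nv s' vh); lia.
  set s1 := setn _ _ _.
  have st1 : same_tabs s' s1.
    by split=> // x; rewrite !inE /= !fupdE => /or4P[|||/orP[]] /eqP ->.
  have t1 := tabs_same st1 t'.
  have e1 : nv s1 vh = v by rewrite /= fupd_eq.
  have lv : na s1 aLEV v = i.+1 by rewrite (tb_lev t1) //; [rewrite -/L; lia|lia].
  have ok1 : lvl_ok s1 (na s1 aLEV (nv s1 vh)).
    by rewrite e1 lv; apply: (tabs_lvl t1).
  have h1 : (0 < nv s1 vh)%N by rewrite e1; lia.
  have pN : na s1 aPN i.+1 = ports (2 ^ a) i by rewrite /ports -(tb_lvl t1).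
  apply: tri_weak (pull_ok h1 ok1) _ _; first by rewrite e1 lv pN.
  move=> s2 hF2; rewrite e1 lv pN => -[r1 r2 r3 r4].
  have st2 : same_tabs s1 s2 by exact: frame_same_tabs hF2 _ _.
  have e2 : nv s2 vh = v by case: hF2 => [-> //].
  have [l2 l3 l4 l5] := ok1; rewrite e1 lv pN in l4.
  have w1 : nv s1 vW = nv s' vW by rewrite /= !fupdE.
  split.
  + by rewrite e2; lia.
  + by rewrite e2; lia.
  + move=> h hh; rewrite e2 => hne.
    case: (eqVneq h v) => [->|hv]; first by split.
    have nk : node_ok s1 h.
      have hv' : h != (nv s' vh)./2 by rewrite -ev.
      exact: i3 h hh hv'.
    apply: (node_keep t1 st2 r3 l4 r4) => //; rewrite !inE !negb_or eq_sym hv /=.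
    have := odd_double_half v; move: hne; case: (odd v) => /=; lia.
  + have w' : nv s' vW = nv s vW by case: st => [-> //].
    apply: leaves_same_trans w' i4 _.
    have : leaves_same NL s1 s2.
      apply: (leaves_same_pull _ l4 _ r3 r4); first by lia.
      by rewrite (tb_W t1); have := exp2_gt0 a; lia.
    by rewrite /leaves_same w1.
- move=> s' hF; rewrite /= (tb_L t) -/L => -[i1 i2 i3 i4].
  (* The climb ends at the root; its parent index is 0, which is no node, so the exception
     disappears. *)
  have c1 : nv s' vh = 1%N.
    have e0 : trunc_log 2 (nv s' vh) = 0%N by lia.
    by move/eqP: e0; rewrite trunc_log_eq0 /=; lia.
  split=> // h hh; have hne : h != (nv s' vh)./2 by rewrite c1; lia.
  exact: i3 h hh hne.
- rewrite /= (tb_L t) -/L /climb_cost -/L.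
  have -> : (\sum_(i < L) (52 + ports (2 ^ a) i * 110).+2 =
    \sum_(i < L) 54 + (\sum_(i < L) ports (2 ^ a) i) * 110)%N.
    by rewrite big_distrl /= -big_split.
  rewrite sum_nat_const card_ord; have := sum_ports a k; rewrite -/L.
  set S := (\sum_(i < L) _)%N; lia.
Qed.

Lemma build_ok s a k : let NL := (2 ^ (a + a + k))%N in tabs s a k ->
  tri build s (1 + NL * (54 + 220 * 2 ^ a)) (fun s' =>
    (forall h, (0 < h < NL)%N -> node_ok s' h) /\ leaves_same NL s s').
Proof.
move=> NL t.
have NL0 : (0 < NL)%N := exp2_gt0 _.
pose I i s' := (forall h, (NL - i <= h < NL)%N -> node_ok s' h) /\ leaves_same NL s s'.
apply: (tri_for_cst (Tb := (52 + 220 * 2 ^ a).+1) (I := I)).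
- by rewrite /= (tb_NL t).
- by split=> // h; lia.
- move=> i s'; rewrite /= (tb_NL t) -/NL => hi [i3 i4] hF.
  have st : same_tabs s s' by exact: frame_same_tabs hF _ _.
  have t' := tabs_same st t.
  step; first by rewrite (tb_NL t') -/NL; lia.
  rewrite (tb_NL t') -/NL in ev.
  set s1 := setn _ _ _.
  have st1 : same_tabs s' s1.
    by split=> // x; rewrite !inE /= !fupdE => /or4P[|||/orP[]] /eqP ->.
  have t1 := tabs_same st1 t'.
  have e1 : nv s1 vh = v by rewrite /= fupd_eq.
  have v0 : (0 < v < NL)%N by lia.
  have ok1 : lvl_ok s1 (na s1 aLEV (nv s1 vh)).
    by rewrite e1; apply: (tabs_lvl t1); apply: (lev_gt0 t1).
  have h1 : (0 < nv s1 vh)%N by rewrite e1; lia.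
  have [l2 l3 l4 l5] := ok1.
  have w1 : nv s1 vW = (2 ^ a + 2 ^ a)%N by rewrite (tb_W t1).
  apply: tri_weak (pull_ok h1 ok1) _ _; first by rewrite w1 in l4; lia.
  move=> s2 hF2; rewrite e1 in l4 * => -[r1 r2 r3 r4].
  have st2 : same_tabs s1 s2 by exact: frame_same_tabs hF2 _ _.
  split.
  + move=> h hh; case: (eqVneq h v) => [->|hv]; first by split.
    have nk : node_ok s1 h.
      by apply: i3; lia.
    apply: (node_keep t1 st2 r3 l4 r4) => //; last by lia.
    rewrite !inE !negb_or eq_sym hv /=; lia.
  + have w' : nv s' vW = nv s vW by case: st => [-> //].
    apply: leaves_same_trans w' i4 _.
    have : leaves_same NL s1 s2.
      apply: (leaves_same_pull _ l4 _ r3 r4); first by lia.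
      by rewrite w1; have := exp2_gt0 a; lia.
    by rewrite /leaves_same w1 (tb_W t').
- move=> s' hF; rewrite /= (tb_NL t) -/NL => -[i3 i4].
  by split=> // h hh; apply: i3; lia.
- rewrite /= (tb_NL t) -/NL; nia.
Qed.
End Tree.

(** * Paths in the matrix and the root of the tree *)

Definition grid_path (F : nat * nat -> bool) m n := exists p : seq (nat * nat),
  [&& path mstep (0%N, 0%N) p, all F ((0%N, 0%N) :: p) &
      last (0%N, 0%N) p == (m, n)].

Lemma grid_pathE F i j : grid_path F i j <-> F (i, j) /\
  ((i = 0 /\ j = 0)%N \/ exists2 p, mstep p (i, j) & grid_path F p.1 p.2).
Proof.
split.
- case; elim/last_ind => [|p x _].
    by case/and3P => _ /=; rewrite andbT => h /eqP [<- <-]; split=> //; left.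
  rewrite rcons_path last_rcons -rcons_cons all_rcons => /and3P[/andP[h1 h2] /andP[h3 h4] /eqP e].
  rewrite e in h2 h3; split=> //; right.
  exists (last (0%N, 0%N) p) => //; exists p; rewrite h1 h4 /=.
  by case: (last _ _) => ? ?.
- case=> hF [[ei ej]|[[x y] hs [p /and3P[h1 h2 /eqP h3]]]].
    rewrite ei ej in hF *.
    by exists [::]; rewrite /= hF eqxx.
  exists (rcons p (i, j)); rewrite rcons_path last_rcons -rcons_cons all_rcons.
  by rewrite h1 h2 h3 /= hs hF eqxx.
Qed.

Section Ports.
Variable F : nat * nat -> bool.

(** The first disjunct is the source of all paths, an entry into the corner cell from outside. A
    diagonal step arrives through the left port, after its detour through the cell to the left of
    its target. *)
Definition portH i j := (i = 0 /\ j = 0)%N \/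
  (0 < j)%N /\ (grid_path F i j.-1 \/ (0 < i)%N /\ grid_path F i.-1 j.-1).
Definition portV i j := (0 < i)%N /\ grid_path F i.-1 j.

Lemma grid_path_ports i j : grid_path F i j <-> F (i, j) /\ (portH i j \/ portV i j).
Proof.
rewrite grid_pathE /portH /portV; split=> -[hF h]; split=> //.
- case: h => [|[[x y] hs hp]]; first by tauto.
  move: hs; rewrite /mstep /= => /or3P[] /eqP [? ?]; subst; rewrite /= in hp *.
  + by right.
  + by left; right; split=> //; left.
  + by left; right; split=> //; right.
- case: h => [[|[h1 [h|[h2 h]]]]|[h1 h]]; first by tauto.
  + by right; exists (i, j.-1) => //; rewrite /mstep /=; case: j h1 {hF h} => // j _; rewrite eqxx orbT.
  + right; exists (i.-1, j.-1) => //; rewrite /mstep /=.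
    by case: j h1 {hF h} => // j _; case: i h2 => // i _; rewrite eqxx !orbT.
  + by right; exists (i.-1, j) => //; rewrite /mstep /=; case: i h1 {hF h} => // i _; rewrite eqxx.
Qed.

Lemma port_eqs r c : cell_eqs portH portV (F (r, c)) r c.
Proof.
split; first by rewrite {1}/portV /= grid_path_ports; split=> [[]|].
rewrite {1}/portH /= grid_path_ports /portV; split.
  by case=> [[_ //]|[_ h]]; tauto.
by case=> [?|[? ?]]; right; split=> //; tauto.
Qed.

(** The right exit of the last cell may also be reached by a detour through that cell while it is
    blocked, so its freeness is tested separately. *)
Lemma port_sink m n : portH m n.+1 /\ F (m, n) <-> grid_path F m n.
Proof.
split=> [[h hF]|h].
  apply/grid_path_ports; split=> //; move: h; rewrite {1}/portH /=.
  by case=> [[_ //]|[_ [/grid_path_ports [_ //]|h]]]; right.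
have [hF _] := (grid_path_ports _ _).1 h.
by split=> //; right; split=> //; left.
Qed.
End Ports.

(** * The relation at the root and the connectivity query *)

Section Root.
Variables (R : realType) (s : st R) (a k : nat).
Hypothesis a0 : (0 < a)%N.
Hypothesis t : tabs s a k.
Let M := (2 ^ a)%N.
Let L := (a + a + k)%N.
Let NL := (2 ^ L)%N.

Definition row h := na s aROW h.
Definition col h := na s aCOL h.

Lemma dimsS m e : dims m e.+1 = next_dim m (dims m e). Proof. by []. Qed.

Lemma level_geo e : (e < L)%N -> let d := dims M e in
  (na s aDR e.+1 = d.1 /\ na s aDC e.+1 = 0 /\ dims M e.+1 = (d.1 + d.1, d.2))%N \/
  (na s aDR e.+1 = 0 /\ na s aDC e.+1 = d.2 /\ dims M e.+1 = (d.1, d.2 + d.2))%N.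
Proof.
move=> he /=; have := tb_lvl t he; rewrite dimsS /level_row /next_dim -/M.
case: (dims M e) => x y /=; case: ifP => h1; first by case=> _ _ _ _ -> -> _; right.
by case: ifP => h2 [_ _ _ _ -> -> _]; [left|right].
Qed.

Lemma lev_root : na s aLEV 1 = L.
Proof. by rewrite (tb_lev t) ?trunc_log1 ?subn0 //= -/L -/NL; have := exp2_gt0 L; lia. Qed.

Lemma lev_internal h : (0 < h < NL)%N -> exists2 e, na s aLEV h = e.+1 & (e < L)%N.
Proof.
move=> hh; have := lev_gt0 t hh; rewrite -/L; case: (na s aLEV h) => // e he.
by exists e.
Qed.

Lemma lev_kids h : (0 < h < NL)%N -> forall b : bool,
  na s aLEV (2 * h + b) = (na s aLEV h).-1.
Proof.
move=> hh b; rewrite !(tb_lev t) -/L -/NL; try (case: b; lia).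
have h1 : (1 < 2 * h + b)%N by case: b; lia.
rewrite (trunc_log2S h1) (_ : (2 * h + b)./2 = h); first by lia.
by rewrite mul2n addnC half_bit_double.
Qed.

Lemma lev_leaf h : (NL <= h < 2 * NL)%N -> na s aLEV h = 0%N.
Proof.
move=> hh; rewrite (tb_lev t); last by have := exp2_gt0 L; rewrite -/L -/NL; lia.
rewrite (@trunc_log_eq 2 L) ?subnn // expnS; lia.
Qed.

Lemma lev_kid_internal h e : (0 < h < 2 * NL)%N -> na s aLEV h = e.+1 -> (0 < h < NL)%N.
Proof.
move=> hh he; case: (ltnP h NL) => h1; first by lia.
by rewrite lev_leaf in he; lia.
Qed.

Lemma lev_leafP h : (0 < h < 2 * NL)%N -> na s aLEV h = 0%N -> (NL <= h < 2 * NL)%N.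
Proof.
move=> hh he; case: (ltnP h NL) => h1; last by lia.
by have [|e] := @lev_internal h _; [lia|rewrite he].
Qed.

Lemma node_ind (P : nat -> Prop) : P 1%N ->
  (forall h, (0 < h < NL)%N -> P h -> P (2 * h)%N /\ P (2 * h + 1)%N) ->
  forall h, (0 < h < 2 * NL)%N -> P h.
Proof.
move=> h1 hs; elim/ltn_ind => h IH hh; case: (ltnP 1 h) => h2; last first.
  by have -> : h = 1%N by lia.
have hh' : (0 < h./2 < NL)%N by have := odd_double_half h; lia.
have [p1 p2] := hs _ hh' (IH h./2 ltac:(have := odd_double_half h; lia) ltac:(lia)).
by have := odd_double_half h; case: (odd h) => /= <-;
  rewrite -mul2n addnC ?addn0.
Qed.

Lemma box_le h : (0 < h < 2 * NL)%N ->
  (row h + (dims M (na s aLEV h)).1 <= M)%N /\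
  (col h + (dims M (na s aLEV h)).2 <= 2 ^ (a + k))%N.
Proof.
have dL : dims M L = (M, 2 ^ (a + k))%N by rewrite dims_wide.
move: h; apply: node_ind.
  by rewrite lev_root dL /= /row /col (tb_root t).1 (tb_root t).2.
move=> h1 hh; have [e he hL] := lev_internal hh.
have := lev_kids hh false; have := lev_kids hh true; rewrite addn0 he /= => -> ->.
have [k1 k2 k3 k4] := tb_kids t hh; rewrite he in k3 k4.
rewrite /row /col k1 k2 k3 k4.
by case: (level_geo hL) => -[-> [-> ->]] /=; lia.
Qed.

Lemma leaf_box h : (NL <= h < 2 * NL)%N -> (row h < M)%N /\ (col h < 2 ^ (a + k))%N.
Proof.
move=> hh; have [|h1 h2] := @box_le h _; first by have := exp2_gt0 L; lia.
by rewrite lev_leaf // /dims /= in h1 h2; lia.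
Qed.

Lemma leaf_onto i j : (i < M)%N -> (j < 2 ^ (a + k))%N ->
  exists2 l, (NL <= l < 2 * NL)%N & row l = i /\ col l = j.
Proof.
move=> hi hj.
have gen e h : (0 < h < 2 * NL)%N -> na s aLEV h = e ->
    (row h <= i < row h + (dims M e).1)%N -> (col h <= j < col h + (dims M e).2)%N ->
    exists2 l, (NL <= l < 2 * NL)%N & row l = i /\ col l = j.
  elim: e h => [|e IH] h hh he hr hc.
    exists h; first exact: lev_leafP.
    by move: hr hc; rewrite /dims /=; lia.
  have hh' := lev_kid_internal hh he.
  have := lev_kids hh' false; have := lev_kids hh' true; rewrite addn0 he /= => l1 l2.
  have [k1 k2 k3 k4] := tb_kids t hh'; rewrite he in k3 k4.
  have hL : (e < L)%N by have := lev_gt0 t hh'; rewrite he -/L; lia.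
  have g1 : (0 < 2 * h < 2 * NL)%N by lia.
  have g2 : (0 < 2 * h + 1 < 2 * NL)%N by lia.
  case: (level_geo hL) => -[d1 [d2 d3]]; rewrite d1 in k3; rewrite d2 in k4;
    rewrite d3 /= in hr hc.
  - case: (ltnP i (row h + (dims M e).1)) => hlt.
      by apply: (IH _ g1 l2); rewrite /row /col ?k1 ?k2 -/(row h) -/(col h); lia.
    by apply: (IH _ g2 l1); rewrite /row /col ?k3 ?k4 -/(row h) -/(col h); lia.
  - case: (ltnP j (col h + (dims M e).2)) => hlt.
      by apply: (IH _ g1 l2); rewrite /row /col ?k1 ?k2 -/(row h) -/(col h); lia.
    by apply: (IH _ g2 l1); rewrite /row /col ?k3 ?k4 -/(row h) -/(col h); lia.
have dL : dims M L = (M, 2 ^ (a + k))%N by rewrite dims_wide.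
apply: (gen L 1%N); rewrite ?lev_root ?dL //= /row /col ?(tb_root t).1 ?(tb_root t).2 //.
by have := exp2_gt0 L; rewrite -/NL; lia.
Qed.

(** Leaves map onto cells by [leaf_onto], and there are as many leaves as cells, so the map is
    injective. *)
Lemma leaf_inj l l' : (NL <= l < 2 * NL)%N -> (NL <= l' < 2 * NL)%N ->
  row l = row l' -> col l = col l' -> l = l'.
Proof.
have Mp : M = M.-1.+1 by rewrite prednK // exp2_gt0.
have Np : (2 ^ (a + k) = (2 ^ (a + k)).-1.+1)%N by rewrite prednK // exp2_gt0.
pose f (i : 'I_NL) : 'I_M.-1.+1 * 'I_(2 ^ (a + k)).-1.+1 :=
  (inord (row (NL + i)), inord (col (NL + i))).
have fbox (i : 'I_NL) : (NL <= NL + i < 2 * NL)%N by have := ltn_ord i; lia.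
have f_onto : codom f =i predT.
  move=> -[x y]; rewrite [RHS]inE; apply/codomP.
  have [z hz [hr hc]] := @leaf_onto x y ltac:(rewrite [X in (_ < X)%N]Mp; exact: ltn_ord)
     ltac:(rewrite [X in (_ < X)%N]Np; exact: ltn_ord).
  have hz' : (z - NL < NL)%N by lia.
  exists (Ordinal hz'); rewrite /f /= subnKC; last by lia.
  by rewrite hr hc !inord_val.
have f_inj : injective f.
  move=> x y e; apply: (image_injP (A := predT) _ x y) e; rewrite ?inE //.
  rewrite (eq_card f_onto) card_prod !card_ord -Mp -Np /NL /L /M -expnD.
  by apply/eqP; congr (2 ^ _)%N; lia.
move=> hl hl' er ec.
have b1 : (l - NL < NL)%N by lia.
have b2 : (l' - NL < NL)%N by lia.
have : f (Ordinal b1) = f (Ordinal b2).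
  by rewrite /f /= !subnKC ?er ?ec //; lia.
by move/f_inj => [] ; lia.
Qed.

Lemma last_leaf : row (2 * NL - 1) = M.-1 /\ col (2 * NL - 1) = (2 ^ (a + k)).-1.
Proof.
have dL : dims M L = (M, 2 ^ (a + k))%N by rewrite dims_wide.
have gen d : (d <= L)%N -> let h := (2 ^ d.+1 - 1)%N in
    na s aLEV h = (L - d)%N /\
    (row h + (dims M (L - d)).1 = M)%N /\ (col h + (dims M (L - d)).2 = 2 ^ (a + k))%N.
  elim: d => [|d IH] hd.
    by rewrite /= subn0 lev_root dL /row /col (tb_root t).1 (tb_root t).2.
  have [e1 [e2 e3]] := IH (ltnW hd).
  have hh : (0 < 2 ^ d.+1 - 1 < NL)%N.
    have : (2 ^ d.+1 <= NL)%N by rewrite leq_exp2l.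
    by rewrite expnS; have := exp2_gt0 d; lia.
  have -> : (2 ^ d.+2 - 1 = 2 * (2 ^ d.+1 - 1) + 1)%N by rewrite (expnS 2 d.+1); lia.
  rewrite /= (lev_kids hh true) e1.
  have eL : (L - d = (L - d.+1).+1)%N by lia.
  rewrite eL in e1 e2 e3 *; rewrite /=; split=> //.
  have [_ _ k3 k4] := tb_kids t hh; rewrite e1 in k3 k4.
  rewrite /row /col k3 k4 -/(row _) -/(col _).
  have hL : (L - d.+1 < L)%N by lia.
  by case: (level_geo hL) => -[d1 [d2 d3]]; rewrite d1 d2 d3 /= in e2 e3 *; lia.
have [_] := gen L (leqnn L); rewrite subnn /dims /= expnS -/NL; lia.
Qed.
Variable (sigma : nat -> bool).
Hypothesis nodes : forall h, (0 < h < NL)%N -> node_ok s h.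
Hypothesis leaves : forall l, (NL <= l < 2 * NL)%N ->
  nrep 2 s 0 (l * nv s vW) (cell_rel (sigma l)).

Definition cell_on (ij : nat * nat) : bool :=
  [exists l : 'I_NL, [&& row (NL + l) == ij.1, col (NL + l) == ij.2 & sigma (NL + l)]].

Lemma cell_onE l : (NL <= l < 2 * NL)%N -> cell_on (row l, col l) = sigma l.
Proof.
move=> hl; apply/existsP/idP => [[x /and3P[/eqP h1 /eqP h2]]|h].
  have hx : (NL <= NL + x < 2 * NL)%N by have := ltn_ord x; lia.
  by rewrite (leaf_inj hx hl h1 h2).
have hl' : (l - NL < NL)%N by lia.
by exists (Ordinal hl'); rewrite /= subnKC ?eqxx //; lia.
Qed.

Let H := portH cell_on.
Let V := portV cell_on.

Lemma leaf_eqs l : (NL <= l < 2 * NL)%N -> cell_eqs H V (sigma l) (row l) (col l).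
Proof. by move=> hl; have := port_eqs cell_on (row l) (col l); rewrite cell_onE. Qed.

Lemma V0 j : ~ V 0 j. Proof. by case. Qed.

(** Restriction forgets the upper entries. That is sound because blocks of full height begin in row
    0, where no path enters from above. *)
Lemma row_top h : (0 < h < 2 * NL)%N -> (a + a <= na s aLEV h)%N -> row h = 0%N.
Proof.
move: h; apply: node_ind; first by rewrite /row (tb_root t).1.
move=> h hh IH; have [e he hL] := lev_internal hh.
have := lev_kids hh false; have := lev_kids hh true; rewrite addn0 he /= => -> ->.
have [k1 _ k3 _] := tb_kids t hh; rewrite /row k1 k3 he; rewrite he in IH.
have hr : (a + a <= e)%N -> na s aDR e.+1 = 0%N.
  move=> hae; have := tb_lvl t hL.
  have -> : e = (a + a + (e - (a + a)))%N by lia.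
  rewrite /level_row dims_wide.
  have h2 : (2 ^ a <= 2 ^ (a + (e - (a + a))))%N by rewrite leq_exp2l // leq_addr.
  by rewrite ltnNge h2 /= ltnn => -[].
by split=> hae; rewrite -/(row h) IH ?hr //; lia.
Qed.

(** Local consistency of the nodes is turned into a global statement, level by level: below level 2a
    a node relates its left and upper entries to all its exits, from level 2a on only its left side
    to its right side. *)
Lemma node_tr e h : (0 < h < 2 * NL)%N -> na s aLEV h = e ->
  exists X, if (e < a + a)%N then
     nrep ((dims M e).1 + (dims M e).2) s 0 (h * nv s vW) X /\
     block_tr H V (row h) (col h) (dims M e).1 (dims M e).2 X
   else nrep M s 0 (h * nv s vW) X /\ wide_tr H M (col h) (dims M e).2 X.
Proof.
elim: e h => [|e IH] h hh he.
  have hl := lev_leafP hh he; exists (cell_rel (sigma h)).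
  by rewrite ifT; [split; [exact: leaves|apply: block_cell; exact: leaf_eqs]|lia].
have hi := lev_kid_internal hh he; have [e' e1 hL] := lev_internal hi.
rewrite he in e1; case: e1 => e1; subst e'.
have := lev_kids hi false; have := lev_kids hi true; rewrite addn0 he /= => l1 l2.
have g1 : (0 < 2 * h < 2 * NL)%N by lia.
have g2 : (0 < 2 * h + 1 < 2 * NL)%N by lia.
have [X hX] := IH _ g1 l2; have [Y hY] := IH _ g2 l1.
have [k1 k2 k3 k4] := tb_kids t hi; rewrite he in k3 k4.
rewrite /row /col k1 k2 in hX; rewrite /row /col k3 k4 in hY.
have [hr _] := nodes hi; have := hr X Y; rewrite he.
have tl := tb_lvl t hL; rewrite dimsS /next_dim.
move: tl hX hY; rewrite /level_row -/M; case: (dimsP a e) => [b hb eb|b hb eb|j ej].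
- have hlt : (2 ^ b < M)%N by rewrite ltn_exp2l.
  rewrite ltnn /= hlt => -[-> -> -> -> -> -> ->] /=.
  rewrite !ifT; try lia.
  move=> [x1 x2] [y1 y2] /(_ x1 y1) hZ.
  eexists; rewrite ifT; last by lia.
  split; first by exact: hZ.
  by rewrite addn0 in y2; exact: block_vmerge x2 y2.
- have hlt : (2 ^ b < 2 ^ b.+1)%N by rewrite ltn_exp2l.
  rewrite hlt /= => -[-> -> -> -> -> -> ->] /=.
  rewrite ifT; last by lia.
  move=> [x1 x2] hY; rewrite ifT in hY; last by lia.
  case: hY => y1 y2 /(_ x1 y1).
  have e2 : (2 ^ b + 2 ^ b = 2 ^ b.+1)%N by rewrite expnS; lia.
  have bt := block_hmerge x2; rewrite addn0 in y2; have {}bt := bt _ y2.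
  case: eqP => hbM /= hZ.
  + have ea : b.+1 = a by apply/eqP; rewrite -(eqn_exp2l (m := 2)) // -e2 hbM.
    eexists; rewrite ifN; last by lia.
    split; first by rewrite -[M](tb_M t); exact: hZ.
    have r0 : na s aROW h = 0%N by apply: row_top => //; rewrite he; lia.
    rewrite -/(col h) e2 ea -/M (tb_M t) -/M; apply: block_restr; first exact: V0.
    by move: bt; rewrite r0 e2 ea -/M -addnA e2 ea.
  + eexists; rewrite ifT; last first.
      have : b.+1 != a by apply/eqP => ea; apply: hbM; rewrite e2 ea.
      lia.
    split; first by rewrite addnA; exact: hZ.
    exact: bt.
- have hle : (M <= 2 ^ (a + j))%N by rewrite leq_exp2l // leq_addr.
  rewrite ltnNge hle /= ltnn /= => -[-> -> -> -> -> -> ->] /=.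
  rewrite !ifN; try lia.
  move=> [x1 x2] [y1 y2] /(_ x1 y1) hZ.
  eexists; rewrite ifN; last by lia.
  split; first by exact: hZ.
  exact: wide_merge.
Qed.

(** Ports are numbered upwards, so the path goes from port M - 1 of the root to port 0. The ends of
    a nonempty hull belong to the row, so it suffices that this hull starts at 0; the last leaf is
    the corner cell. *)
Definition query : bool :=
  [&& na s aLO (nv s vW + (M - 1)) == 0, 0 < na s aHI (nv s vW + (M - 1)) &
      sigma (2 * NL - 1)]%N.

Lemma query_path : query <-> grid_path cell_on M.-1 (2 ^ (a + k)).-1.
Proof.
have Mp : (0 < M)%N := exp2_gt0 a.
have h1 : (0 < 1 < 2 * NL)%N by have := exp2_gt0 L; rewrite -/NL; lia.
have [X] := node_tr h1 lev_root; rewrite ifN; last by rewrite /L; lia.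
rewrite mul1n /L dims_wide /= /col (tb_root t).2 => -[hX hT].
have hs : H M.-1 (2 ^ (a + k)) <-> X (M - 1)%N 0%N.
  have := hT 0%N Mp; rewrite add0n subn1 => ->; split.
    case=> a' [ha' [[e0 _]|[]//] x].
    by have -> : M.-1 = a' by lia.
  move=> x; exists (M.-1); split=> //; first by lia.
  by left; rewrite prednK // subnn.
have hq : X (M - 1)%N 0%N <-> (na s aLO (nv s vW + (M - 1)) == 0)%N &&
    (0 < na s aHI (nv s vW + (M - 1)))%N.
  have [hh _ _] := hX; have [|q1 q2 q3 q4] := hh (M - 1)%N; first by lia.
  split; first by move=> /(q3 _ Mp); rewrite leqn0.
  by move=> /andP[/eqP z1 z2]; rewrite z1 in q4; have [] := q4 z2.
have Np : (2 ^ (a + k) = (2 ^ (a + k)).-1.+1)%N by rewrite prednK // exp2_gt0.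
rewrite -port_sink -Np -/H hs hq /query.
have NLp := exp2_gt0 L.
have el : (NL <= 2 * NL - 1 < 2 * NL)%N by rewrite -/NL in NLp; lia.
rewrite -(cell_onE el) last_leaf.1 last_leaf.2.
split; first by case/and3P => -> -> ->.
by case=> /andP[-> ->] ->.
Qed.
End Root.

(** * Sweeping the right half of a circle *)

Notation xd := 0%N. Notation xx0 := 1%N. Notation xy0 := 2%N. Notation xdx := 3%N.
Notation xdy := 4%N. Notation xD := 5%N. Notation xE := 6%N. Notation xF := 7%N.
Notation xb := 8%N. Notation xr := 9%N. Notation xal := 10%N. Notation xbe := 11%N.

Definition arc_code : com :=
  SetR xdx (RSub (RA aCX (NV vh)) (RV xx0));; SetR xdy (RSub (RA aCY (NV vh)) (RV xy0));;
  SetR xD (RAdd (RMul (RV xdx) (RV xdx)) (RMul (RV xdy) (RV xdy)));;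
  SetR xal (RC (-1));; SetR xbe (RC 1);; SetN vph (NC 0);;
  If (BR (RC 0) (RV xD))
   (If (BR (RMul (RC 4) (RMul (RV xd) (RV xd))) (RV xD)) (SetN vph (NC 2))
     (SetR xb (RMul (RMul (RC 2) (RV xd)) (RV xdy));;
      SetR xE (RAdd (RV xD) (RMul (RMul (RC 2) (RV xd)) (RV xdx)));;
      SetR xF (RSub (RV xD) (RMul (RMul (RC 2) (RV xd)) (RV xdx)));;
      SetR xr (RSqrt (RMul (RV xD) (RSub (RMul (RC 4) (RMul (RV xd) (RV xd))) (RV xD))));;
      If (BR (RC 0) (RV xE))
       (SetR xal (RDiv (RSub (RV xb) (RV xr)) (RV xE));;
        SetR xbe (RDiv (RAdd (RV xb) (RV xr)) (RV xE));;
        If (BR (RV xal) (RC (-1))) (SetR xal (RC (-1))) Skip;;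
        If (BR (RC 1) (RV xbe)) (SetR xbe (RC 1)) Skip;;
        If (BR (RV xbe) (RV xal)) (SetN vph (NC 2)) Skip)
       (If (BR (RAdd (RV xb) (RV xr)) (RV xF))
         (If (BR (RSub (RV xr) (RV xb)) (RV xF)) (SetN vph (NC 2))
            (SetR xbe (RDiv (RV xF) (RSub (RV xb) (RV xr)))))
         (SetR xal (RDiv (RV xF) (RAdd (RV xb) (RV xr)))))))
   Skip.

(* First event of a leaf; a leaf without events has phase 2 and a key beyond the
   parameter range. *)
Definition leaf_init : com :=
  arc_code;;
  StoR aKEY (NV vh) (RV xal);; StoR aBE (NV vh) (RV xbe);; StoN aTYP (NV vh) (NV vph);;
  If (BN (NC 0) (NV vph)) (StoR aKEY (NV vh) (RC 2)) Skip;;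
  StoN aEV (NV vh) (NV vh);; set_leaf.

Definition prep : com :=
  For vl (NV vNL) (SetN vh (NAdd (NV vNL) (NV vl));; leaf_init).

(** * Arcs at the leaves and their first events *)

Section Arc.
Variable R : realType.
Implicit Types (s : st R).

Definition ctr s l : pt R := (ra s aCX l, ra s aCY l).
Definition ctr0 s : pt R := (rv s xx0, rv s xy0).
Definition rel_ctr s l : pt R := ((ctr s l).1 - (ctr0 s).1, (ctr s l).2 - (ctr0 s).2).

Lemma arc_code_ok s : 0 < rv s xd ->
  tri arc_code s 24 (fun s' => (nv s' vph < 3)%N /\ nv s' vph != 1%N /\
    arc_spec (rv s xd) (rel_ctr s (nv s vh)) (nv s' vph == 0)%N (rv s' xal) (rv s' xbe)).
Proof.
move=> d0; set d := rel_ctr s (nv s vh); pose delta := rv s xd.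
rewrite /arc_code; do 6 step; rewrite -/d.1 -/d.2.
have e1 : x = d.1 by [].
have e2 : x0 = d.2 by [].
have e3 : x1 = qD d by rewrite ex1 e1 e2 /qD !expr2.
rewrite -pmulrn in ex3.
have em : x2 = -1 by rewrite ex2 mulrNz.
clear ex ex0 ex1 ex2; subst x x0 x1 x2 x3 v.
have four : 4%:~R * (delta * delta) = 4 * delta ^+ 2 :> R by rewrite expr2.
step; last first.
  steps; rewrite /= !fupdE /=; do 2 split=> //.
  by apply: arc_same; rewrite leNgt; move: hc; rewrite mulr0z.
rewrite mulr0z in hc; step.
  steps; subst v; rewrite /= !fupdE /=; do 2 split=> //; rewrite -/delta four in hc0.
  exact: arc_far.
rewrite -/delta four -leNgt in hc0.
step; step; step.
have h2 : 2%:~R = 2 :> R by [].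
have eb : x = qb delta d by rewrite ex h2.
have eE : x0 = qE delta d by rewrite ex0 h2.
have eF : x1 = qF delta d by rewrite ex1 h2.
clear ex ex0 ex1; subst x x0 x1.
step.
  by rewrite -/delta four; apply: mulr_ge0; lra.
have er : x = qr delta d by rewrite ex -/delta four.
clear ex; subst x.
step.
- rewrite mulr0z in hc1; step; first by rewrite gt_eqF.
  step; first by rewrite gt_eqF.
  pose lo := (qb delta d - qr delta d) / qE delta d.
  pose hi := (qb delta d + qr delta d) / qE delta d.
  have fin al be (ph : nat) : al = (if lo < (-1)%:~R then (-1)%:~R else lo) ->
     be = (if 1%:~R < hi then 1%:~R else hi) -> ph = (if (be < al)%R then 2 else 0)%N ->
     [/\ (ph < 3)%N, ph != 1%N & arc_spec delta d (ph == 0)%N al be].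
    move=> h1 h3 ->; split; [by case: ifP|by case: ifP|].
    rewrite mulrNz in h1; have := arc_pos hc hc0 hc1 h1 h3; by case: ifP.
  rewrite -/lo in ex; rewrite -/hi in ex0; subst x x0.
  have fin' al be ph : al = (if lo < (-1)%:~R then (-1)%:~R else lo) ->
     be = (if 1%:~R < hi then 1%:~R else hi) -> ph = (if (be < al)%R then 2 else 0)%N ->
     (ph < 3)%N /\ ph != 1%N /\ arc_spec delta d (ph == 0)%N al be.
    by move=> h1 h3 h4; have [] := fin al be ph h1 h3 h4.
  steps; rewrite /= ?fupdE /=; apply: fin';
    first [by rewrite ?ex ?ex0 ?ev hc2 | by rewrite ?ex ?ex0 ?ev (negbTE hc2)
          | by rewrite ?ex ?ex0 ?ev hc3 | by rewrite ?ex ?ex0 ?ev (negbTE hc3)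
          | by rewrite ?ev hc4 | by rewrite ?ev (negbTE hc4)].
- rewrite mulr0z -leNgt in hc1.
  have F0 : 0 < qF delta d.
    have : qE delta d + qF delta d = 2 * qD d by rewrite /qE /qF; ring.
    lra.
  have fin (ne : bool) al be := @arc_npos R delta d ne al be hc hc0 hc1.
  rewrite /= in fin.
  step; [step|].
  + steps; rewrite /= ?fupdE /= ev; split=> //; split=> //.
    by apply: fin; rewrite /= hc2 hc3.
  + rewrite -leNgt in hc3.
    have nb : qb delta d - qr delta d != 0 by rewrite lt_eqF //; lra.
    steps => //; rewrite /= ?fupdE /=; split=> //; split=> //.
    by apply: fin; rewrite /= hc2 ltNge hc3 /= ex.
  + rewrite -leNgt in hc2.
    have nb : qb delta d + qr delta d != 0 by rewrite gt_eqF //; lra.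
    steps => //; rewrite /= ?fupdE /=; split=> //; split=> //.
    by apply: fin; rewrite /= ltNge hc2 /= ex.
Qed.

(* What the sweep keeps at leaf [l] in phase [ph]: the arc of the circle inside
   the disk of the leaf is [al, be], and it is empty when [~~ ne]. *)
Definition leaf_ok s l (ne : bool) (al be : R) (ph : nat) :=
  [/\ na s aTYP l = ph, na s aEV l = l,
      nrep 2 s 0 (l * nv s vW) (cell_rel (na s aTYP l == 1)%N) &
      [/\ (ph <= 2)%N, ph <> 2 -> ne, ne -> ra s aBE l = be &
        ra s aKEY l = if ph == 0%N then al else if ph == 1%N then be else 2]].

Lemma leaf_init_ok s : 0 < rv s xd -> let h := nv s vh in
  tri leaf_init s 45 (fun s' => [/\
    exists ne al be, arc_spec (rv s xd) (rel_ctr s h) ne al be /\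
      leaf_ok s' h ne al be (if ne then 0 else 2)%N,
    only_at (h * nv s vW) 2 s s' &
    forall l, l != h -> [/\ ra s' aKEY l = ra s aKEY l, ra s' aBE l = ra s aBE l,
      na s' aTYP l = na s aTYP l & na s' aEV l = na s aEV l]]).
Proof.
move=> d0 h.
apply: (tri_seq (T2 := 20) (arc_code_ok d0)); last by [].
move=> s1 [fn1 _ fa1 fra1 _] [hp1 [hp2 harc]].
have eh : nv s1 vh = h by rewrite fn1.
have eW : nv s1 vW = nv s vW by rewrite fn1.
set ph := nv s1 vph in hp1 hp2 harc.
pose ne := (ph == 0)%N.
have eph : ph = (if ne then 0 else 2)%N by rewrite /ne; move: hp1 hp2; case: (ph) => [|[|[]]].
have main s2 : nv s2 vh = h -> nv s2 vW = nv s vW ->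
    (forall A, (A < 4)%N -> na s2 A = na s A) ->
    (forall l, na s2 aTYP l = if l == h then ph else na s aTYP l) ->
    (forall l, na s2 aEV l = if l == h then h else na s aEV l) ->
    (forall l, ra s2 aBE l = if l == h then rv s1 xbe else ra s aBE l) ->
    (forall l, ra s2 aKEY l = if l == h then (if ne then rv s1 xal else 2) else ra s aKEY l) ->
    tri set_leaf s2 12 (fun s' => [/\
    exists ne al be, arc_spec (rv s xd) (rel_ctr s h) ne al be /\
      leaf_ok s' h ne al be (if ne then 0 else 2)%N,
    only_at (h * nv s vW) 2 s s' &
    forall l, l != h -> [/\ ra s' aKEY l = ra s aKEY l, ra s' aBE l = ra s aBE l,
      na s' aTYP l = na s aTYP l & na s' aEV l = na s aEV l]]).
  move=> q1 q2 q3 q4 q5 q6 q7.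
  apply: tri_weak (set_leaf_ok s2) _ _ => // s3 [fn3 _ fa3 fra3 _].
  rewrite q1 q2 => -[k1 k2]; split.
  - exists ne, (rv s1 xal), (rv s1 xbe); split=> //.
    have et : na s3 aTYP h = ph by rewrite fa3 // q4 eqxx.
    split=> //.
    + by rewrite et.
    + by rewrite fa3 // q5 eqxx.
    + by rewrite fn3 // q2 et; rewrite q4 eqxx in k2.
    + split; first by case: (ne).
      * by case: (ne).
      * by rewrite fra3 // q6 eqxx.
      * by rewrite fra3 // q7 eqxx; case: (ne).
  - by move=> A j hA hj; rewrite k1 // q3.
  - by move=> l /negbTE hl; rewrite !fra3 // !fa3 // q4 q5 q6 q7 hl.
do 3 step; rewrite eh in ek ek0 ek1; subst k k0 k1; step.
- rewrite -/ph in hc; do 2 step; rewrite ?eh in ek ek0 ev0; subst.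
  have nef : ne = false by rewrite /ne; lia.
  apply: tri_weak (main _ _ _ _ _ _ _ _) _ _ => //; rewrite /= ?fupdE //= => l;
    rewrite ?fupdE ?fa1 ?fra1 ?nef //.
    by move=> hA; rewrite !ifN //; lia.
  by case: eqP.
- rewrite -/ph in hc; step; rewrite ?eh in ek ev0; subst.
  have net : ne = true by rewrite /ne; lia.
  apply: tri_weak (main _ _ _ _ _ _ _ _) _ _ => //; rewrite /= ?fupdE //= => l;
    rewrite ?fupdE ?fa1 ?fra1 ?net //.
  by move=> hA; rewrite !ifN //; lia.
Qed.

Lemma prep_ok s a k : let NL := (2 ^ (a + a + k))%N in tabs s a k -> 0 < rv s xd ->
  tri prep s (1 + NL * 47) (fun s' =>
    exists (ne : nat -> bool) (al be : nat -> R),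
    forall l, (NL <= l < 2 * NL)%N ->
      arc_spec (rv s xd) (rel_ctr s l) (ne l) (al l) (be l) /\
      leaf_ok s' l (ne l) (al l) (be l) (if ne l then 0 else 2)%N).
Proof.
move=> NL t d0.
pose good s' l := exists (ne : bool) (al be : R),
  arc_spec (rv s xd) (rel_ctr s l) ne al be /\ leaf_ok s' l ne al be (if ne then 0 else 2)%N.
pose I i s' := forall l, (NL <= l < NL + i)%N -> good s' l.
apply: (tri_for_cst (Tb := 46) (I := I)).
- by [].
- by move=> l; lia.
- move=> i s'; rewrite /= (tb_NL t) -/NL => hi hI hF.
  have [fn fr fa fra _] := hF.
  have t' : tabs s' a k by apply: tabs_same t; exact: frame_same_tabs hF _ _.
  step; rewrite (tb_NL t') -/NL in ev; set s1 := setn _ _ _.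
  have e1 : nv s1 vh = v by rewrite /= fupd_eq.
  have d1 : 0 < rv s1 xd by rewrite /= fr.
  apply: tri_weak (leaf_init_ok d1) _ _ => // s2 hF2; rewrite e1 => -[h1 h2 h3] l hl.
  have er l' : rel_ctr s1 l' = rel_ctr s l'.
    by rewrite /rel_ctr /ctr /ctr0 /= !fra ?fr.
  have ed : rv s1 xd = rv s xd by rewrite /= fr.
  have w2 : nv s2 vW = nv s1 vW by case: hF2 => [-> //].
  have W1 : nv s1 vW = (2 ^ a + 2 ^ a)%N := tb_W t'.
  case: (eqVneq l v) => [->|nl].
    case: h1 => ne [al [be [k1 k2]]]; exists ne, al, be.
    by rewrite -ed -er.
  have [ne [al [be [k1 k2]]]] := hI l ltac:(lia); exists ne, al, be; split=> //.
  have [b1 b2 b3 b4] := h3 l nl; have [c1 c2 c3 c4] := k2.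
  rewrite /leaf_ok b1 b2 b3 b4; split=> //.
  have w' : nv s1 vW = nv s' vW by [].
  rewrite w2; apply: (nrep_keep _ h2 _ nl _).1; rewrite ?W1; try by have := exp2_gt0 a; lia.
  by rewrite -W1 w'.
- move=> s' _; rewrite /= (tb_NL t) -/NL => hI.
  have ch l : exists x : bool * R * R, (NL <= l < 2 * NL)%N ->
      arc_spec (rv s xd) (rel_ctr s l) x.1.1 x.1.2 x.2 /\
      leaf_ok s' l x.1.1 x.1.2 x.2 (if x.1.1 then 0 else 2)%N.
    case: (boolP (NL <= l < 2 * NL)%N) => hl; last by exists (true, 0, 0).
    have [ne [al [be h]]] := hI l ltac:(lia); by exists (ne, al, be).
  have [f hf] := choice ch.
  by exists (fun l => (f l).1.1), (fun l => (f l).1.2), (fun l => (f l).2).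
- by rewrite /= (tb_NL t) -/NL; lia.
Qed.
End Arc.

Definition query_code : com :=
  If (BN (NA aLO (NAdd (NV vW) (NSub (NV vM) (NC 1)))) (NC 1))
   (If (BN (NC 0) (NA aHI (NAdd (NV vW) (NSub (NV vM) (NC 1)))))
     (If (BN (NC 0) (NA aTYP (NSub (NMul (NC 2) (NV vNL)) (NC 1))))
       (If (BN (NA aTYP (NSub (NMul (NC 2) (NV vNL)) (NC 1))) (NC 2))
          (SetN vout (NC 1)) Skip) Skip) Skip) Skip.

Definition advance : com :=
  SetN vh (NA aEV (NC 1));; SetN vph (NA aTYP (NV vh));;
  If (BN (NC 0) (NV vph))
   (If (BN (NV vph) (NC 2)) (StoN aTYP (NV vh) (NC 2);; StoR aKEY (NV vh) (RC 2)) Skip)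
   (StoN aTYP (NV vh) (NC 1);; StoR aKEY (NV vh) (RA aBE (NV vh))).

(** Each leaf has at most two events, so [2 * NL] rounds exhaust them; a surplus round selects an
    exhausted leaf and changes no phase. *)
Definition sweep : com :=
  For vq (NMul (NC 2) (NV vNL)) (advance;; set_leaf;; climb;; query_code).

(** * The order of insertions and removals *)

Section Events.
Variables (R : realType) (NL : nat) (ne : nat -> bool) (al be : nat -> R).
Let leaf l := (NL <= l < 2 * NL)%N.
Hypothesis arcs : forall l, leaf l -> ne l -> [/\ -1 <= al l, al l <= be l & be l <= 1].
Implicit Types (ph : nat -> nat).

(** At equal parameters an insertion precedes a removal. Disks are closed, so two arcs that share
    one end point only must be active together at some moment. *)
Definition evle (x : R) (i : nat) y (j : nat) := (x < y) || ((x == y) && (i <= j)%N).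

Lemma evle_trans x i y j z l : evle x i y j -> evle y j z l -> evle x i z l.
Proof.
case/orP => [h1|/andP[/eqP -> h1]]; case/orP => [h2|/andP[/eqP <- h2]]; rewrite /evle.
- by rewrite (lt_trans h1 h2).
- by rewrite h1.
- by rewrite h2.
- by rewrite eqxx (leq_trans h1 h2) orbT.
Qed.

Definition key ph l := if ph l == 0%N then al l else if ph l == 1%N then be l else 2.

(* Processed events precede pending ones; phase p means that p events of the
   leaf, the insertion at [al] and the removal at [be], are processed. *)
Definition ordered ph := forall l l', leaf l -> leaf l' -> ne l ->
  ((0 < ph l)%N -> evle (al l) 0 (key ph l') (ph l')) /\
  ((1 < ph l)%N -> evle (be l) 1 (key ph l') (ph l')).

Definition bump ph l0 := fupd ph l0 (minn (ph l0).+1 2).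

Lemma key_bump ph l0 l : leaf l0 -> (ph l0 <> 2 -> ne l0) -> (ph l0 <= 2)%N ->
  evle (key ph l) (ph l) (key (bump ph l0) l) (bump ph l0 l).
Proof.
move=> hl hne h2; rewrite /key /bump fupdE; case: (eqVneq l l0) => [->|_]; last first.
  by rewrite /evle eqxx leqnn orbT.
case e : (ph l0) h2 => [|[|[|?]]] // _; rewrite /evle /=.
- have [_ h _] := arcs hl (hne ltac:(by rewrite e)).
  by rewrite andbT orbC -le_eqVlt.
- have [_ _ h] := arcs hl (hne ltac:(by rewrite e)).
  by rewrite (le_lt_trans h) //; lra.
- by rewrite ?eqxx ?orbT.
Qed.

Lemma ordered_bump ph l0 : leaf l0 -> (forall l, leaf l -> ph l <> 2 -> ne l) ->
  (forall l, leaf l -> ph l <= 2)%N ->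
  (forall l, leaf l -> evle (key ph l0) (ph l0) (key ph l) (ph l)) ->
  ordered ph -> ordered (bump ph l0).
Proof.
move=> h0 hne h2 hmin ho l l' hl hl' nel.
have up := key_bump l' h0 (hne _ h0) (h2 _ h0).
have [w1 w3] := ho l l' hl hl' nel.
split; rewrite {1}/bump fupdE; case: eqP => [e|_].
- subst l; move=> _; apply: evle_trans up.
  case e0 : (ph l0) => [|p]; last by apply: w1; rewrite e0.
  by have := hmin l' hl'; rewrite {1}/key e0.
- by move=> h; apply: evle_trans up; exact: w1.
- subst l; move=> hlt; apply: evle_trans up.
  case e0 : (ph l0) hlt => [|[|p]] //= _; last by apply: w3; rewrite e0.
  by have := hmin l' hl'; rewrite {1}/key e0.
- by move=> h; apply: evle_trans up; exact: w3.
Qed.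

Definition inside x l := ne l && (al l <= x <= be l).

(** Soundness of the sweep: take the latest insertion among the active arcs. It is processed and
    every removal of an active arc is pending, so it precedes all of them and lies in all active
    arcs. *)
Lemma active_point ph l1 : leaf l1 -> ph l1 = 1%N ->
  (forall l, leaf l -> ph l <> 2 -> ne l) -> ordered ph ->
  exists2 x, -1 <= x <= 1 & forall l, leaf l -> ph l = 1%N -> inside x l.
Proof.
move=> hl1 h1 hne ho.
pose A := [seq l <- iota NL NL | ph l == 1%N].
have memA l : (l \in A) = (ph l == 1%N) && leaf l.
  by rewrite mem_filter mem_iota /leaf; congr (_ && _); lia.
have hA1 : l1 \in A by rewrite memA h1 hl1.
have [m hm hmin] := seq_min (fun l => - al l) hA1.
rewrite memA in hm; have /andP[/eqP m1 ml] := hm.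
have nem : ne m by apply: hne; rewrite // m1.
have [b1 b2 b3] := arcs ml nem.
exists (al m); first by rewrite b1 (le_trans b2 b3).
move=> l hl hl1'; have nel : ne l by apply: hne; rewrite // hl1'.
rewrite /inside nel /=; apply/andP; split.
  by have := hmin l; rewrite memA hl1' hl lerN2; apply.
have [ + _] := ho m l ml hl nem; rewrite m1 /key hl1' /= => /(_ isT).
by rewrite /evle /= andbT orbC -le_eqVlt.
Qed.

(** Completeness of the sweep: consider the moment when the last arc containing x is inserted. If
    another such arc were already removed, its right end would lie strictly before the left end of
    the new one, because ties favour insertions; yet x lies between them. *)
Lemma bump_complete ph l0 x : leaf l0 -> (forall l, leaf l -> ph l <> 2 -> ne l) ->
  ordered ph -> (exists2 l, leaf l & inside x l /\ ph l = 0%N) ->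
  (exists2 l, leaf l & inside x l /\ bump ph l0 l = 0%N) \/
  (forall l, leaf l -> inside x l -> bump ph l0 l = 1%N).
Proof.
move=> h0 hne ho [l1 hl1 [i1 p1]].
case: (pselect (exists2 l, leaf l & inside x l /\ bump ph l0 l = 0%N)) => [|no]; first by left.
right.
have e1 : l1 = l0.
  apply/eqP/negPn/negP => ne1; apply: no; exists l1 => //; split=> //.
  by rewrite /bump fupdE (negbTE ne1).
subst l1; move=> l hl il.
have nz : bump ph l0 l <> 0%N by move=> z; apply: no; exists l.
move: nz; rewrite /bump fupdE; case: eqP => [_|nl nz]; first by rewrite p1.
case: (ltngtP (ph l) 1) => [|h|//]; first by case: (ph l) nz.
have nel : ne l by case/andP: il.
have [_ /(_ h)] := ho l l0 hl h0 nel; rewrite /key p1 /= /evle /= andbF orbF => lt.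
case/and3P: il => _ _ i2; case/and3P: i1 => _ i3 _.
by have := lt_le_trans lt (le_trans i3 i2); rewrite ltxx.
Qed.
End Events.

Lemma grid_path_mono (F F' : nat * nat -> bool) m n : (forall ij, F ij -> F' ij) ->
  grid_path F m n -> grid_path F' m n.
Proof.
move=> h [p /and3P[h1 h2 h3]]; exists p; rewrite h1 h3 andbT /=.
by move: h2; rewrite /= => /andP[/h -> /=]; exact: sub_all.
Qed.

(** * Correctness of the sweep of one circle *)

Section Sweep.
Variable R : realType.
Implicit Types (s : st R).

Lemma cell_on_mono s a k (sg sg' : nat -> bool) :
  (forall l, (2 ^ (a + a + k) <= l < 2 * 2 ^ (a + a + k))%N -> sg l -> sg' l) ->
  forall ij, cell_on s a k sg ij -> cell_on s a k sg' ij.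
Proof.
move=> h ij /existsP[l /and3P[h1 h2 h3]]; apply/existsP; exists l.
by rewrite h1 h2 h //; have := ltn_ord l; lia.
Qed.

Lemma cell_on_same s s' a k sg : same_tabs s s' -> cell_on s' a k sg =1 cell_on s a k sg.
Proof. by case=> _ h ij; rewrite /cell_on /row /col !h. Qed.

Lemma query_code_ok s a k : (0 < a)%N -> tabs s a k ->
  tri query_code s 5 (fun s' => nv s' vout =
    if query s a k (fun l => na s aTYP l == 1%N) then 1%N else nv s vout).
Proof.
move=> a0 t; rewrite /query_code /query.
have M0 := exp2_gt0 a; have N0 := exp2_gt0 (a + a + k).
have e1 : (nv s vW + (nv s vM - 1) = nv s vW + (2 ^ a - 1))%N by rewrite (tb_M t).
have e2 : (2 * nv s vNL - 1 = 2 * 2 ^ (a + a + k) - 1)%N by rewrite (tb_NL t).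
step; try (rewrite (tb_M t); lia).
- rewrite e1 in hc; step; try (rewrite (tb_M t); lia).
  + rewrite e1 in hc0; step; try (rewrite (tb_NL t); lia).
    * rewrite e2 in hc1; step; try (rewrite (tb_NL t); lia).
      - rewrite e2 in hc2; steps; rewrite /= fupd_eq ev ifT //.
        apply/and3P; split=> //; lia.
      - rewrite e2 in hc2; steps; rewrite ifF //.
        apply/negbTE/negP => /and3P[_ _ h]; lia.
    * rewrite e2 in hc1; steps; rewrite ifF //.
      apply/negbTE/negP => /and3P[_ _ h]; lia.
  + rewrite e1 in hc0; steps; rewrite ifF //.
    apply/negbTE/negP => /and3P[_ h _]; lia.
- rewrite e1 in hc; steps; rewrite ifF //.
  apply/negbTE/negP => /and3P[h _ _]; lia.
Qed.
Lemma root_min s a k : (0 < a)%N -> let NL := (2 ^ (a + a + k))%N in tabs s a k ->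
  (forall h, (0 < h < NL)%N -> node_ok s h) ->
  (forall l, (NL <= l < 2 * NL)%N -> na s aEV l = l) ->
  (NL <= na s aEV 1 < 2 * NL)%N /\
  (forall l, (NL <= l < 2 * NL)%N -> key_le s (na s aEV 1) l).
Proof.
move=> a0 NL t hn hev; have N0 : (0 < NL)%N := exp2_gt0 _.
have top h : (0 < h < 2 * NL)%N -> key_le s 1 h.
  move: h; apply: (node_ind a0 (k := k)).
    by rewrite /key_le eqxx leqnn orbT.
  move=> h hh hk; have [_ [c [hc e1 e2 e3 [k1 k2]]]] := hn h hh.
  by split; apply: evle_trans hk _; rewrite /evle e1 e2.
have ev n h : (0 < h < 2 * NL)%N -> (2 * NL - h <= n)%N ->
  [/\ (NL <= na s aEV h < 2 * NL)%N, ra s aKEY (na s aEV h) = ra s aKEY h &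
      na s aTYP (na s aEV h) = na s aTYP h].
  elim: n h => [|n IH] h hh hle; first by lia.
  case: (ltnP h NL) => hlt; last first.
    have hl : (NL <= h < 2 * NL)%N by lia.
    by rewrite !hev.
  have [_ [c [hc -> -> -> _]]] := hn h ltac:(lia).
  by apply: IH; case: hc => ->; lia.
have [e1 e2 e3] := ev (2 * NL)%N 1%N ltac:(lia) ltac:(lia).
split=> // l hl; have := top l ltac:(lia).
by rewrite /key_le e2 e3.
Qed.

Lemma advance_ok s : (na s aTYP (na s aEV 1) <= 2)%N ->
  let l0 := na s aEV 1 in tri advance s 6 (fun s' => [/\ nv s' vh = l0,
    forall j, na s' aTYP j = bump (na s aTYP) l0 j &
    forall j, ra s' aKEY j = if j == l0 then
      (if na s aTYP l0 == 0%N then ra s aBE l0 else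
       if na s aTYP l0 == 1%N then 2 else ra s aKEY l0) else ra s aKEY j]).
Proof.
move=> h2 l0; rewrite /advance; do 2 step; rewrite -/l0 in ev ev0 h2; subst v v0.
step; first step; steps; rewrite /= ?fupdE /= ?fupdE /=.
- subst; have e : na s aTYP l0 = 1%N by lia.
  by split=> // j; rewrite ?fupdE /bump ?fupdE e //=; case: eqP.
- have e : na s aTYP l0 = 2%N by lia.
  split=> // j; rewrite /bump ?fupdE e //=.
    by case: eqP => [->|//]; rewrite e.
  by case: eqP => [->|//].
- subst; have e : na s aTYP l0 = 0%N by lia.
  by split=> // j; rewrite ?fupdE /bump ?fupdE e //=; case: eqP.
Qed.

Section Circle.
Variables (s : st R) (a k : nat) (ne : nat -> bool) (al be : nat -> R).
Let NL := (2 ^ (a + a + k))%N.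
Let leaf l := (NL <= l < 2 * NL)%N.
Hypothesis a0 : (0 < a)%N.
Hypothesis t : tabs s a k.
Hypothesis arcs : forall l, leaf l -> ne l -> [/\ -1 <= al l, al l <= be l & be l <= 1].

Definition hit (x : R) := grid_path (cell_on s a k (inside ne al be x))
  (2 ^ a).-1 (2 ^ (a + k)).-1.

(** The output flag accumulates over the circles, hence its clauses refer to its value at the start.
    A parameter whose path has not been reported still has a waiting arc. The last clause counts
    processed events, so that nothing is waiting in the end. *)
Definition sweep_inv i s' := [/\
  forall l, leaf l -> leaf_ok s' l (ne l) (al l) (be l) (na s' aTYP l),
  forall h, (0 < h < NL)%N -> node_ok s' h,
  ordered NL ne al be (na s' aTYP),
  [/\ nv s' vout != 0%N -> nv s vout != 0%N \/ exists2 x, -1 <= x <= 1 & hit x,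
      nv s vout != 0%N -> nv s' vout != 0%N &
      forall x, -1 <= x <= 1 -> hit x -> nv s' vout != 0%N \/
        (exists2 l, leaf l & inside ne al be x l /\ na s' aTYP l = 0%N)] &
  (i <= \sum_(j < NL) na s' aTYP (NL + j))%N \/ (forall l, leaf l -> na s' aTYP l = 2)].

Lemma ordered_eq ph ph' : (forall l, leaf l -> ph l = ph' l) ->
  ordered NL ne al be ph -> ordered NL ne al be ph'.
Proof.
by move=> e h l l' hl hl' nel; have := h l l' hl hl' nel; rewrite /key !e.
Qed.

Lemma sweep_step i s' : same_tabs s s' -> sweep_inv i s' ->
  tri (advance;; set_leaf;; climb;; query_code) s' (23 + climb_cost a k)
    (sweep_inv i.+1).
Proof.
move=> st [il inode iord [i1 i2 i3] icnt].
have t' := tabs_same st t; have W' := tb_W t'.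
have M0 := exp2_gt0 a.
have ev l : leaf l -> na s' aEV l = l by move=> /il [].
have [hl0 hmin] := root_min a0 t' inode ev.
set l0 := na s' aEV 1 in hl0 hmin.
have ph2 l : leaf l -> (na s' aTYP l <= 2)%N by move=> /il [_ _ _ []].
have phne l : leaf l -> na s' aTYP l <> 2 -> ne l by move=> /il [_ _ _ []].
have phkey l : leaf l -> ra s' aKEY l = key al be (na s' aTYP) l.
  by move=> /il [_ _ _ []].
apply: (tri_seq (T2 := 17 + climb_cost a k) (advance_ok (ph2 _ hl0))); last by lia.
rewrite -/l0 => s2 hF2 [v2 ty2 ky2]; have [fn2 fr2 fa2 fra2 _] := hF2.
apply: (tri_seq (T2 := 5 + climb_cost a k) (set_leaf_ok s2)); last by lia.
move=> s3 hF3; have [fn3 fr3 fa3 fra3 _] := hF3.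
have W2 : nv s2 vW = nv s' vW by rewrite fn2.
rewrite v2 W2 => -[k1 k2].
have st3 : same_tabs s' s3.
  by apply: same_tabs_trans (frame_same_tabs hF2 _ _) (frame_same_tabs hF3 _ _).
have t3 := tabs_same st3 t'.
have at3 : only_at (l0 * nv s' vW) 2 s' s3.
  move=> A j hA hj; rewrite k1 // fa2 //.
  by case: A hA => [|[|[|[|]]]].
have sk3 : same_keys (fun j => j != l0) s' s3.
  move=> j /negbTE hj; rewrite !fra3 // !fa3 // ty2 ky2 hj /bump fupdE hj.
  by rewrite fa2.
have v3 : nv s3 vh = l0 by rewrite fn3.
have nodes3 h : (0 < h < NL)%N -> h != (nv s3 vh)./2 -> node_ok s3 h.
  move=> hh; rewrite v3 => hne.
  apply: (node_keep t' st3 at3 _ sk3 _ hh (inode _ hh)); first by rewrite W'; lia.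
  have := odd_double_half l0; move: hl0 hne; rewrite !inE !negb_or -/NL.
  by case: (odd l0) => /=; lia.
have hl3 : (NL <= nv s3 vh < 2 * NL)%N by rewrite v3.
apply: (tri_seq (T2 := 5) (climb_ok t3 hl3 nodes3)); last by lia.
rewrite -/NL => s4 hF4 [nodes4 same4]; have [fn4 fr4 fa4 fra4 _] := hF4.
have st4 : same_tabs s3 s4 by exact: frame_same_tabs hF4 _ _.
have t4 := tabs_same st4 t3.
apply: tri_weak (query_code_ok a0 t4) _ _ => // s5 hF5 out5.
have [fn5 fr5 fa5 fra5 _] := hF5.
have n5 A : na s5 A = na s4 A by rewrite fa5.
pose ph := bump (na s' aTYP) l0.
have ty4 l : leaf l -> na s4 aTYP l = ph l.
  by case/andP => hl _; have [_ [_ -> _]] := same4 l hl; rewrite fa3 // ty2.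
have W3 : nv s3 vW = nv s' vW by case: st3 => [-> //].
have W5 : nv s5 vW = nv s' vW by rewrite fn5 // fn4.
have key4 l : leaf l -> ra s4 aKEY l = key al be ph l.
  case/andP => hl hl'; have [_ [-> _ _]] := same4 l hl; rewrite fra3 // ky2.
  rewrite /key /ph /bump fupdE; case: (eqVneq l l0) => [->|nl].
    have [_ _ _ [_ hne hbe hk]] := il _ hl0; have h2 := ph2 _ hl0.
    case e0 : (na s' aTYP l0) h2 => [|[|[|?]]] //= _.
      by apply: hbe; apply: hne; rewrite e0.
    by rewrite hk e0.
  by rewrite phkey // /leaf hl hl'.
have BE4 l : ra s4 aBE l = ra s' aBE l by rewrite fra4 // fra3 // fra2.
have leaves4 l : leaf l -> leaf_ok s5 l (ne l) (al l) (be l) (na s5 aTYP l).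
  move=> hl; have hl1 : (NL <= l)%N by case/andP: hl.
  have [same_rel [_ _ sev]] := same4 l hl1.
  have [_ p1 p2 [p3 p4 p5 p6]] := il l hl.
  split=> //.
  - by rewrite n5 sev fa3 // fa2.
  - rewrite n5 ty4 // W5.
    have rel3 : nrep 2 s3 0 (l * nv s' vW) (cell_rel (ph l == 1)%N).
      case: (eqVneq l l0) => [->|nl]; first by rewrite /ph -ty2.
      rewrite /ph /bump fupdE (negbTE nl).
      by apply: (nrep_keep _ at3 _ nl _).1 p2; rewrite W'; lia.
    by apply: nrep_ext rel3 => // x hx; rewrite !n5 -W3 !same_rel.
  - have e5 : na s5 aTYP l = ph l by rewrite n5 ty4.
    rewrite e5; split.
    + rewrite /ph /bump fupdE; case: eqP => _ //; exact: geq_minr.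
    + rewrite /ph /bump fupdE; case: eqP => [->|_] hp; last exact: p4.
      apply: phne => // h2; apply: hp; by rewrite h2.
    + by rewrite fra5 // BE4.
    + by rewrite fra5 // key4.
have o5 l : leaf l -> ph l = na s5 aTYP l by move=> hl; rewrite n5 ty4.
have hmin' l : leaf l -> evle (key al be (na s' aTYP) l0) (na s' aTYP l0)
    (key al be (na s' aTYP) l) (na s' aTYP l).
  by move=> hl; have := hmin l hl; rewrite /key_le !phkey.
have ord5 : ordered NL ne al be ph by exact: (ordered_bump arcs hl0 phne ph2 hmin' iord).
have s04 : same_tabs s s4.
  exact: same_tabs_trans st (same_tabs_trans st3 st4).
have out4 : nv s4 vout = nv s' vout by rewrite fn4 // fn3 // fn2.
rewrite out4 in out5.
have qp : query s4 a k (fun l => na s4 aTYP l == 1%N) <->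
    grid_path (cell_on s a k (fun l => ph l == 1)%N) (2 ^ a).-1 (2 ^ (a + k)).-1.
  have q := query_path a0 t4 (sigma := fun l => na s4 aTYP l == 1%N) nodes4 _.
  rewrite q; last first.
    move=> l hl; have [_ _ h _] := leaves4 l hl; move: h; rewrite n5 W5.
    have -> : nv s4 vW = nv s' vW by rewrite fn4.
    by apply: nrep_ext => // x hx; rewrite !n5.
  split; apply: grid_path_mono => ij.
    rewrite (cell_on_same _ _ _ s04); apply: cell_on_mono => l hl.
    by rewrite ty4.
  rewrite (cell_on_same _ _ _ s04); apply: cell_on_mono => l hl.
  by rewrite ty4.
have phne' l : leaf l -> ph l <> 2 -> ne l.
  by move=> hl; rewrite o5 //; have [_ _ _ []] := leaves4 l hl.
split.
- exact: leaves4.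
- move=> h hh; have [r1 r2] := nodes4 h hh; split.
    by move: r1; rewrite /rel_ok /nrep !n5 !fn5.
  case: r2 => c hc; exists c; move: hc; rewrite /key_le !n5 !fra5 //.
- by apply: ordered_eq ord5.
- split.
  + rewrite out5; case: ifP => [/qp hq _|_ h]; last exact: i1.
    right.
    (* Every path contains the cell (0, 0), so at least one arc is active. *)
    have [l1 hl1 p1] : exists2 l, leaf l & ph l = 1%N.
      have /grid_path_ports [_ _] := hq.
      case: hq => p /and3P[_ /= /andP[/existsP[x /and3P[_ _ /eqP hx]] _] _].
      by exists (NL + x)%N => //; rewrite /leaf; have := ltn_ord x; rewrite -/NL; lia.
    have [x hx hin] := active_point arcs hl1 p1 phne' ord5.
    exists x => //; apply: grid_path_mono hq => ij; apply: cell_on_mono => l hl /eqP.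
    exact: hin.
  + by move=> h; rewrite out5; case: ifP => // _; apply: i2.
  + move=> x hx hg; rewrite out5; case: (i3 x hx hg) => [h|ex].
      by left; case: ifP.
    have [[l hl [l1 l2]]|all1] := bump_complete hl0 phne iord ex.
      by right; exists l => //; split=> //; rewrite -o5.
    left; rewrite (qp.2 _) //; apply: grid_path_mono hg => ij.
    by apply: cell_on_mono => l hl il'; apply/eqP; apply: all1.
- have hx0 : (l0 - NL < NL)%N by move: hl0; rewrite -/NL; lia.
  have e0 : (NL + Ordinal hx0 = l0)%N by rewrite /= subnKC //; case/andP: hl0.
  have sum5 : (\sum_(j < NL) na s5 aTYP (NL + j) =
     \sum_(j < NL) ph (NL + j))%N.
    by apply: eq_bigr => j _; rewrite -o5 // /leaf; have := ltn_ord j; lia.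
  rewrite sum5.
  case: icnt => [icnt|all2]; last first.
    right=> l hl; rewrite -o5 // /ph /bump fupdE !all2 //.
    by case: eqP.
  case: (ltnP (na s' aTYP l0) 2) => hlt.
    left; move: icnt; rewrite (bigD1 (Ordinal hx0)) //= [X in (i < X)%N](bigD1 (Ordinal hx0)) //=.
    rewrite subnKC; last by case/andP: hl0.
    have -> : ph l0 = (na s' aTYP l0).+1.
      by rewrite /ph /bump fupd_eq; apply/minn_idPl.
    rewrite addSn ltnS => h; apply: leq_trans h _; rewrite leq_add2l.
    apply: leq_sum => j hj; rewrite /ph /bump fupdE ifN //.
    by apply: contra hj => /eqP e1; apply/eqP/val_inj => /=; lia.
  (* The least event has the key 2, while an unfinished leaf has a key of at most 1; so all leaves
     are finished. *)
  have e2 : na s' aTYP l0 = 2%N by have := ph2 _ hl0; lia.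
  right=> l hl; rewrite -o5 //.
  have := hmin' l hl; rewrite /key e2 /= /evle.
  have hk : forall l, leaf l -> na s' aTYP l <> 2 -> key al be (na s' aTYP) l < 2.
    move=> l' hl' n2; have nel := phne l' hl' n2; have [b1 b2 b3] := arcs hl' nel.
    have := ph2 l' hl'; rewrite /key; case: (na s' aTYP l') n2 => [|[|[|?]]] //= _ _; lra.
  case: (eqVneq (na s' aTYP l) 2) => [e3 _|/eqP n3].
    by rewrite /ph /bump fupdE e2 e3; case: eqP.
  have lt := hk l hl n3; rewrite /key in lt.
  case/orP => [h|/andP[/eqP h _]]; first by have := lt_trans lt h; rewrite ltxx.
  by rewrite -h ltxx in lt.
Qed.

Lemma sweep_ok :
  (forall l, leaf l -> leaf_ok s l (ne l) (al l) (be l) (if ne l then 0 else 2)%N) ->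
  (forall h, (0 < h < NL)%N -> node_ok s h) ->
  tri sweep s (1 + 2 * NL * (24 + climb_cost a k)) (fun s' =>
    nv s' vout != 0%N <-> nv s vout != 0%N \/ exists2 x, -1 <= x <= 1 & hit x).
Proof.
move=> hl hn.
have ph0 l : leaf l -> na s aTYP l = (if ne l then 0 else 2)%N by move=> /hl [].
apply: (tri_for_cst (Tb := (23 + climb_cost a k)%N) (I := sweep_inv)).
- by [].
- split=> //.
  + by move=> l hl'; rewrite ph0 //; exact: hl.
  + by move=> l l' hl' _ nel; rewrite ph0 // nel.
  + split=> //; first by left.
    (* Before the sweep every nonempty arc is waiting, in particular that of the cell (0, 0) on the
       path. *)
    move=> x hx [p /and3P[_ /= /andP[/existsP[j /and3P[_ _ hj]] _] _]]; right.
    have lj : leaf (NL + j) by rewrite /leaf; have := ltn_ord j; rewrite -/NL; lia.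
    exists (NL + j)%N => //; split=> //.
    by rewrite ph0 //; case/andP: hj => ->.
  + by left.
- move=> i s' _ hI hF; have st := frame_same_tabs hF isT isT.
  have hI' : sweep_inv i (setn s' vq i) by exact: hI.
  apply: sweep_step hI'; apply: same_tabs_trans st _; split=> // x.
  by rewrite !inE => /or4P[/eqP->|/eqP->|/eqP->|/orP[]/eqP->].
- move=> s' _; rewrite /= (tb_NL t) -/NL => -[il _ _ [i1 i2 i3] icnt] /=.
  have all2 l : leaf l -> na s' aTYP l = 2%N.
    case: icnt => [icnt hl'|]; last exact.
    have [_ _ _ [h2 _ _ _]] := il l hl'.
    have lj : (l - NL < NL)%N by move: hl'; rewrite /leaf; lia.
    have ej : (NL + Ordinal lj = l)%N by rewrite /= subnKC //; case/andP: hl'.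
    move: icnt; rewrite (bigD1 (Ordinal lj)) //= subnKC; last by case/andP: hl'.
    have : (\sum_(j < NL | j != Ordinal lj) na s' aTYP (NL + j) <=
            \sum_(j < NL | j != Ordinal lj) 2)%N.
      apply: leq_sum => j _; have lj' : leaf (NL + j).
        by rewrite /leaf; have := ltn_ord j; rewrite -/NL; lia.
      by have [_ _ _ []] := il _ lj'.
    rewrite sum_nat_const cardC1 card_ord.
    set S := (\sum_(_ < _ | _) _)%N; lia.
  split=> [/i1 //|[/i2 //|[x hx hg]]].
  case: (i3 x hx hg) => // -[l hl' [_ e]].
  by rewrite all2 in e.
- by rewrite /= (tb_NL t) -/NL; lia.
Qed.
End Circle.
End Sweep.

Definition circle : com :=
  SetR xx0 (RA aCX (NAdd (NV vNL) (NV vc)));;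
  SetR xy0 (RA aCY (NAdd (NV vNL) (NV vc)));;
  prep;; build;; sweep.

Definition all_circles : com := For vc (NV vNL) circle.

Definition circle_cost a k := let NL := (2 ^ (a + a + k))%N in
  (5 + NL * (101 + 220 * 2 ^ a) + 2 * NL * (24 + climb_cost a k))%N.

(** * From one circle to all circles *)

Section Circles.
Variable R : realType.
Implicit Types (s : st R).

Definition on_circle s a k c0 x := grid_path
  (cell_on s a k (fun l => in_disk (rv s xd) (ctr s l) (circ (rv s xd) c0 x)))
  (2 ^ a).-1 (2 ^ (a + k)).-1.

Lemma circle_ok s a k : (0 < a)%N -> tabs s a k -> 0 < rv s xd ->
  let NL := (2 ^ (a + a + k))%N in
  tri circle s (circle_cost a k) (fun s' => nv s' vout != 0%N <-> nv s vout != 0%N \/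
    exists2 x, -1 <= x <= 1 & on_circle s a k (ctr s (NL + nv s vc)) x).
Proof.
move=> a0 t d0 NL; pose T := (1 + 2 * NL * (24 + climb_cost a k))%N.
pose T0 := ((1 + NL * 47) + ((1 + NL * (54 + 220 * 2 ^ a)) + T))%N.
have -> : circle_cost a k = T0.+2.
  by rewrite /circle_cost /T0 /T -/NL; move: (climb_cost a k) => c; lia.
rewrite /circle; do 2 step; rewrite (tb_NL t) -/NL in ex ex0.
set s1 := setr _ _ _.
have t1 : tabs s1 a k by apply: tabs_same t.
have d1 : rv s1 xd = rv s xd by [].
suff h : tri (prep;; build;; sweep) s1 T0 (fun s' => nv s' vout != 0%N <->
    nv s1 vout != 0%N \/ exists2 x, -1 <= x <= 1 & on_circle s a k (ctr s (NL + nv s vc)) x).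
  exact: h.
have d1' : 0 < rv s1 xd by rewrite d1.
refine (tri_seq (prep_ok t1 d1') _ (leqnn _)).
move=> s2 hF2 [ne [al [be hl2]]]; have [fn2 fr2 fa2 fra2 _] := hF2.
have st2 : same_tabs s1 s2 by exact: frame_same_tabs hF2 _ _.
have t2 := tabs_same st2 t1.
refine (tri_seq (build_ok t2) _ (leqnn _)).
rewrite -/NL => s3 hF3 [nodes3 same3]; have [fn3 fr3 fa3 fra3 _] := hF3.
have st3 : same_tabs s2 s3 by exact: frame_same_tabs hF3 _ _.
have t3 := tabs_same st3 t2.
have arcs l : (NL <= l < 2 * NL)%N -> ne l -> [/\ -1 <= al l, al l <= be l & be l <= 1].
  by move=> hl nel; have [[_ h] _] := hl2 l hl; exact: h.
have leaves3 l : (NL <= l < 2 * NL)%N ->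
    leaf_ok s3 l (ne l) (al l) (be l) (if ne l then 0 else 2)%N.
  move=> hl; have [_ [p1 p2 p3 [p4 p5 p6 p7]]] := hl2 l hl.
  have [q1 [q2 q3 q4]] := same3 l ltac:(by case/andP: hl).
  split.
  - by rewrite q3.
  - by rewrite q4.
  - rewrite q3 (_ : nv s3 vW = nv s2 vW) ?fn3 //.
    by apply: nrep_ext p3 => // i hi; rewrite !q1.
  - by split=> //; [rewrite fra3|rewrite q2].
refine (tri_weak (sweep_ok a0 t3 arcs leaves3 nodes3) (leqnn _) _).
move=> s4 _ ->.
have out3 : nv s3 vout = nv s1 vout by rewrite fn3 // fn2.
have hitE y : -1 <= y <= 1 -> hit s3 a k ne al be y <->
    on_circle s a k (ctr s (NL + nv s vc)) y.
  move=> hx; have st : same_tabs s s3.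
    by apply: same_tabs_trans (same_tabs_trans st2 st3).
  have e l : (NL <= l < 2 * NL)%N -> inside ne al be y l <->
      in_disk (rv s xd) (ctr s l) (circ (rv s xd) (ctr s (NL + nv s vc)) y).
    move=> hl; have [[h _] _] := hl2 l hl; rewrite in_disk_circ /inside.
    have {h} := h y hx; rewrite d1.
    have -> : rel_ctr s1 l = ((ctr s l).1 - (ctr s (NL + nv s vc)%N).1,
        (ctr s l).2 - (ctr s (NL + nv s vc)%N).2).
      by rewrite /rel_ctr /ctr /ctr0 /= -ex -ex0.
    by move=> ->; split=> [/andP[]|[-> ->]].
  split; apply: grid_path_mono => ij; rewrite (cell_on_same _ _ _ st);
    by apply: cell_on_mono => l hl /(e l hl).
rewrite out3; split=> [[|[y hx h]]|[|[y hx h]]]; try by left.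
- by right; exists y => //; apply/hitE.
- by right; exists y => //; apply/hitE.
Qed.

Lemma all_circles_ok s a k : (0 < a)%N -> tabs s a k -> 0 < rv s xd ->
  nv s vout = 0%N -> let NL := (2 ^ (a + a + k))%N in
  tri all_circles s (1 + NL * (1 + circle_cost a k)) (fun s' => nv s' vout != 0%N <->
    exists2 l, (NL <= l < 2 * NL)%N &
    exists2 x, -1 <= x <= 1 & on_circle s a k (ctr s l) x).
Proof.
move=> a0 t d0 out0 NL.
pose I i s' := nv s' vout != 0%N <-> exists2 l, (NL <= l < NL + i)%N &
    exists2 x, -1 <= x <= 1 & on_circle s a k (ctr s l) x.
apply: (tri_for_cst (Tb := circle_cost a k) (I := I)).
- by [].
- by split=> [|[l]]; [rewrite out0|lia].
- move=> i s'; rewrite /= (tb_NL t) -/NL => hi hI hF.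
  have [fn fr fa fra _] := hF.
  set s1 := setn s' _ _.
  have st : same_tabs s s1.
    apply: same_tabs_trans (frame_same_tabs hF isT isT) _; split=> // x.
    by rewrite !inE => /or4P[/eqP->|/eqP->|/eqP->|/orP[]/eqP->].
  have t1 := tabs_same st t.
  have d1 : rv s1 xd = rv s xd by rewrite /= fr.
  apply: tri_weak (circle_ok a0 t1 _) _ _ => //; first by rewrite d1.
  rewrite -/NL => s2 _ h2; rewrite /I h2.
  have -> : nv s1 vc = i by rewrite /= fupd_eq.
  have ctrE l : ctr s1 l = ctr s l by rewrite /ctr /= !fra.
  have onE x : on_circle s1 a k (ctr s1 (NL + i)) x <-> on_circle s a k (ctr s (NL + i)) x.
    by split; apply: grid_path_mono => ij; rewrite (cell_on_same _ _ _ st);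
      apply: cell_on_mono => l _; rewrite d1 !ctrE.
  have -> : (nv s1 vout != 0%N) = (nv s' vout != 0%N) by [].
  split=> [[/hI [l hl ex]|[x hx /onE h]]|[l hl [x hx h]]].
  + by exists l => //; lia.
  + by exists (NL + i)%N; [lia|exists x].
  + case: (ltnP l (NL + i)) => hl'; last first.
      right; exists x => //; apply/onE; by have -> : (NL + i = l)%N by lia.
    by left; apply/hI; exists l; [lia|exists x].
- move=> s' _; rewrite /= (tb_NL t) -/NL /I => ->.
  by rewrite mul2n -addnn.
- by rewrite /= (tb_NL t) -/NL; lia.
Qed.
End Circles.

(** * Setting up the tables *)

(** Loops are bounded, so the search for a power of two runs for y rounds: a positive x grows in
    each round until it reaches y. *)
Definition double_up x y : com :=
  For vt (NV y) (If (BN (NV x) (NV y)) (SetN x (NAdd (NV x) (NV x))) Skip).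

(** M starts at 2, so that a > 0 and a leaf lies strictly below the level of the full square; still
    M <= 2m. N starts at M, so M divides N and the quotient is 2^k. *)
Definition sizes : com :=
  SetN vM (NC 2);; double_up vM vm;; SetN vN (NV vM);; double_up vN vn;;
  SetN vW (NAdd (NV vM) (NV vM));; SetN vNL (NMul (NV vM) (NV vN));;
  SetN vs (NC 1);; SetN vw (NC 1);; SetN vL (NC 0).

Definition sto_row pa pn r s dr dc : com :=
  StoN aPA (NV ve) pa;; StoN aPN (NV ve) pn;; StoN aOR (NV ve) r;;
  StoN aOS (NV ve) s;; StoN aDR (NV ve) dr;; StoN aDC (NV ve) dc.

Definition level_code : com :=
  SetN ve (NAdd (NV vL) (NC 1));; StoN aRS (NV ve) (NC 0);;
  (If (BN (NV vw) (NV vs))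
    (sto_row (NAdd (NV vs) (NV vw)) (NAdd (NAdd (NV vs) (NV vw)) (NV vw))
       (NC 0) (NV vw) (NC 0) (NV vw);;
     SetN vw (NAdd (NV vw) (NV vw));;
     If (BN (NV vw) (NV vM)) Skip
       (If (BN (NV vM) (NV vw)) Skip (StoN aRS (NV ve) (NC 1))))
    (If (BN (NV vs) (NV vM))
      (sto_row (NAdd (NV vs) (NV vw)) (NAdd (NAdd (NV vs) (NV vs)) (NV vw))
         (NV vs) (NC 0) (NV vs) (NC 0);;
       SetN vs (NAdd (NV vs) (NV vs)))
      (sto_row (NV vM) (NV vM) (NC 0) (NC 0) (NC 0) (NV vw);;
       SetN vw (NAdd (NV vw) (NV vw)))));;
  SetN vL (NV ve).

Definition levels : com :=
  For vt (NV vNL) (If (BN (NMul (NV vs) (NV vw)) (NV vNL)) level_code Skip).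

Definition kids_code : com :=
  SetN vh (NAdd (NV vt) (NC 1));; SetN ve (NA aLEV (NV vh));;
  SetN vi (NMul (NC 2) (NV vh));; SetN vj (NAdd (NMul (NC 2) (NV vh)) (NC 1));;
  StoN aLEV (NV vi) (NSub (NV ve) (NC 1));; StoN aLEV (NV vj) (NSub (NV ve) (NC 1));;
  StoN aPAR (NV vi) (NV vh);; StoN aPAR (NV vj) (NV vh);;
  StoN aROW (NV vi) (NA aROW (NV vh));; StoN aCOL (NV vi) (NA aCOL (NV vh));;
  StoN aROW (NV vj) (NAdd (NA aROW (NV vh)) (NA aDR (NV ve)));;
  StoN aCOL (NV vj) (NAdd (NA aCOL (NV vh)) (NA aDC (NV ve))).

Definition tree : com :=
  StoN aLEV (NC 1) (NV vL);; StoN aPAR (NC 1) (NC 0);;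
  StoN aROW (NC 1) (NC 0);; StoN aCOL (NC 1) (NC 0);;
  For vt (NSub (NV vNL) (NC 1)) kids_code.

(** Coordinate number k is still in its input cell k + 3, unless that cell is below 200; then it was
    copied to b + 1 + k by the prologue. *)
Definition read x e : com :=
  SetN vk e;;
  If (BN (NAdd (NV vk) (NC 3)) (NC 200))
    (SetN vk (NAdd (NAdd (NV vB) (NC 1)) (NV vk))) (SetN vk (NAdd (NC 3) (NV vk)));;
  SetR x (RRaw (NV vk)).

Definition clamp x y : com :=
  If (BN (NV x) (NV y)) Skip (SetN x (NSub (NV y) (NC 1))).

Definition center_code : com :=
  SetN vh (NAdd (NV vNL) (NV vt));;
  SetN vi (NA aROW (NV vh));; clamp vi vm;; SetN vj (NA aCOL (NV vh));; clamp vj vn;;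
  SetN vi (NMul (NC 2) (NV vi));;
  SetN vj (NAdd (NMul (NC 2) (NV vm)) (NMul (NC 2) (NV vj)));;
  read xx0 (NV vi);; read xdx (NV vj);;
  read xy0 (NAdd (NV vi) (NC 1));; read xdy (NAdd (NV vj) (NC 1));;
  StoR aCX (NV vh) (RSub (RV xx0) (RV xdx));; StoR aCY (NV vh) (RSub (RV xy0) (RV xdy)).

Definition centers : com := For vt (NV vNL) center_code.

Section Setup.
Variable R : realType.
Implicit Types (s : st R).

Lemma double_up_ok x y s : x != vt -> y != vt -> x != y -> (0 < nv s x)%N ->
  tri (double_up x y) s (1 + nv s y * 3) (fun s' =>
    [/\ exists j, nv s' x = (nv s x * 2 ^ j)%N, (nv s y <= nv s' x)%N &
        (nv s' x <= maxn (nv s x) (2 * nv s y))%N]).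
Proof.
move=> xt yt xy x0.
pose I i s' := [/\ exists j, nv s' x = (nv s x * 2 ^ j)%N,
  (i < nv s' x)%N \/ (nv s y <= nv s' x)%N & (nv s' x <= maxn (nv s x) (2 * nv s y))%N].
apply: (tri_for_cst (Tb := 2) (I := I)).
- by [].
- by split; [exists 0%N; rewrite muln1|left|exact: leq_maxl].
- move=> i s' hi [[j hj] h1 h2] [fn _ _ _ _].
  have ey : nv s' y = nv s y by rewrite fn //= !inE negb_or yt /= eq_sym.
  apply: tri_if => [|hc|hc]; first by [].
    rewrite /= !fupd_neq // ey in hc.
    split=> //=; rewrite /I /= !fupd_eq !fupd_neq //; split.
    + by exists j.+1; rewrite hj addnn -mul2n expnS; lia.
    + by left; lia.
    + by rewrite leq_max; apply/orP; right; lia.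
  rewrite /= !fupd_neq // ey in hc.
  by split=> //=; rewrite /I /= !fupd_neq //; split; [exists j|right; lia|].
- move=> s' _ /= [h1 h2 h3]; rewrite /= !fupd_neq //; split=> //.
  by lia.
- by rewrite /=; lia.
Qed.

Definition sized s a k := [/\ (0 < a)%N, nv s vM = (2 ^ a)%N, nv s vN = (2 ^ (a + k))%N,
  nv s vW = (2 ^ a + 2 ^ a)%N & nv s vNL = (2 ^ (a + a + k))%N].

Lemma sizes_ok s : let m := nv s vm in let n := nv s vn in (0 < m <= n)%N ->
  tri sizes s (9 + 6 * n) (fun s' => exists a k,
    [/\ sized s' a k, (m <= 2 ^ a <= 2 * m)%N, (n <= 2 ^ (a + k) <= 2 * n)%N &
        [/\ nv s' vs = 1%N, nv s' vw = 1%N & nv s' vL = 0%N]]).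
Proof.
move=> m n hmn; rewrite /sizes; apply: (@tri_weak _ _ _ (8 + 6 * n).+1 _ (fun s' => exists a k,
    [/\ sized s' a k, (m <= 2 ^ a <= 2 * m)%N, (n <= 2 ^ (a + k) <= 2 * n)%N &
        [/\ nv s' vs = 1%N, nv s' vw = 1%N & nv s' vL = 0%N]])) => //.
step; set s1 := setn _ _ _.
have m1 : nv s1 vm = m by [].
have M1 : nv s1 vM = 2%N by rewrite /= fupd_eq ev.
apply: (tri_seq (T2 := (7 + 3 * n)%N)); first by apply: (@double_up_ok vM vm s1); rewrite ?M1.
  move=> s2 [fn2 _ _ _ _]; rewrite M1 m1 => -[[j hj] h1 h2].
  have n2 : nv s2 vn = n by rewrite fn2.
  have M2 : nv s2 vM = (2 ^ j.+1)%N by rewrite hj expnS.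
  apply: (@tri_weak _ _ _ (6 + 3 * n).+1 _ (fun s' => exists a k,
    [/\ sized s' a k, (m <= 2 ^ a <= 2 * m)%N, (n <= 2 ^ (a + k) <= 2 * n)%N &
        [/\ nv s' vs = 1%N, nv s' vw = 1%N & nv s' vL = 0%N]])) => //.
  step; set s3 := setn _ _ _.
  have n3 : nv s3 vn = n by [].
  have N3 : nv s3 vN = (2 ^ j.+1)%N by rewrite /= fupd_eq ev0.
  apply: (tri_seq (T2 := 5)); first by apply: (@double_up_ok vN vn s3); rewrite ?N3 ?exp2_gt0.
    move=> s4 [fn4 _ _ _ _]; rewrite N3 n3 => -[[i hi] h3 h4].
    have M4 : nv s4 vM = (2 ^ j.+1)%N by rewrite fn4.
    have N4 : nv s4 vN = (2 ^ (j.+1 + i))%N by rewrite hi expnD.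
    steps; exists j.+1, i; subst; rewrite -N4 -M4; split.
    + split=> //=; rewrite fupdE /= ?M4 //.
      by rewrite N4 -expnD addnA.
    + by lia.
    + by lia.
    + by [].
  by rewrite n3; lia.
by rewrite m1; lia.
Qed.

Lemma dims_prod a e : ((dims (2 ^ a) e).1 * (dims (2 ^ a) e).2 = 2 ^ e)%N.
Proof. by case: dimsP => [b _|b _|j] -> /=; rewrite -expnD ?addSn ?addnA. Qed.

Definition row_at s e := (na s aPA e.+1, na s aPN e.+1, (na s aOR e.+1, na s aOS e.+1),
  (na s aDR e.+1, na s aDC e.+1), na s aRS e.+1).

Lemma level_code_ok s a e : nv s vM = (2 ^ a)%N -> nv s vL = e ->
  (nv s vs, nv s vw) = dims (2 ^ a) e ->
  tri level_code s 15 (fun s' => [/\ nv s' vL = e.+1,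
    (nv s' vs, nv s' vw) = dims (2 ^ a) e.+1, row_at s' e = level_row (2 ^ a) e &
    forall A j, j != e.+1 -> na s' A j = na s A j]).
Proof.
move=> hM hL hd; rewrite /level_code /sto_row /row_at dimsS /next_dim /level_row -hd -hM.
have keep s' A B i x j : j != i -> na (setna s' B i x) A j = na s' A j.
  by move=> hj; rewrite /= fupdE; case: eqP => [->|//]; rewrite fupdE (negbTE hj).
have keepn s' x v : na (setn s' x v) = na s' by [].
steps; rewrite hL addn1 in ev; subst; (split; [by []|..|by move=> A j hj;
  rewrite !(keepn, keep)]);
  rewrite /=; repeat (rewrite fupdE /=); rewrite ?eqxx;
  rewrite ?hc ?(negbTE hc) ?hc0 ?(negbTE hc0) //; congr (_, _); case: eqP => //; lia.
Qed.
End Setup.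

Section Tables.
Variable R : realType.
Implicit Types (s : st R).

(** A block of level e has area 2^e, so the guard holds exactly while e < L; the NL = 2^L rounds are
    more than enough. *)
Lemma levels_ok s a k : sized s a k -> [/\ nv s vs = 1%N, nv s vw = 1%N & nv s vL = 0%N] ->
  tri levels s (1 + 2 ^ (a + a + k) * 17) (fun s' => nv s' vL = (a + a + k)%N /\
    forall e, (e < a + a + k)%N -> row_at s' e = level_row (2 ^ a) e).
Proof.
move=> [a0 hM hN hW hNL] [s0 w0 L0]; set L := (a + a + k)%N.
pose I i s' := exists e, [/\ (e <= L)%N, nv s' vL = e, (nv s' vs, nv s' vw) = dims (2 ^ a) e,
  forall e', (e' < e)%N -> row_at s' e' = level_row (2 ^ a) e' & (i <= e)%N \/ e = L].
have dL e : (2 ^ e < 2 ^ L)%N = (e < L)%N by rewrite ltn_exp2l.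
have rows_done e s' : (e <= L)%N -> ~~ (e < L)%N -> e = L by move=> h1 h2; lia.
apply: (tri_for_cst (Tb := 16) (I := I)).
- by [].
- by exists 0%N; rewrite L0 s0 w0; split=> //; left.
- move=> i s' hi [e [h1 h2 h3 h4 h5]] hF; have [fn _ _ _ _] := hF.
  have cnd : (nv s' vs * nv s' vw)%N = (2 ^ e)%N.
    by have := dims_prod a e; rewrite -h3.
  have NL' : nv s' vNL = (2 ^ L)%N by rewrite fn.
  apply: tri_if => [|hc|hc]; first by [].
  + have {}hc : (e < L)%N by move: hc; rewrite /= !fupdE /= cnd NL' dL.
    have M' : nv (setn s' vt i) vM = (2 ^ a)%N by rewrite /= fupdE /= fn.
    apply: tri_weak (level_code_ok M' h2 h3) (leqnn _) _ => s2 _ [q1 q2 q3 q4].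
    exists e.+1; split=> //.
    * move=> e' he'; case: (ltnP e' e) => hlt; last by have -> : e' = e by lia.
      by rewrite -(h4 _ hlt) /row_at !q4 //; lia.
    * by case: h5 => [h5|h5]; [left|lia].
  + have {}hc : ~~ (e < L)%N by move: hc; rewrite /= !fupdE /= cnd NL' dL.
    by split=> //; exists e; split=> //; right; exact: rows_done hc.
- move=> s' _; rewrite /= hNL -/L => -[e [h1 h2 h3 h4 h5]].
  have eL : e = L by case: h5 => // h5; have := ltn_expl L (isT : 1 < 2)%N; lia.
  by rewrite -eL; split=> // e' he'; exact: h4.
- by rewrite /= hNL -/L; lia.
Qed.

Definition nodes_upto s a k n := [/\
  forall h, (0 < h < 2 * n)%N -> na s aLEV h = (a + a + k - trunc_log 2 h)%N,
  forall h, (0 < h < 2 * n)%N -> na s aPAR h = h./2,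
  na s aROW 1 = 0%N /\ na s aCOL 1 = 0%N &
  forall h, (0 < h < n)%N ->
    [/\ na s aROW (2 * h)%N = na s aROW h, na s aCOL (2 * h)%N = na s aCOL h,
        na s aROW (2 * h + 1)%N = (na s aROW h + na s aDR (na s aLEV h))%N &
        na s aCOL (2 * h + 1)%N = (na s aCOL h + na s aDC (na s aLEV h))%N] ].

Lemma kids_code_ok s a k : let n := (nv s vt).+1 in (n < 2 ^ (a + a + k))%N ->
  nodes_upto s a k n -> tri kids_code s 12 (fun s' => nodes_upto s' a k n.+1).
Proof.
move=> n hn [h1 h2 [h3 h4] h5].
have n0 : (0 < n)%N by [].
have ln := h1 n ltac:(lia).
have tn : (trunc_log 2 n < a + a + k)%N.
  by rewrite -(ltn_exp2l _ _ (isT : 1 < 2)%N); apply: leq_ltn_trans hn; exact: trunc_logP.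
have t2 : trunc_log 2 (2 * n) = (trunc_log 2 n).+1.
  by rewrite trunc_log2S ?mul2n ?doubleK //; lia.
have t3 : trunc_log 2 (2 * n + 1) = (trunc_log 2 n).+1.
  by rewrite trunc_log2S ?mul2n ?addn1 /= ?uphalf_double //; lia.
rewrite /kids_code; do 4 step.
rewrite addn1 -/n in ev; subst v; rewrite ln in ev0; subst.
do 2 (step; first by lia); steps; subst.
rewrite !if_same; set s' := (X in nodes_upto X).
have eL j : na s' aLEV j = if (j == 2 * n)%N || (j == 2 * n + 1)%N
    then (a + a + k - trunc_log 2 n - 1)%N else na s aLEV j.
  by rewrite /= !fupdE /= !fupdE; case: eqP => // _; case: eqP.
have eP j : na s' aPAR j = if (j == 2 * n)%N || (j == 2 * n + 1)%N then n else na s aPAR j.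
  by rewrite /= !fupdE /= !fupdE; case: eqP => // _; case: eqP.
have eR j : na s' aROW j = if (j == 2 * n)%N then na s aROW n else
    if (j == 2 * n + 1)%N then (na s aROW n + na s aDR (na s aLEV n))%N else na s aROW j.
  by rewrite ln /= !fupdE /= !fupdE; case: eqP => [->|_]; case: eqP => //; lia.
have eC j : na s' aCOL j = if (j == 2 * n)%N then na s aCOL n else
    if (j == 2 * n + 1)%N then (na s aCOL n + na s aDC (na s aLEV n))%N else na s aCOL j.
  by rewrite ln /= !fupdE /= !fupdE; case: eqP => [->|_]; case: eqP => //; lia.
have eD : na s' aDR = na s aDR by [].
have eD' : na s' aDC = na s aDC by [].
move: s' eL eP eR eC eD eD' => s' eL eP eR eC eD eD'; clearbody n.
have old h : (0 < h <= n)%N -> (h == 2 * n)%N || (h == 2 * n + 1)%N = false.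
  by move=> hh; apply/negbTE; lia.
have old1 h : (0 < h <= n)%N -> (h == 2 * n)%N = false by move=> /old/norP[/negbTE].
have old2 h : (0 < h <= n)%N -> (h == 2 * n + 1)%N = false by move=> /old/norP[_ /negbTE].
split.
- move=> h hh; rewrite eL; case: eqP => [->|n1] /=; first by rewrite t2; lia.
  by case: eqP => [->|n2]; [rewrite t3; lia|apply: h1; lia].
- move=> h hh; rewrite eP; case: eqP => [->|n1] /=; first by rewrite mul2n doubleK.
  case: eqP => [->|n2]; last by apply: h2; lia.
  by rewrite addn1 mul2n /= uphalf_double.
- by rewrite eR eC !(old1 1%N) ?(old2 1%N).
- move=> h hh; have f (x y : nat) : x <> y -> (x == y) = false by move/eqP/negbTE.
  have f3 : (2 * h + 1 == 2 * h)%N = false by apply: f; lia.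
  have f4 : (2 * h + 1 == 2 * n)%N = false by apply: f; lia.
  have f5 : (2 * h == 2 * n + 1)%N = false by apply: f; lia.
  have f6 : (2 * h == 2 * n)%N = (h == n) by rewrite eqn_pmul2l.
  have f7 : (2 * h + 1 == 2 * n + 1)%N = (h == n) by rewrite eqn_add2r f6.
  have hn2 : (0 < h <= n)%N by lia.
  rewrite !eR !eC !eL eD eD' f4 f5 f6 f7 (old1 h hn2) (old2 h hn2) /=.
  case: eqP => [->//|nn]; apply: h5; lia.
Qed.

Lemma tree_ok s a k : sized s a k -> nv s vL = (a + a + k)%N ->
  (forall e, (e < a + a + k)%N -> row_at s e = level_row (2 ^ a) e) ->
  tri tree s (5 + 2 ^ (a + a + k) * 13) (fun s' => tabs s' a k).
Proof.
move=> [a0 hM hN hW hNL] hL hrow; rewrite /tree; set NL := (2 ^ (a + a + k))%N.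
have NL0 : (0 < NL)%N := exp2_gt0 _.
apply: (@tri_weak _ _ _ (4 + (1 + NL * 13))%N _ (fun s' => tabs s' a k)) => //.
do 4 step; subst; set s1 := setna _ _ _ _.
have h1 : nodes_upto s1 a k 1.
  split=> [h hh|h hh||h hh]; [| |by rewrite /= !fupdE|by lia].
  + have -> : h = 1%N by lia.
    by rewrite /= !fupdE /= hL trunc_log1 subn0.
  + by have -> : h = 1%N by lia.
have hN1 x : x \in [:: vM; vN; vW; vL; vNL] -> nv s1 x = nv s x by [].
apply: (tri_for_cst (Tb := 12) (I := fun i s' => nodes_upto s' a k i.+1)).
- by split=> //=; rewrite hNL -/NL.
- exact: h1.
- move=> i s'; rewrite [evn _ _]/= hNL -/NL => hi hI hF.
  have := @kids_code_ok (setn s' vt i) a k; rewrite [nv _ vt]fupd_eq; apply; last exact: hI.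
  by rewrite -/NL; lia.
- move=> s' [fn _ fa _ _]; rewrite [evn _ _]/= hNL -/NL => -[q1 q2 q3 q4].
  have e1 : (NL - 1).+1 = NL by lia.
  rewrite e1 in q1 q2 q4.
  split; rewrite /= ?fupdE /= ?fn //.
  by move=> e he; rewrite -hrow // /row_at !fa.
- by rewrite [evn _ _]/= hNL -/NL; lia.
Qed.
End Tables.

(** * Reading the input and computing the centres *)

Section Input.
Variable R : realType.
Implicit Types (s : st R) (P Q : seq (pt R)).

Lemma input_memP P Q delta i : (i < size P)%N ->
  input_mem P Q delta (3 + 2 * i)%N = (nth (pt0 R) P i).1 /\
  input_mem P Q delta (3 + (2 * i + 1))%N = (nth (pt0 R) P i).2.
Proof.
move=> hi; rewrite /input_mem /= !addKn !ifT; try lia.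
by rewrite /Defs.coord mul2n odd_double doubleK addn1 /= odd_double uphalf_double.
Qed.

Lemma input_memQ P Q delta j : (j < size Q)%N ->
  input_mem P Q delta (3 + (2 * size P + 2 * j))%N = (nth (pt0 R) Q j).1 /\
  input_mem P Q delta (3 + (2 * size P + 2 * j + 1))%N = (nth (pt0 R) Q j).2.
Proof.
move=> hj; have e k : (k < 2 * size Q)%N ->
    input_mem P Q delta (3 + (2 * size P + k))%N = Defs.coord Q k.
  move=> hk; rewrite /input_mem /= !addKn ifF; last by apply/negbTE; lia.
  by rewrite hk.
rewrite -addnA !e; try lia.
by rewrite /Defs.coord mul2n odd_double doubleK addn1 /= odd_double uphalf_double.
Qed.

Definition loaded s P Q delta := let B := (256 * (size P + size Q))%N in
  [/\ nv s vm = size P, nv s vn = size Q, nv s vB = B, bs s = (B + cells)%N &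
      forall k, (3 + k < B)%N ->
     raw s (if (k + 3 < cells)%N then B + 1 + k else 3 + k)%N = input_mem P Q delta (3 + k)%N].

Lemma read_ok s x e P Q delta : let k := evn e s in (0 < size P)%N -> loaded s P Q delta ->
  okn e s -> (k < 2 * (size P + size Q))%N ->
  tri (read x e) s 4 (fun s' => rv s' x = input_mem P Q delta (3 + k)%N).
Proof.
move=> k P0 [hm hn hB hb hraw] he hk; rewrite /read.
rewrite -(hraw k); last by lia.
apply: tri_setn => // v ev; rewrite -/k in ev; clearbody k; subst v.
step; step; rewrite ?hB in ev; (step; [rewrite ev hb /cells; lia|]); steps;
  rewrite /= fupd_eq; subst; congr (raw s _); rewrite /cells; case: ifP; lia.
Qed.

Lemma loaded_frame c s s' P Q delta : frame c s s' ->
  ~~ has (mem [:: vm; vn; vB]) (wn c) -> loaded s P Q delta -> loaded s' P Q delta.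
Proof.
move=> [fn _ _ _ [fr fb]] /hasPn h [h1 h2 h3 h4 h5].
have e x : x \in [:: vm; vn; vB] -> nv s' x = nv s x.
  by move=> hx; apply: fn; apply/negP => /h /negP []; exact: hx.
by split; rewrite ?e // ?fr ?fb.
Qed.

Lemma clamp_ok s x y : (0 < nv s y)%N ->
  tri (clamp x y) s 2 (fun s' => nv s' x = minn (nv s x) (nv s y).-1).
Proof.
by move=> hy; rewrite /clamp; steps; rewrite /= ?fupd_eq; lia.
Qed.

Definition center P Q i j : pt R :=
  ((nth (pt0 R) P (minn i (size P).-1)).1 - (nth (pt0 R) Q (minn j (size Q).-1)).1,
   (nth (pt0 R) P (minn i (size P).-1)).2 - (nth (pt0 R) Q (minn j (size Q).-1)).2).

Lemma center_code_ok s P Q delta : (0 < size P)%N -> (0 < size Q)%N ->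
  loaded s P Q delta -> let h := (nv s vNL + nv s vt)%N in
  tri center_code s 27 (fun s' => forall l,
    ctr s' l = if l == h then center P Q (na s aROW h) (na s aCOL h) else ctr s l).
Proof.
move=> P0 Q0 ld h; rewrite /center_code; do 2 step; set s1 := setn _ _ _.
have ld1 : loaded s1 P Q delta by [].
have hm1 : (0 < nv s1 vm)%N by have [-> _ _ _ _] := ld1.
refine (tri_seq (T2 := 23) (clamp_ok _ hm1) _ _); last by [].
move=> s2 F2 v2; have ld2 := loaded_frame F2 isT ld1; have [fn2 fr2 fa2 fra2 _] := F2.
have vh2 : nv s2 vh = h by rewrite fn2 //= !fupdE /= ev.
have a2 : na s2 = na s1 by apply/funext => A; rewrite fa2.
have {}v2 : nv s2 vi = minn (na s aROW h) (size P).-1.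
  case: ld => e _ _ _ _; by rewrite v2 /= !fupdE /= ev0 e ev.
step; rewrite vh2 a2 in ev1; set s3 := setn _ _ _.
have ld3 : loaded s3 P Q delta by [].
have hn3 : (0 < nv s3 vn)%N by have [_ -> _ _ _] := ld3.
refine (tri_seq (T2 := 20) (clamp_ok _ hn3) _ _); last by [].
move=> s4 F4 v4; have ld4 := loaded_frame F4 isT ld3; have [fn4 fr4 fa4 fra4 _] := F4.
have vh4 : nv s4 vh = h by rewrite fn4.
have vi4 : nv s4 vi = minn (na s aROW h) (size P).-1 by rewrite fn4.
have {}v4 : nv s4 vj = minn (na s aCOL h) (size Q).-1.
  by case: ld2 => _ e _ _ _; rewrite v4 /= !fupdE /= ev1 e.
set i := minn _ _ in vi4; set j := minn _ _ in v4.
have hi : (i < size P)%N by rewrite /i; lia.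
have hj : (j < size Q)%N by rewrite /j; lia.
step; step; rewrite vi4 in ev2; rewrite v4 in ev3.
have em : nv s4 vm = size P by case: ld4.
rewrite em in ev3; set s5 := setn _ _ _.
have ld5 : loaded s5 P Q delta by [].
have i5 : nv s5 vi = (2 * i)%N by rewrite /= !fupdE /= ev2.
have j5 : nv s5 vj = (2 * size P + 2 * j)%N by rewrite /= !fupdE /= ev3.
have [p1 p2] := input_memP Q delta hi; have [q1 q2] := input_memQ P delta hj.
refine (tri_seq (T2 := 14) (read_ok xx0 (e := NV vi) P0 ld5 I _) _ _); last by [].
  by rewrite [evn _ _]i5; lia.
rewrite [evn _ _]i5 p1 => s6 F6 r6; have ld6 := loaded_frame F6 isT ld5.
have [fn6 fr6 fa6 fra6 _] := F6.
have j6 : nv s6 vj = (2 * size P + 2 * j)%N by rewrite fn6.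
have i6 : nv s6 vi = (2 * i)%N by rewrite fn6.
refine (tri_seq (T2 := 10) (read_ok xdx (e := NV vj) P0 ld6 I _) _ _); last by [].
  by rewrite [evn _ _]j6; lia.
rewrite [evn _ _]j6 q1 => s7 F7 r7; have ld7 := loaded_frame F7 isT ld6.
have [fn7 fr7 fa7 fra7 _] := F7.
have j7 : nv s7 vj = (2 * size P + 2 * j)%N by rewrite fn7.
have i7 : nv s7 vi = (2 * i)%N by rewrite fn7.
refine (tri_seq (T2 := 6)
  (read_ok xy0 (e := NAdd (NV vi) (NC 1)) P0 ld7 (conj I I) _) _ _); last by [].
  by rewrite /evn i7; lia.
rewrite [evn _ _]/= i7 p2 => s8 F8 r8; have ld8 := loaded_frame F8 isT ld7.
have [fn8 fr8 fa8 fra8 _] := F8.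
have j8 : nv s8 vj = (2 * size P + 2 * j)%N by rewrite fn8.
refine (tri_seq (T2 := 2)
  (read_ok xdy (e := NAdd (NV vj) (NC 1)) P0 ld8 (conj I I) _) _ _); last by [].
  by rewrite /evn j8; lia.
rewrite [evn _ _]/= j8 q2 => s9 F9 r9; have [fn9 fr9 fa9 fra9 _] := F9.
have h9 : nv s9 vh = h by rewrite fn9 // fn8 // fn7 // fn6.
steps => l; rewrite /ctr /= !fupdE /=.
rewrite h9 in ek ek0; subst k k0; rewrite !fupdE.
have ra9 A : ra s9 A = ra s A by rewrite fra9 // fra8 // fra7 // fra6 // fra4 // fra2.
have x9 : rv s9 xx0 = (nth (pt0 R) P i).1 by rewrite fr9 // fr8 // fr7.
have dx9 : rv s9 xdx = (nth (pt0 R) Q j).1 by rewrite fr9 // fr8.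
have y9 : rv s9 xy0 = (nth (pt0 R) P i).2 by rewrite fr9.
rewrite !ra9 ex ex0 x9 dx9 y9 r9 /center -/i -/j.
by case: eqP.
Qed.

Lemma centers_ok s a k P Q delta : (0 < size P)%N -> (0 < size Q)%N -> tabs s a k ->
  loaded s P Q delta ->
  let NL := (2 ^ (a + a + k))%N in
  tri centers s (1 + NL * 28) (fun s' => forall l, (NL <= l < 2 * NL)%N ->
    ctr s' l = center P Q (na s aROW l) (na s aCOL l)).
Proof.
move=> P0 Q0 t ld NL.
pose I i s' := forall l, (NL <= l < NL + i)%N ->
  ctr s' l = center P Q (na s aROW l) (na s aCOL l).
apply: (tri_for_cst (Tb := 27) (I := I)).
- by [].
- by move=> l; lia.
- move=> i s'; rewrite /= (tb_NL t) -/NL => hi hI hF; have [fn fr fa fra _] := hF.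
  have ld' : loaded (setn s' vt i) P Q delta.
    by have [? ? ? ? ?] := loaded_frame hF isT ld.
  apply: tri_weak (center_code_ok P0 Q0 ld') (leqnn _) _ => s2 _.
  have -> : nv (setn s' vt i) vNL = NL by rewrite /= fupdE /= fn // (tb_NL t).
  rewrite [nv _ vt]fupd_eq => h l hl; rewrite h /= !fa //.
  by case: eqP => [->//|ne]; apply: hI; lia.
- by move=> s' _; rewrite /= (tb_NL t) -/NL /I mul2n -addnn.
- by rewrite /= (tb_NL t) -/NL; lia.
Qed.
End Input.

(** * From paths to the discrete Frechet distance *)

Lemma grid_path_end F i j : grid_path F i j -> F (i, j).
Proof. by move/grid_pathE => []. Qed.

Lemma grid_path_step F i j i' j' : grid_path F i j -> mstep (i, j) (i', j') ->
  F (i', j') -> grid_path F i' j'.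
Proof. by move=> h hs hF; apply/grid_pathE; split=> //; right; exists (i, j). Qed.

Lemma grid_path_full m n : grid_path (fun ij => (ij.1 <= m) && (ij.2 <= n))%N m n.
Proof.
have h i : (i <= m)%N -> grid_path (fun ij => (ij.1 <= m) && (ij.2 <= n))%N i 0.
  elim: i => [|i IH] hi; first by apply/grid_pathE; split=> //; left.
  by apply: grid_path_step (IH (ltnW hi)) _ _; rewrite /mstep /= ?eqxx ?hi.
suff v j : (j <= n)%N -> grid_path (fun ij => (ij.1 <= m) && (ij.2 <= n))%N m j by exact: v.
elim: j => [|j IH] hj; first exact: h.
by apply: grid_path_step (IH (ltnW hj)) _ _; rewrite /mstep /= ?eqxx ?orbT ?leqnn.
Qed.

(** Clamping the indices sends each step of a padded path to a step or to a standstill. Conversely a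
    path ending at (m, n) continues down and then to the right through copies of that cell. *)
Lemma grid_path_pad F m n M N : (m <= M)%N -> (n <= N)%N ->
  grid_path (fun ij => [&& ij.1 <= M, ij.2 <= N & F (minn ij.1 m, minn ij.2 n)])%N M N <->
  grid_path (fun ij => [&& ij.1 <= m, ij.2 <= n & F ij])%N m n.
Proof.
move=> hm hn; set G := fun ij : nat * nat => [&& _, _ & F (minn _ _, _)].
set E := fun ij : nat * nat => [&& _, _ & F ij]; split.
- suff h s i j : (i + j <= s)%N -> grid_path G i j -> grid_path E (minn i m) (minn j n).
    by move/(h _ _ _ (leqnn _)); rewrite (minn_idPr hm) (minn_idPr hn).
  elim: s i j => [|s IH] i j hs /grid_pathE [/and3P[_ _ hF] hp];
    have hE : E (minn i m, minn j n) by rewrite /E /= !geq_minr hF.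
  - apply/grid_pathE; split=> //; left; lia.
  case: hp => [[ei ej]|[[x y] st]].
    by apply/grid_pathE; split=> //; left; rewrite ei ej !min0n.
  rewrite /= => hg; have hxy : (x + y <= s)%N.
    by move: st; rewrite /mstep => /or3P[] /eqP [? ?]; subst; rewrite /= in hs; lia.
  have {}hg := IH x y hxy hg.
  have [[e1 e2]|st'] : (minn x m = minn i m /\ minn y n = minn j n) \/
      mstep (minn x m, minn y n) (minn i m, minn j n).
  - move: st; rewrite /mstep /= !xpair_eqE.
    by case: (ltnP x m) => h1; case: (ltnP y n) => h2;
      case/or3P => /andP[/eqP -> /eqP ->]; lia.
  - by rewrite -e1 -e2.
  - exact: grid_path_step hg st' hE.
- move=> h; have /and3P[_ _ hF] := grid_path_end h.
  have h1 : grid_path G m n.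
    apply: grid_path_mono h => -[i j] /and3P[/= h1 h2 h3].
    by rewrite /G /= (minn_idPl h1) (minn_idPl h2) h3 (leq_trans h1) ?(leq_trans h2).
  have gF i j : (m <= i <= M)%N -> (n <= j <= N)%N -> G (i, j).
    move=> /andP[i1 i2] /andP[j1 j2].
    by rewrite /G /= i2 j2 (minn_idPr i1) (minn_idPr j1).
  have h2 d : (m + d <= M)%N -> grid_path G (m + d)%N n.
    elim: d => [|d IH] hd; first by rewrite addn0.
    rewrite addnS in hd *; apply: grid_path_step (IH (ltnW hd)) _ (gF _ _ _ _); try lia.
    by rewrite /mstep /= eqxx.
  have h3 d : (n + d <= N)%N -> grid_path G M (n + d)%N.
    elim: d => [|d IH] hd; first by rewrite addn0 -(subnKC hm); apply: h2; rewrite subnKC.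
    rewrite addnS in hd *; apply: grid_path_step (IH (ltnW hd)) _ (gF _ _ _ _); try lia.
    by rewrite /mstep /= eqxx orbT.
  by rewrite -(subnKC hn); apply: h3; rewrite subnKC.
Qed.

Section Frechet_distance.
Variable R : realType.
Implicit Types (P Q : seq (pt R)) (t : pt R).

(** The matrix depends on finitely many distances, so it is constant on some interval to the right
    of delta. This makes the infimum in the distance attained. *)
Lemma gap (l : seq R) delta : exists2 e, delta < e & forall x, x \in l -> x <= delta \/ e <= x.
Proof.
elim: l => [|y l [e de h]]; first by exists (delta + 1); [lra|].
case: (leP y delta) => hy.
  by exists e => // x; rewrite inE => /orP[/eqP ->|/h //]; left.
exists (Num.min y e); first by rewrite lt_min hy de.
move=> x; rewrite inE => /orP[/eqP ->|/h [|hx]]; first by right; rewrite ge_min lexx.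
  by left.
by right; rewrite ge_min hx orbT.
Qed.

Lemma has_mpathE d P Q : has_mpath d P Q <-> grid_path (entry1 d P Q) (size P).-1 (size Q).-1.
Proof. by []. Qed.

Lemma dfrechet_le delta P Q : (0 < size P)%N -> (0 < size Q)%N -> 0 < delta ->
  dfrechet P Q <= delta <-> has_mpath delta P Q.
Proof.
move=> P0 Q0 d0; pose A := [set d : R | 0 < d /\ has_mpath d P Q]%classic.
have lbA : lbound A 0 by move=> d [/ltW].
split=> [h|h]; last by apply: ge_inf; [exists 0|split].
pose dist (ij : nat * nat) := Defs.edist (nth (pt0 R) P ij.1) (nth (pt0 R) Q ij.2).
pose l := [seq dist (i, j) | i <- iota 0 (size P), j <- iota 0 (size Q)].
have inl ij : (ij.1 < size P)%N -> (ij.2 < size Q)%N -> dist ij \in l.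
  by case: ij => i j /= hi hj; apply: allpairs_f; rewrite mem_iota.
have [e de he] := gap l delta.
have [D hD] : exists D, forall x, x \in l -> x <= D.
  elim: (l) => [|y s [D hD]]; first by exists 0.
  exists (Num.max y D) => x; rewrite inE le_max => /orP[/eqP ->|/hD ->];
    by rewrite ?lexx ?orbT.
have nA : (A !=set0)%classic.
  exists (Num.max 1 D); split; first by rewrite lt_max ltr01.
  apply/has_mpathE; apply: grid_path_mono (grid_path_full _ _) => ij /andP[h1 h2].
  have h1' : (ij.1 < size P)%N by lia.
  have h2' : (ij.2 < size Q)%N by lia.
  by rewrite /entry1 h1' h2' /= le_max; apply/orP; right; apply: hD; apply: inl.
(* Without a path at delta there is none at any value below [e], because no distance lies strictly
   between the two. *)
apply: contrapT => no; have : e <= dfrechet P Q.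
  apply: lb_le_inf => // d [_ hd]; rewrite leNgt; apply/negP => hlt; apply: no.
  apply: grid_path_mono hd => ij /and3P[h1 h2 h3]; rewrite /entry1 h1 h2 /=.
  by have [//|h4] := he _ (inl ij h1 h2); have := le_lt_trans (le_trans h4 h3) hlt; rewrite ltxx.
by move=> h1; have := lt_le_trans de (le_trans h1 h); rewrite ltxx.
Qed.

Lemma entry1_translate delta P Q t ij : 0 < delta ->
  entry1 delta P (translate Q t) ij = [&& (ij.1 < size P)%N, (ij.2 < size Q)%N &
    in_disk delta ((nth (pt0 R) P ij.1).1 - (nth (pt0 R) Q ij.2).1,
                   (nth (pt0 R) P ij.1).2 - (nth (pt0 R) Q ij.2).2) t].
Proof.
move=> d0; rewrite /entry1 size_map; case: ltnP => //= h1; case: ltnP => //= h2.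
rewrite (nth_map (pt0 R)) // /Defs.edist /in_disk /=.
set u := (_ - (_ + _)); have -> : u = (nth (pt0 R) P ij.1).1 - (nth (pt0 R) Q ij.2).1 - t.1.
  by rewrite /u opprD addrA.
set v := (_ - (_ + _)); have -> : v = (nth (pt0 R) P ij.1).2 - (nth (pt0 R) Q ij.2).2 - t.2.
  by rewrite /v opprD addrA.
by rewrite -{1}(ger0_norm (ltW d0)) -sqrtr_sqr ler_sqrt ?sqr_ge0.
Qed.
End Frechet_distance.

(** From 2^k = N / M <= 2n / m it follows that k + 1 <= 2 (1 + ln (n/m)). The bound is M^3 N^2 (k +
    1) with M <= 2m and N <= 2n, and 64 = 8 * 4 * 2. *)
Lemma steps_bound (R : realType) m n a k NL T : (0 < m <= n)%N ->
  (m <= 2 ^ a <= 2 * m)%N -> (2 ^ (a + k) <= 2 * n)%N -> NL = (2 ^ a * 2 ^ (a + k))%N ->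
  (T <= NL ^ 2 * 2 ^ a * k.+1)%N ->
  T%:R <= 64 * m%:R ^+ 3 * n%:R ^+ 2 * (1 + ln (n%:R / m%:R)) :> R.
Proof.
move=> /andP[m0 mn] /andP[ma am] Nn -> hT; set x : R := n%:R / m%:R.
have mR : 0 < m%:R :> R by rewrite ltr0n.
have nR : 0 < n%:R :> R by rewrite ltr0n (leq_trans m0).
have x0 : 0 < x by rewrite divr_gt0.
have two_k : 2 ^+ k <= 2 * x :> R.
  rewrite mulrA ler_pdivlMr // -!natrX -!natrM ler_nat.
  apply: leq_trans Nn; rewrite expnD mulnC leq_mul2r ma orbT //.
have x1 : 0 <= ln x by rewrite ln_ge0 // ler_pdivlMr // mul1r ler_nat.
clearbody x.
have ln2 : 1 / 2 <= ln 2 :> R.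
  rewrite -ler_expR lnK ?posrE // -[expR _]invrK -expRN.
  have h : 1 / 2 <= expR (- (1 / 2)) :> R.
    by apply: le_trans (expR_ge1Dx _); lra.
  by rewrite -[X in _ <= X]invrK lef_pV2 ?posrE ?expR_gt0 ?invr_gt0 //; lra.
have hk : k%:R * ln 2 <= ln 2 + ln x :> R.
  by rewrite -lnM ?posrE // mulr_natl -lnXn // ler_ln ?posrE ?exprn_gt0 ?mulr_gt0.
have lnx : (k.+1)%:R <= 2 * (1 + ln x) :> R.
  (* One factor 2 of 2^k is absorbed by padding: (k - 1) ln 2 <= ln x, and ln 2 >= 1/2 gives k - 1
     <= 2 ln x. *)
  case: k two_k hk {hT Nn} => [|k] two_k hk; first by lra.
  have := ler_wpM2r (ler0n R k) ln2; move: hk.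
  by rewrite -(natr1 k.+1) -(natr1 k); nra.
have hT' : T%:R <= (2 * m%:R) ^+ 3 * (2 * n%:R) ^+ 2 * (k.+1)%:R :> R.
  rewrite -!natrM -!natrX -!natrM ler_nat; apply: leq_trans hT _.
  rewrite leq_mul2r; apply/orP; right.
  rewrite expnMn mulnAC -expnSr; by apply: leq_mul; rewrite leq_exp2r.
apply: le_trans hT' _.
have -> : 64 * m%:R ^+ 3 * n%:R ^+ 2 * (1 + ln x) =
  (2 * m%:R) ^+ 3 * (2 * n%:R) ^+ 2 * (2 * (1 + ln x)) :> R by ring.
by rewrite ler_pM2l // mulr_gt0 // exprn_gt0 // mulr_gt0.
Qed.

(** * Assembly of the program, its cost and its correctness *)

Definition program : com := sizes;; levels;; tree;; centers;; all_circles.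

Lemma program_wf : wfc program.
Proof. by vm_compute. Qed.

(** The leading term is NL circles times 2 NL events times a climb. The height 2a + k is absorbed
    into X = M (k + 1) by a < 2^a, so a climb costs at most 1100 X; 2700 leaves room for the
    set-up. *)
Lemma total_cost a k n : let NL := (2 ^ (a + a + k))%N in (n <= 2 ^ (a + k))%N ->
  ((9 + 6 * n) + ((1 + NL * 17) + ((5 + NL * 13) + ((1 + NL * 28) +
     (1 + NL * (1 + circle_cost a k))))) < 2700 * (NL ^ 2 * 2 ^ a * k.+1))%N.
Proof.
move=> NL hn; rewrite /circle_cost /climb_cost -/NL.
have hNL : (n <= NL)%N by apply: leq_trans hn _; rewrite leq_exp2l // -addnA leq_addl.
have aM : (a < 2 ^ a)%N := ltn_expl a (isT : 1 < 2)%N.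
have N0 : (0 < NL)%N := exp2_gt0 _.
have M0 := exp2_gt0 a.
move: NL (2 ^ a)%N hNL aM N0 M0 {hn} => N M hNL aM N0 M0.
have k1 : (k <= M * k)%N by exact: leq_pmull.
pose X := (M * k.+1)%N; have eX : X = (M + M * k)%N by rewrite /X mulnS.
have c1 : (1 + (a + a + k) * 54 + (7 + k) * M * 110 <= 1100 * X)%N.
  have -> : ((7 + k) * M = 7 * M + M * k)%N by rewrite mulnDl (mulnC k).
  by rewrite eX; move: (M * k)%N k1 => z k1; lia.
have c2 : (101 + 220 * M + 2 * (24 + (1 + (a + a + k) * 54 + (7 + k) * M * 110)) <=
    2569 * X)%N by lia.
have c3 : (1 + (5 + N * (101 + 220 * M) +
    2 * N * (24 + (1 + (a + a + k) * 54 + (7 + k) * M * 110))) <= N * (2575 * X))%N.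
  have : (N * (101 + 220 * M + 2 * (24 + (1 + (a + a + k) * 54 + (7 + k) * M * 110))) <=
    N * (2569 * X))%N by rewrite leq_mul2l c2 orbT.
  have : (1 <= N * X)%N by rewrite muln_gt0 N0 eX; lia.
  by move: (_ + (7 + k) * M * 110)%N c1 {c2} => c _; nia.
have c4 : (N * (1 + (5 + N * (101 + 220 * M) +
    2 * N * (24 + (1 + (a + a + k) * 54 + (7 + k) * M * 110)))) <= N * (N * (2575 * X)))%N.
  by rewrite leq_mul2l c3 orbT.
have eZ : (N ^ 2 * M * k.+1 = N * (N * X))%N by rewrite /X -!mulnA.
have z1 : (N <= N * (N * X))%N.
  by rewrite leq_pmulr // muln_gt0 N0 eX; lia.
rewrite eZ; move: (N * (1 + _))%N c4 => c c4.
have e2 : (N * (N * (2575 * X)) = 2575 * (N * (N * X)))%N by ring.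
rewrite e2 in c4; move: (N * (N * X))%N z1 c4 => z z1 c4; lia.
Qed.

Section Program.
Variable R : realType.
Implicit Types (s : st R) (P Q : seq (pt R)).

Definition hits P Q delta M N := exists i0 j0 x, [/\ (i0 <= M)%N, (j0 <= N)%N, -1 <= x <= 1 &
  grid_path (fun ij => [&& (ij.1 <= M)%N, (ij.2 <= N)%N &
    in_disk delta (center P Q ij.1 ij.2) (circ delta (center P Q i0 j0) x)]) M N].

Lemma program_ok s P Q delta : (0 < size P <= size Q)%N -> 0 < delta ->
  initial P Q delta s -> exists a k T,
  [/\ (size P <= 2 ^ a <= 2 * size P)%N, (size Q <= 2 ^ (a + k) <= 2 * size Q)%N,
   (T < 2700 * ((2 ^ (a + a + k)) ^ 2 * 2 ^ a * k.+1))%N &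
   tri program s T (fun s' =>
     nv s' vout != 0%N <-> hits P Q delta (2 ^ a).-1 (2 ^ (a + k)).-1)].
Proof.
move=> /andP[P0 PQ] d0 [i1 i2 i3 i4 i5].
have Q0 : (0 < size Q)%N by exact: leq_trans PQ.
have ld : loaded s P Q delta by split; rewrite ?i1.
have hmn : (0 < nv s vm <= nv s vn)%N by rewrite !i1 /= P0.
(* The exponents come out of the run of [sizes], yet the budget depends on them; so this run is
   opened first and its final state is named. *)
have T1 := sizes_ok hmn; rewrite !i1 /= in T1; case: (T1) => [sf1 c1 [a [k [sz hm hn ini]]]].
set NL := (2 ^ (a + a + k))%N.
have hn' : (size Q <= 2 ^ (a + k))%N by case/andP: hn.
have tc := total_cost hn'; rewrite -/NL in tc.
set s1 := run sizes s in sz ini.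
have a0 : (0 < a)%N by case: sz.
have F1 := run_frame sizes s; rewrite -/s1 in F1; have [fn1 fr1 fa1 fra1 _] := F1.
have post1 : tri sizes s (9 + 6 * size Q) (fun s' => s' = s1) by split.
pose Post s' := nv s' vout != 0%N <-> hits P Q delta (2 ^ a).-1 (2 ^ (a + k)).-1.
pose Tc := (1 + NL * (1 + circle_cost a k))%N.
pose T2 := ((1 + NL * 17) + ((5 + NL * 13) + ((1 + NL * 28) + Tc)))%N.
exists a, k, (9 + 6 * size Q + T2)%N; split; [exact: hm|exact: hn|exact: tc|].
refine (tri_seq post1 _ (leqnn _)) => _ _ ->.
have ld1 := loaded_frame F1 isT ld.
refine (tri_seq (levels_ok sz ini) _ (leqnn _)) => s2 F2 [L2 row2].
have ld2 := loaded_frame F2 isT ld1; have [fn2 fr2 fa2 fra2 _] := F2.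
have sz2 : sized s2 a k by case: sz => *; split; rewrite ?fn2.
refine (tri_seq (tree_ok sz2 L2 row2) _ (leqnn _)) => s3 F3 t3.
have ld3 := loaded_frame F3 isT ld2; have [fn3 fr3 fa3 fra3 _] := F3.
refine (tri_seq (centers_ok P0 Q0 t3 ld3) _ (leqnn _)) => s4 F4 ctr4.
have [fn4 fr4 fa4 fra4 _] := F4.
have st4 : same_tabs s3 s4 by exact: frame_same_tabs F4 isT isT.
have t4 := tabs_same st4 t3.
have xd4 : rv s4 xd = delta by rewrite fr4 // fr3 // fr2 // fr1.
have d4 : 0 < rv s4 xd by rewrite xd4.
have out4 : nv s4 vout = 0%N by rewrite fn4 // fn3 // fn2 // fn1 // i1.
refine (tri_weak (all_circles_ok a0 t4 d4 out4) (leqnn _) _) => s5 _; rewrite -/NL /Post => ->.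
have M0 := exp2_gt0 a; have N0 := exp2_gt0 (a + k).
have below x y : (x < y)%N -> (x <= y.-1)%N by lia.
have above x y : (0 < y)%N -> (x <= y.-1)%N -> (x < y)%N by lia.
have onE l x : (NL <= l < 2 * NL)%N -> on_circle s4 a k (ctr s4 l) x <->
    grid_path (fun ij => [&& (ij.1 <= (2 ^ a).-1)%N, (ij.2 <= (2 ^ (a + k)).-1)%N &
      in_disk delta (center P Q ij.1 ij.2)
        (circ delta (center P Q (row s4 l) (col s4 l)) x)]) (2 ^ a).-1 (2 ^ (a + k)).-1.
  have ctrE z : (NL <= z < 2 * NL)%N -> ctr s4 z = center P Q (row s4 z) (col s4 z).
    by move=> hz; rewrite ctr4 // /row /col !fa4.
  move=> hl; rewrite /on_circle xd4 (ctrE l hl); split; apply: grid_path_mono => -[i j].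
  - case/existsP=> z /and3P[/eqP /= <- /eqP <-].
    have hz : (NL <= NL + z < 2 * NL)%N by have := ltn_ord z; rewrite -/NL; lia.
    rewrite ctrE // => ->; have [b1 b2] := leaf_box a0 t4 hz.
    by rewrite /= !below.
  - move=> /= /and3P[b1 b2 b3].
    have b1' := above _ _ M0 b1.
    have b2' := above _ _ N0 b2.
    have [z hz [e1 e2]] := leaf_onto a0 t4 b1' b2'.
    by rewrite -e1 -e2 cell_onE // ctrE // e1 e2.
split.
- case=> l hl [x hx /(onE l x hl) h]; have [b1 b2] := leaf_box a0 t4 hl.
  by exists (row s4 l), (col s4 l), x; split=> //; exact: below.
- case=> i0 [j0 [x [b1 b2 hx h]]].
  have b1' := above _ _ M0 b1.
  have b2' := above _ _ N0 b2.
  have [z hz [e1 e2]] := leaf_onto a0 t4 b1' b2'.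
  by exists z => //; exists x => //; apply/(onE z x hz); rewrite e1 e2.
Qed.

Lemma hitsP P Q delta M N : (0 < size P <= M.+1)%N -> (0 < size Q <= N.+1)%N -> 0 < delta ->
  hits P Q delta M N <-> exists t, dfrechet P (translate Q t) <= delta.
Proof.
move=> /andP[P0 PM] /andP[Q0 QN] d0.
pose F t ij := in_disk delta ((nth (pt0 R) P ij.1).1 - (nth (pt0 R) Q ij.2).1,
                   (nth (pt0 R) P ij.1).2 - (nth (pt0 R) Q ij.2).2) t.
have key t : dfrechet P (translate Q t) <= delta <-> grid_path (fun ij =>
    [&& (ij.1 <= M)%N, (ij.2 <= N)%N & in_disk delta (center P Q ij.1 ij.2) t]) M N.
  rewrite dfrechet_le ?size_map // has_mpathE size_map.
  have := @grid_path_pad (F t) (size P).-1 (size Q).-1 M N.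
  rewrite /F /= => -> ; try lia.
  split; apply: grid_path_mono => ij; rewrite entry1_translate //.
    by case/and3P=> h1 h2 ->; rewrite andbT; apply/andP; split; lia.
  by case/and3P=> h1 h2 ->; rewrite andbT; apply/andP; split; lia.
split=> [[i0 [j0 [x [_ _ _ h]]]]|[t /key [p /and3P[h1 h2 h3]]]].
  by exists (circ delta (center P Q i0 j0) x); apply/key.
(* Only the disks of one path are kept while moving to the right; the same path then works for the
   point found on a circle. *)
pose l := [seq center P Q ij.1 ij.2 | ij <- (0%N, 0%N) :: p].
have lE c : c \in l -> exists2 ij, c = center P Q ij.1 ij.2 & (ij.1 <= M)%N && (ij.2 <= N)%N.
  by case/mapP=> ij /(allP h2) /and3P[i1 i2 _] ->; exists ij => //; rewrite i1 i2.
have [c [x [/lE [[i0 j0] -> /andP[b1 b2]] hx hc]]] :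
    exists c x, [/\ c \in l, -1 <= x <= 1 &
      forall c', c' \in l -> in_disk delta c' (circ delta c x)].
  apply: (@right_half _ delta t l (center P Q 0 0)) => //; first by rewrite inE eqxx.
  by move=> c /mapP [ij /(allP h2) /and3P[_ _ h] ->].
exists i0, j0, x; split=> //; exists p; rewrite h1 h3 andTb andbT.
apply/allP => ij hij; have /and3P[i1 i2 _] := allP h2 _ hij.
by rewrite i1 i2 /=; apply: hc; exact: (map_f (fun ij => center P Q ij.1 ij.2) hij).
Qed.
End Program.

Theorem theorem1 (R : realType) :
  exists (prog : seq instr) (C : R),
  forall (P Q : seq (pt R)) (delta : R),
    (1 <= size P)%N -> (size P <= size Q)%N -> 0 < delta ->
    exists (k : nat) (out : rmem R),
      exec prog (0%N, input_mem P Q delta) k out /\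
      ((out 0%N != 0) <-> exists t : pt R, dfrechet P (translate Q t) <= delta) /\
      k%:R <= C * (size P)%:R ^+ 3 * (size Q)%:R ^+ 2
                * (1 + ln ((size Q)%:R / (size P)%:R)).
Proof.
(* A variable in place of the constant keeps the unary numeral folded. *)
have [K eK] : exists K, K = 2700%N by eexists.
have [prog [W hW]] := ram_program R program_wf.
exists prog, (W%:R * K%:R * 64) => P Q delta P0 PQ d0.
have Q0 : (0 < size Q)%N by exact: leq_trans PQ.
have mn : (0 < size P <= size Q)%N by rewrite P0.
have [s hs hrun] := hW P Q delta P0 Q0.
have [a [k [T [hm hn hT [sf hc hpost]]]]] := program_ok mn d0 hs.
rewrite -{}eK in hT.
have [steps [out [hex hout hle]]] := hrun sf.
exists steps, out; split=> //; split.
  rewrite hout pnatr_eq0 hpost; apply: hitsP => //.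
    by rewrite P0 prednK ?exp2_gt0 //; case/andP: hm.
  by rewrite Q0 prednK ?exp2_gt0 //; case/andP: hn.
set X := ((2 ^ (a + a + k)) ^ 2 * 2 ^ a * k.+1)%N in hT.
have hX := @steps_bound R (size P) (size Q) a k (2 ^ (a + a + k)) X mn hm _ _ (leqnn _).
have {}hX := hX ltac:(by case/andP: hn) ltac:(by rewrite -expnD addnA).
have hk : (steps <= W * (K * X))%N.
  (* The strict bound on T absorbs the extra unit that pays for the prologue. *)
  by apply: leq_trans hle _; rewrite leq_mul2l (leq_trans _ hT) ?orbT // ltnS.
have {}hk : steps%:R <= W%:R * (K%:R * X%:R) :> R by rewrite -!natrM ler_nat.
apply: le_trans hk _; rewrite mulrA -!mulrA mulrA [leRHS]mulrA ler_wpM2l -?natrM //.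
by move: hX; rewrite !mulrA.
Qed.
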